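(* Let $m,n$ be positive integers with $n\ge 2$, let $1\le p\le\infty$, let $T\in\mathcal{L}(^m\ell_1;\ell_p)$ and let $A_k\in\mathcal{L}(^n\ell_\infty;\ell_1)$ for all $k=1,\ldots,m$. Let $s\ge 1$ be a real number such that the quantity $$r=\begin{cases}\dfrac{2ps}{2mp-2s+2ps-mps}, & \text{if } 1\le p\le 2,\\[2mm] \dfrac{2ps}{2mp+2s-mps}, & \text{if } 2\le p\le\infty,\end{cases}$$ has positive denominator (so that $r\in(0,\infty)$), where for $p=\infty$ the formula is read as $r=\frac{2s}{2m-ms}$, with the requirement $2m-ms>0$. Then the composition $T(A_1,\ldots,A_m)$ is absolutely $(r;2s)$-summing.
   Context: All Banach spaces are over $\mathbb{K}=\mathbb{R}$ or $\mathbb{C}$. $\mathcal{L}(^mE;F)$ is the space of all bounded $m$-linear operators $E\times\cdots\times E\to F$. The composition $T(A_1,\ldots,A_m)$ is the $mn$-linear operator $\ell_\infty\times\cdots\times\ell_\infty\to\ell_p$ given by $(x^{(1)},\ldots,x^{(mn)})\mapsto T\big(A_1(x^{(1)},\ldots,x^{(n)}),\ldots,A_m(x^{((m-1)n+1)},\ldots,x^{(mn)})\big)$. For a Banach space $E$ with closed dual unit ball $B_{E^*}$ and $1\le q<\infty$, $\ell_q^w(E)$ is the space of sequences $(x_j)_{j=1}^\infty$ in $E$ with $\|(x_j)_{j=1}^\infty\|_{w,q}:=\sup_{\varphi\in B_{E^*}}\left(\sum_{j=1}^\infty|\varphi(x_j)|^q\right)^{1/q}<\infty$. For $r\in(0,\infty)$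 and $1\le q<\infty$ with $1/r\le N/q$, a bounded $N$-linear operator $S:E_1\times\cdots\times E_N\to F$ is absolutely $(r;q)$-summing if there is a constant $C>0$ such that $\left(\sum_{j=1}^\infty\|S(x^{(1)}_{j},\ldots,x^{(N)}_{j})\|_F^r\right)^{1/r}\le C\prod_{k=1}^N\|(x^{(k)}_{j})_{j=1}^\infty\|_{w,q}$ for all $(x_j^{(k)})_{j=1}^\infty\in\ell_q^w(E_k)$, $k=1,\ldots,N$. *)

(* Defs.v *)
From HB Require Import structures.
From mathcomp Require Import all_boot all_order all_algebra.
From mathcomp Require Import finmap.
From mathcomp Require Import all_classical all_reals all_analysis.
From mathcomp Require Import ess_sup_inf complex.

Set Implicit Arguments.
Unset Strict Implicit.
Unset Printing Implicit Defensive.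
Import Order.TTheory GRing.Theory Num.Theory.
Import numFieldNormedType.Exports.
Local Open Scope classical_set_scope.
Local Open Scope ring_scope.

Variant scalars := RealScalars | ComplexScalars.

Definition scalar_field (R : realType) (k : scalars) : numFieldType :=
  match k with RealScalars => R | ComplexScalars => R[i] end.

(* In a [normedModType R[i]] the norm takes its values in R[i]; [real_part] is
   used to read norms as elements of R. *)
Definition real_part (R : realType) (k : scalars) : scalar_field R k -> R :=
  match k as k0 return scalar_field R k0 -> R with
  | RealScalars => fun x : R => x
  | ComplexScalars => fun z : R[i] => complex.Re z
  end.

Definition of_real (R : realType) (k : scalars) : R -> scalar_field R k :=
  match k as k0 return R -> scalar_field R k0 with
  | RealScalars => fun x : R => x
  | ComplexScalars => fun x : R => Complex x 0
  end.
Arguments of_real R k x : clear implicits.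

Definition rnorm (R : realType) (k : scalars)
  (V : normedModType (scalar_field R k)) (v : V) : R := real_part `|v|.

Definition modulus (R : realType) (k : scalars) (x : scalar_field R k) : R :=
  real_part `|x|.

(* The l_p (quasi-)norm of a sequence of reals; see [lnormE] and [lnormyE]. *)
Definition lnorm (R : realType) (p : \bar R) (a : nat -> R) : \bar R :=
  ('N[counting]_p [EFin \o a])%E.

Section scalar_lemmas.
Context (R : realType) (k : scalars).
Notation K := (scalar_field R k).

Lemma of_realK : cancel (of_real R k) (@real_part R k).
Proof. by case: k. Qed.

Lemma real_partK (x : K) : 0 <= x -> of_real R k (real_part x) = x.
Proof.
case: k x => //= -[a b]; rewrite lecE /= => /andP[/eqP -> _] //.
Qed.

Lemma ler_of_real (x y : R) : (of_real R k x <= of_real R k y) = (x <= y).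
Proof. by case: k => //=; rewrite lecE/= eqxx. Qed.

Lemma of_realD (x y : R) : of_real R k (x + y) = of_real R k x + of_real R k y.
Proof. by case: k => //=; apply/eqP; rewrite eq_complex/= addr0 !eqxx. Qed.

Lemma of_realM (x y : R) : of_real R k (x * y) = of_real R k x * of_real R k y.
Proof.
case: k => //=; apply/eqP.
by rewrite eq_complex/= !(mulr0, mul0r) subr0 addr0 !eqxx.
Qed.

Lemma of_real0 : of_real R k 0 = 0.
Proof. by case: k. Qed.

Lemma rnormE (V : normedModType K) (v : V) : of_real R k (rnorm v) = `|v|.
Proof. by rewrite /rnorm real_partK. Qed.

Lemma modulusE (x : K) : of_real R k (modulus x) = `|x|.
Proof. by rewrite /modulus real_partK. Qed.

Lemma modulus_ge0 (x : K) : 0 <= modulus x.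
Proof. by rewrite -ler_of_real modulusE of_real0. Qed.

Lemma modulus0 : modulus (0 : K) = 0.
Proof. by rewrite /modulus normr0 -of_real0 of_realK. Qed.

Lemma modulusD (x y : K) : modulus (x + y) <= modulus x + modulus y.
Proof. by rewrite -ler_of_real of_realD !modulusE ler_normD. Qed.

Lemma modulusM (x y : K) : modulus (x * y) = modulus x * modulus y.
Proof.
by apply: (can_inj of_realK); rewrite of_realM !modulusE normrM.
Qed.

Lemma modulus_eq0 (x : K) : modulus x = 0 -> x = 0.
Proof. by move=> x0; apply/normr0_eq0; rewrite -modulusE x0 of_real0. Qed.

Lemma rnorm_ge0 (V : normedModType K) (v : V) : 0 <= rnorm v.
Proof. by rewrite -ler_of_real rnormE of_real0. Qed.

Lemma rnormD (V : normedModType K) (u v : V) :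
  rnorm (u + v) <= rnorm u + rnorm v.
Proof. by rewrite -ler_of_real of_realD !rnormE ler_normD. Qed.

Lemma rnormZ (V : normedModType K) (c : K) (v : V) :
  rnorm (c *: v) = modulus c * rnorm v.
Proof.
by apply: (can_inj of_realK); rewrite of_realM modulusE !rnormE normrZ.
Qed.

Lemma rnorm0_eq0 (V : normedModType K) (v : V) : rnorm v = 0 -> v = 0.
Proof. by move=> v0; apply/normr0_eq0; rewrite -rnormE v0 of_real0. Qed.

End scalar_lemmas.

Section lnorm_lemmas.
Context (R : realType).
Implicit Types (a b : nat -> R).

Lemma lnormE (r : R) a : 0 < r ->
  lnorm r%:E a = ((\sum_(0 <= j <oo) (`|a j| `^ r)%:E) `^ r^-1)%E.
Proof. by move=> r0; rewrite /lnorm Lnorm_counting. Qed.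

Let counting_nat_gt0 : (0 < @counting nat R [set: nat])%E.
Proof.
rewrite /counting; case: asboolP => // fT.
by have := infinite_nat.
Qed.

Let ae_counting (P : set nat) :
  {ae (@counting nat R), forall j, P j} -> forall j, P j.
Proof.
move=> [N [_ N0 PN]] j; apply: contrapT => nPj.
suff: (0 < @counting nat R N)%E by rewrite N0 ltxx.
rewrite /counting; case: asboolP => // fN; rewrite lte_fin ltr0n lt0n cardfs_eq0.
by apply/fset0Pn; exists j; rewrite in_fset_set// inE; exact: PN.
Qed.

Lemma lnormyE a : lnorm +oo%E a = ereal_sup (range (fun j => `|a j|%:E)).
Proof.
rewrite /lnorm unlock counting_nat_gt0; apply/eqP; rewrite eq_le; apply/andP; split.
  by apply/ess_supP; apply: nearW => j /=; apply: ereal_sup_ubound; exists j.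
apply: ge_ereal_sup => _ [j _ <-].
exact: (ae_counting (ess_sup_ge counting (abse \o (EFin \o a)))).
Qed.

Lemma lnorm_ge0 p a : (0 <= lnorm p a)%E.
Proof. exact: Lnorm_ge0. Qed.

Lemma lnorm_eq0 p a : (1 <= p)%E -> lnorm p a = 0%E -> forall j, a j = 0.
Proof.
move=> p1 a0 j.
have p0 : (0 < p)%E by apply: lt_le_trans p1.
suff h : EFin \o a = \0 %[ae (@counting nat R)].
  by have [] := @ae_counting (fun i => setT i -> (EFin \o a) i = 0%E) h j I.
exact: Lnorm_eq0_eq0 a0.
Qed.

Lemma lnormD p a b : (1 <= p)%E ->
  (lnorm p (fun j => a j + b j)%R <= lnorm p a + lnorm p b)%E.
Proof. by move=> p1; apply: eminkowski. Qed.

Lemma lnormZ p (c : R) a : (1 <= p)%E -> (lnorm p a < +oo)%E ->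
  lnorm p (fun j => c * a j)%R = (`|c|%:E * lnorm p a)%E.
Proof.
move=> p1 ay.
have aL : a \in @Lfun _ nat R counting p by apply/andP; rewrite !inE.
exact: (LnormZ (Lfun_Sub p1 aL) c).
Qed.

Lemma le_lnorm p a b : (1 <= p)%E -> (forall j, 0 <= a j <= b j) ->
  (lnorm p a <= lnorm p b)%E.
Proof.
case: p => [r||//] p1 ab.
  rewrite lee_fin in p1; have r0 : 0 < r by apply: lt_le_trans p1.
  have sum_itv c : ((\sum_(0 <= j <oo) (`|c j| `^ r)%:E)%E \in `[0%E, +oo%E]).
    rewrite in_itv/= leey andbT.
    by apply: nneseries_ge0 => j _ _; rewrite lee_fin powR_ge0.
  rewrite !lnormE//; apply: gt0_ler_poweR; rewrite ?sum_itv//.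
    by rewrite invr_ge0 ltW.
  apply: lee_nneseries => [j _ _|j _]; first by rewrite lee_fin powR_ge0.
  have /andP[a0 abj] := ab j; have b0 := le_trans a0 abj.
  by rewrite lee_fin ge0_ler_powR ?nnegrE// ?(ltW r0)// !ger0_norm.
rewrite !lnormyE; apply: ge_ereal_sup => _ [j _ <-].
apply: le_trans (ereal_sup_ubound _); last by exists j.
have /andP[a0 abj] := ab j.
by rewrite lee_fin !ger0_norm// (le_trans a0).
Qed.

End lnorm_lemmas.

Definition ell_pred (R : realType) (k : scalars) (p : \bar R) :
  {pred nat -> scalar_field R k} :=
  [pred x | `[< (lnorm p (fun j => modulus (x j)) < +oo)%E >]].
Arguments ell_pred R k p : clear implicits.

Lemma ell_predP (R : realType) (k : scalars) (p : \bar R)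
    (x : nat -> scalar_field R k) :
  reflect (lnorm p (fun j => modulus (x j)) < +oo)%E (x \in ell_pred R k p).
Proof. exact: asboolP. Qed.

Section ell_submod.
Context (R : realType) (k : scalars) (p : \bar R).
Hypothesis p1 : (1 <= p)%E.
Notation K := (scalar_field R k).

Lemma ell_submod_closed : submod_closed (ell_pred R k p).
Proof.
split.
  apply/ell_predP.
  rewrite (_ : (fun _ => _) = cst 0); last first.
    by apply/funext => j /=; rewrite modulus0.
  rewrite /lnorm (_ : _ \o _ = cst 0%E); last exact/funext.
  have p0 : p != 0%E by rewrite gt_eqF// (lt_le_trans _ p1).
  by rewrite Lnorm0// ltry.
move=> c x y /ell_predP xp /ell_predP yp; apply/ell_predP.
apply: (@le_lt_trans _ _ (lnorm p (fun j =>
    modulus c * modulus (x j) + modulus (y j)))).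
  apply: le_lnorm => // j; rewrite modulus_ge0/= -modulusM; exact: modulusD.
apply: (le_lt_trans (lnormD _ _ p1)); rewrite lte_add_pinfty//.
by rewrite lnormZ// lte_mul_pinfty.
Qed.

End ell_submod.

(* The space l_p over K; its norm is [ell_norm] below.  The proof of [1 <= p]
   is a parameter so that the norm axioms hold for the type. *)
Record ell (R : realType) (k : scalars) (p : \bar R) (p1 : (1 <= p)%E) := Ell {
  ell_seq :> nat -> scalar_field R k ;
  ell_seqP : ell_seq \in ell_pred R k p }.
Arguments ell R k {p} p1.

Section ell_normed.
Context (R : realType) (k : scalars) (p : \bar R) (p1 : (1 <= p)%E).
Notation K := (scalar_field R k).
Notation ell := (ell R k p1).

HB.instance Definition _ := [isSub for @ell_seq R k p p1].
HB.instance Definition _ := [Choice of ell by <:].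
#[local] HB.instance Definition _ :=
  GRing.isSubmodClosed.Build K (nat -> K) (ell_pred R k p)
    (ell_submod_closed k p1).
HB.instance Definition _ := [SubChoice_isSubLmodule of ell by <:].

Definition ell_norm (x : ell) : K :=
  of_real R k (fine (lnorm p (fun j => modulus (x j)))).

Let lnorm_fin (x : ell) :
  (fine (lnorm p (fun j => modulus (x j))))%:E = lnorm p (fun j => modulus (x j)).
Proof.
rewrite fineK// ge0_fin_numE ?lnorm_ge0//.
exact/ell_predP/ell_seqP.
Qed.

Let lnorm_lty (x : ell) : (lnorm p (fun j => modulus (x j)) < +oo)%E.
Proof. by rewrite -lnorm_fin ltry. Qed.

Let ler_ell_normD (x y : ell) : ell_norm (x + y) <= ell_norm x + ell_norm y.
Proof.
rewrite /ell_norm -of_realD ler_of_real -lee_fin EFinD !lnorm_fin.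
apply: le_trans (lnormD _ _ p1); apply: le_lnorm => // j.
by rewrite modulus_ge0/=; exact: modulusD.
Qed.

Let ell_normZ (c : K) (x : ell) : ell_norm (c *: x) = `|c| * ell_norm x.
Proof.
rewrite /ell_norm -modulusE -of_realM; congr of_real.
apply: EFin_inj; rewrite EFinM !lnorm_fin.
rewrite -(ger0_norm (modulus_ge0 c)) -lnormZ//.
by congr lnorm; apply/funext => j; rewrite -modulusM.
Qed.

Let ell_norm_eq0 (x : ell) : ell_norm x = 0 -> x = 0.
Proof.
rewrite /ell_norm -of_real0 => /(can_inj (@of_realK R k)) x0.
apply/val_inj/funext => j; apply: modulus_eq0.
apply: (@lnorm_eq0 R p (fun i => modulus (x i))) => //.
by rewrite -lnorm_fin x0.
Qed.

HB.instance Definition _ :=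
  @Lmodule_isNormed.Build K ell ell_norm ler_ell_normD ell_normZ ell_norm_eq0.

Lemma rnorm_ell (x : ell) : (rnorm x)%:E = lnorm p (fun j => modulus (x j)).
Proof. by rewrite /rnorm (_ : `|x| = ell_norm x)// of_realK lnorm_fin. Qed.

End ell_normed.

Notation ell_1 R k := (ell R k (lexx 1%E)).
Notation ell_oo R k := (ell R k (leey 1%E)).

Section operators.
Context (R : realType) (k : scalars).
Notation K := (scalar_field R k).

Definition multilinear (N : nat) (E : 'I_N -> normedModType K)
    (F : normedModType K) (S : (forall i, E i) -> F) : Prop :=
  forall i (x : forall j, E j), linear (fun u : E i => S (dfwith x i u)).

Definition bounded_multilinear (N : nat) (E : 'I_N -> normedModType K)
    (F : normedModType K) (S : (forall i, E i) -> F) : Prop :=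
  multilinear S /\
  exists C : R, forall x, rnorm (S x) <= C * \prod_(i < N) rnorm (x i).

(* The space L(^N E; F). *)
Definition multilinear_operators (N : nat) (E F : normedModType K) :
    set (('I_N -> E) -> F) :=
  [set S | @bounded_multilinear N (fun=> E) F S].

(* The bound makes phi continuous, so this is the closed unit ball of E^*. *)
Definition dual_ball (E : normedModType K) : set {scalar E} :=
  [set phi | forall v : E, `|phi v| <= `|v|].

Definition weak_norm (E : normedModType K) (q : R) (x : nat -> E) : \bar R :=
  ereal_sup [set lnorm q%:E (fun j => modulus (phi (x j)))
            | phi in @dual_ball E].

Definition absolutely_summing (N : nat) (E : 'I_N -> normedModType K)
    (F : normedModType K) (r q : R) (S : (forall i, E i) -> F) : Prop :=
  [/\ bounded_multilinear S, 0 < r, 1 <= q, r^-1 <= N%:R / q &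
      exists2 C : R, 0 < C &
        forall x : forall i, nat -> E i,
          (forall i, (weak_norm q (x i) < +oo)%E) ->
          (lnorm r%:E (fun j => rnorm (S (fun i => x i j))) <=
             C%:E * \prod_(i < N) weak_norm q (x i))%E].

End operators.

Lemma block_index_subproof (m n : nat) (i : 'I_m) (j : 'I_n) :
  (i * n + j < m * n)%N.
Proof.
apply: (@leq_trans (i.+1 * n)); last by rewrite leq_mul2r ltn_ord orbT.
by rewrite mulSn addnC ltn_add2r.
Qed.

Definition block_index (m n : nat) (i : 'I_m) (j : 'I_n) : 'I_(m * n) :=
  Ordinal (block_index_subproof i j).

Definition block_comp (m n : nat) (E F G : Type)
    (T : ('I_m -> F) -> G) (A : 'I_m -> ('I_n -> E) -> F) :
    ('I_(m * n) -> E) -> G :=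
  fun x => T (fun i => A i (fun j => x (block_index i j))).

Definition summing_num (R : realType) (s : R) (p : \bar R) : R :=
  match p with
  | t%:E => 2 * t * s
  | +oo%E => 2 * s
  | -oo%E => 0
  end.

(* The two finite branches agree at t = 2. *)
Definition summing_denom (R : realType) (m : nat) (s : R) (p : \bar R) : R :=
  match p with
  | t%:E => if t <= 2 then 2 * m%:R * t - 2 * s + 2 * t * s - m%:R * t * s
            else 2 * m%:R * t + 2 * s - m%:R * t * s
  | +oo%E => 2 * m%:R - m%:R * s
  | -oo%E => 0
  end.

Definition summing_exponent (R : realType) (m : nat) (s : R) (p : \bar R) : R :=
  summing_num s p / summing_denom m s p.

(* Main.v *)
Require Import Defs.
From HB Require Import structures.
From mathcomp Require Import all_boot all_order all_algebra.
From mathcomp Require Import ring lra complex.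
From mathcomp Require Import all_classical all_reals all_analysis.
From mathcomp Require Import cyclic separable cyclotomic.
Set Implicit Arguments.
Unset Strict Implicit.
Unset Printing Implicit Defensive.
Import Order.TTheory GRing.Theory Num.Theory.
Import numFieldNormedType.Exports.
Import Normc.
Local Open Scope classical_set_scope.
Local Open Scope ring_scope.
Local Open Scope complex_scope.
Local Notation Re := (@complex.Re _).
Local Notation Im := (@complex.Im _).

(** A sequence of l_oo whose weak 2s-norm is at most 1 satisfies
    sum_j |x_j(t)|^(2s) <= 1 at every coordinate t, because coordinates are
    functionals of norm at most 1.  These scalar inequalities alone force
    sum_j |T(A_1(x_j), ..., A_m(x_j))|^r <= B with B independent of the
    sequences; other weak norms follow by multilinearity
    ([absolutely_summing_of_normalized]).

    Finitely many j matter at a time, so elements of l_oo can be replaced by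
    functions with finitely many values and elements of l_1 by truncations
    ([block_comp_approximation]).  Each A_k then is an array with n + 1 >= 3
    indices whose form is bounded on products of sup-norm balls, the last index
    testing l_1 against l_oo, and what remains are inequalities between finite
    complex arrays.

    The operators A_k.  For s = 1 one uses the Grothendieck inequality for
    forms of at least three variables (Blei, Tonge): such a form stays bounded
    when its arguments are Hilbert-Schmidt matrices, multiplied in order and
    closed up by a trace ([trace_chain_le], [grothendieck_blei]).  For s = oo
    plain boundedness of the form is enough, and the values of s in between
    come from interpolating along a polynomial whose exponents are dyadic
    levels of the data ([interpolated_grothendieck]).  The outcome is that
    a_j = A_k(x_j) satisfies sum_j |psi(a_j)|_2^s <= K for every
    psi : l_1 -> l_2 of norm 1 ([hilbert_summable] with exponent s / 2).

    The operator T.  If sum_j |psi(a_j)|_2^2 <= 1 for all psi and every slot,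
    then inserting the families one slot at a time gives
    sum_j |T(a_j)|_2^2 <= 1 for values in l_2 ([hilbert_multilinear]).
    Extrapolating over the dyadic levels of the coefficients of T gives, for
    values in l_p, |T(a_j)|_p <= C om_j^g with sum_j om_j <= 1, where g is
    1 - 1/p for p <= 2 and 1/p for p >= 2 ([lp_multilinear]).  For p = 1 and
    p = oo this says g = 0, which is boundedness of T.

    From s to 2.  If s < 2, Maurey's change of density ([exists_density])
    produces weights be_j for which the families be_j a_j are of the second
    kind, with 1 / be_j <= C La_j^(1/s - 1/2) and sum_j La_j <= C.  Since T has
    m slots, |T(a_j)| <= C La_j^(m/s - m/2) om_j^g, and Hoelder's inequality
    sums the powers of exponent r with 1/r = m/s - m/2 + g, which is the
    exponent of the statement.  If s >= 2 weights built from the sum to be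
    bounded serve the same purpose, and the sum is absorbed
    ([sum_power_bound]). *)

(** * Complex numbers and independent signs *)

Lemma le_of_eq d (T : porderType d) (x y : T) : x = y -> (x <= y)%O.
Proof. by move=> ->. Qed.

Section cauchy_schwarz.
Context (R : realFieldType).

Lemma sum_sqr_eq0 (I : finType) (f : I -> R) :
  \sum_i f i ^+ 2 = 0 -> forall i, f i = 0.
Proof.
move=> /eqP; rewrite psumr_eq0; last by move=> i _; exact: sqr_ge0.
by move=> /allP h i; apply/eqP; rewrite -sqrf_eq0; apply: h; rewrite mem_index_enum.
Qed.

Lemma cauchy_schwarz (I : finType) (f g : I -> R) :
  (\sum_i f i * g i) ^+ 2 <= (\sum_i f i ^+ 2) * (\sum_i g i ^+ 2).
Proof.
set A := \sum_i f i ^+ 2; set B := \sum_i g i ^+ 2; set D := \sum_i f i * g i.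
have B0 : 0 <= B by apply: sumr_ge0 => i _; exact: sqr_ge0.
have : 0 <= \sum_i (B * f i - D * g i) ^+ 2.
  by apply: sumr_ge0 => i _; exact: sqr_ge0.
have -> : \sum_i (B * f i - D * g i) ^+ 2 = B * (A * B - D ^+ 2).
  transitivity (\sum_i (B ^+ 2 * f i ^+ 2 - B * D * 2 * (f i * g i)
      + D ^+ 2 * g i ^+ 2)); first by apply: eq_bigr => i _; ring.
  rewrite !big_split/= sumrN -!mulr_sumr -/A -/B -/D; ring.
have [B_eq0 _|B_neq0] := eqVneq B 0; last first.
  by rewrite pmulr_rge0 ?lt0r ?B_neq0// subr_ge0.
rewrite /D B_eq0 mulr0 big1 ?expr0n// => i _.
by rewrite (sum_sqr_eq0 B_eq0) mulr0.
Qed.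

End cauchy_schwarz.

Section modulus_of_complex.
Context (R : rcfType).
Implicit Types (z u : R[i]) (x : R).

Lemma sqr_normc z : normc z ^+ 2 = Re z ^+ 2 + Im z ^+ 2.
Proof. by case: z => a b; rewrite /= sqr_sqrtr// addr_ge0 ?sqr_ge0. Qed.

Lemma normc_ge0 z : 0 <= normc z.
Proof. by case: z => a b; exact: sqrtr_ge0. Qed.

Lemma normc_real x : normc x%:C = `|x|.
Proof. by rewrite /= expr0n addr0 sqrtr_sqr. Qed.

Lemma normcX z n : normc (z ^+ n) = normc z ^+ n.
Proof. by elim: n => [|n IH]; rewrite ?normc1// !exprS normcM IH. Qed.

Lemma ler_normc_sum (I : Type) (s : seq I) (P : pred I) (f : I -> R[i]) :
  normc (\sum_(i <- s | P i) f i) <= \sum_(i <- s | P i) normc (f i).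
Proof.
elim/big_ind2: _ => [|x1 y1 x2 y2 h1 h2|//]; first by rewrite normc0.
by apply: le_trans (le_normcD _ _) _; exact: lerD.
Qed.

Lemma sqr_normc_scale x z : normc (x%:C * z) ^+ 2 = x ^+ 2 * normc z ^+ 2.
Proof. by rewrite normcM normc_real exprMn real_normK// num_real. Qed.

Lemma Re_sum (I : Type) (s : seq I) (P : pred I) (f : I -> R[i]) :
  Re (\sum_(i <- s | P i) f i) = \sum_(i <- s | P i) Re (f i).
Proof. exact: (big_morph (@complex.Re R) (fun z u => raddfD (@complex.Re R : {additive Rcomplex R -> R}) z u) erefl). Qed.

Lemma Im_sum (I : Type) (s : seq I) (P : pred I) (f : I -> R[i]) :
  Im (\sum_(i <- s | P i) f i) = \sum_(i <- s | P i) Im (f i).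
Proof. exact: (big_morph (@complex.Im R) (fun z u => raddfD (@complex.Im R : {additive Rcomplex R -> R}) z u) erefl). Qed.

Lemma Re_scale x z : Re (x%:C * z) = x * Re z.
Proof. by case: z => a b /=; rewrite mul0r subr0. Qed.

Lemma Im_scale x z : Im (x%:C * z) = x * Im z.
Proof. by case: z => a b /=; rewrite mul0r addr0. Qed.

Definition re_dot (D : finType) (f g : D -> R[i]) : R :=
  \sum_d (Re (f d) * Re (g d) + Im (f d) * Im (g d)).

(** Cauchy-Schwarz over the 2 #|D| real coordinates, which the boolean of the
    auxiliary index selects. *)
Lemma sqr_re_dot (D : finType) (f g : D -> R[i]) :
  re_dot f g ^+ 2 <=
    (\sum_d normc (f d) ^+ 2) * (\sum_d normc (g d) ^+ 2).
Proof.
pose co (h : D -> R[i]) (p : D * bool) := if p.2 then Re (h p.1) else Im (h p.1).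
have sumE (F : D -> bool -> R) : \sum_d (F d true + F d false) =
    \sum_(p : D * bool) F p.1 p.2.
  by rewrite -(pair_bigA _ (fun d b => F d b))/=; apply: eq_bigr => d _; rewrite big_bool.
have sqE h : \sum_d normc (h d) ^+ 2 = \sum_p co h p ^+ 2.
  rewrite -(sumE (fun d b => co h (d, b) ^+ 2)) /=.
  by apply: eq_bigr => d _; rewrite sqr_normc.
rewrite !sqE /re_dot (sumE (fun d b => co f (d, b) * co g (d, b)))/=.
apply: le_trans (cauchy_schwarz _ _).
by apply: le_of_eq; congr (_ ^+ 2); apply: eq_bigr => -[].
Qed.

Lemma sum_sqr_normcD (D : finType) (f g : D -> R[i]) :
  \sum_d normc (f d + g d) ^+ 2 =
    \sum_d normc (f d) ^+ 2 + 2 * re_dot f g + \sum_d normc (g d) ^+ 2.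
Proof.
rewrite /re_dot mulr_sumr -!big_split/=; apply: eq_bigr => d _.
by rewrite !sqr_normc; case: (f d) (g d) => a b [a' b'] /=; ring.
Qed.

Lemma re_dotN (D : finType) (f g : D -> R[i]) :
  re_dot f (fun d => - g d) = - re_dot f g.
Proof.
by rewrite /re_dot -sumrN; apply: eq_bigr => d _; case: (g d) => a b /=; ring.
Qed.

End modulus_of_complex.

Section rademacher.
Context (R : rcfType).

Definition orthogonal_signs (v w : nat) (E : 'I_v -> 'I_w -> R) :=
  forall a b, \sum_o E a o * E b o = w%:R * (a == b)%:R.

Lemma second_moment_real v w (E : 'I_v -> 'I_w -> R) (x : 'I_v -> R) :
  orthogonal_signs E ->
  \sum_o (\sum_a E a o * x a) ^+ 2 = w%:R * \sum_a x a ^+ 2.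
Proof.
move=> orthE; transitivity (\sum_o \sum_a \sum_b x a * x b * (E a o * E b o)).
  apply: eq_bigr => o _; rewrite expr2 big_distrl/=; apply: eq_bigr => a _.
  by rewrite big_distrr/=; apply: eq_bigr => b _; ring.
rewrite exchange_big mulr_sumr; apply: eq_bigr => a _; rewrite exchange_big/=.
under eq_bigr => b _ do rewrite -mulr_sumr orthE.
rewrite (bigD1 a)//= eqxx/= mulr1 big1 ?addr0; first by ring.
by move=> b; rewrite eq_sym => /negPf ->; rewrite !mulr0.
Qed.

Lemma second_moment v w (E : 'I_v -> 'I_w -> R) (u : 'I_v -> R[i]) :
  orthogonal_signs E ->
  \sum_o normc (\sum_a (E a o)%:C * u a) ^+ 2 = w%:R * \sum_a normc (u a) ^+ 2.
Proof.
move=> orthE.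
transitivity (\sum_o ((\sum_a E a o * Re (u a)) ^+ 2
    + (\sum_a E a o * Im (u a)) ^+ 2)).
  apply: eq_bigr => o _; rewrite sqr_normc Re_sum Im_sum.
  by congr (_ ^+ 2 + _ ^+ 2); apply: eq_bigr => a _; rewrite (Re_scale, Im_scale).
rewrite big_split/= !second_moment_real// -mulrDr -big_split/=.
by congr (_ * _); apply: eq_bigr => a _; rewrite sqr_normc.
Qed.

(** The rows are Rademacher functions, and the last claim is the comparison of
    fourth and second moments of Hilbert-valued Rademacher sums.  A new row is
    added by doubling the columns: with S a column sum of the old rows and u the
    new vector, |S + u|^2 and |S - u|^2 have the same cross term up to sign, so
    their squares add up to at most 2 (|S|^4 + 6 |S|^2 |u|^2 + |u|^4). *)
Lemma rademacher_signs (v : nat) : exists w (E : 'I_v -> 'I_w -> R),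
  [/\ (0 < w)%N, orthogonal_signs E &
   forall (D : finType) (u : 'I_v -> D -> R[i]),
    \sum_o (\sum_d normc (\sum_a (E a o)%:C * u a d) ^+ 2) ^+ 2 <=
      3 * w%:R * (\sum_a \sum_d normc (u a d) ^+ 2) ^+ 2].
Proof.
elim: v => [|v [w [E [w0 orthE E4]]]].
  exists 1%N, (fun _ _ => 1); split=> // [[]//|D u].
  by rewrite !big_ord0 big_ord1 big1 ?expr0n ?mulr0// => d _; rewrite big_ord0 normc0 expr0n.
pose sgn (o : 'I_(w + w)) : R := if fintype.split o is inl _ then 1 else -1.
pose red (o : 'I_(w + w)) := match fintype.split o with inl p => p | inr p => p end.
pose E' (a : 'I_v.+1) (o : 'I_(w + w)) :=
  if unlift ord0 a is Some a' then E a' (red o) else sgn o.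
have splitl (o : 'I_w) : fintype.split (lshift w o) = inl o by rewrite -[lshift w o]/(unsplit (inl o)) unsplitK.
have splitr (o : 'I_w) : fintype.split (rshift w o) = inr o by rewrite -[rshift w o]/(unsplit (inr o)) unsplitK.
have E'0 o : E' ord0 o = sgn o by rewrite /E' unlift_none.
have E'S a o : E' (lift ord0 a) o = E a (red o) by rewrite /E' liftK.
exists (w + w)%N, E'; split=> [|a b|D u]; first by rewrite addn_gt0 w0.
  rewrite big_split_ord/= natrD.
  case: (unliftP ord0 a) => [a'|] ->; case: (unliftP ord0 b) => [b'|] ->;
    under eq_bigr => o _ do rewrite ?E'0 ?E'S /sgn /red splitl;
    under [X in _ + X]eq_bigr => o _ do rewrite ?E'0 ?E'S /sgn /red splitr.
  - by rewrite !orthE (inj_eq (@lift_inj _ ord0)); ring.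
  - rewrite -big_split big1/= => [|o _]; last by ring.
    by rewrite mulr0.
  - rewrite -big_split big1/= => [|o _]; last by ring.
    by rewrite mulr0.
  - by rewrite eqxx mulrNN mulr1 !sumr_const card_ord mulr1.
pose P (o : 'I_w) := \sum_d normc (\sum_a (E a o)%:C * u (lift ord0 a) d) ^+ 2.
pose Q := \sum_d normc (u ord0 d) ^+ 2.
pose A := \sum_a \sum_d normc (u (lift ord0 a) d) ^+ 2.
have sumP : \sum_o P o = w%:R * A.
  rewrite /P /A exchange_big/=; under eq_bigr => d _ do rewrite second_moment//.
  by rewrite -mulr_sumr exchange_big.
rewrite big_split_ord/= -big_split/= [X in _ <= _ * X ^+ 2]big_ord_recl -/A -/Q.
have le_o (o : 'I_w) : true ->
   (\sum_d normc (\sum_a (E' a (lshift w o))%:C * u a d) ^+ 2) ^+ 2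
   + (\sum_d normc (\sum_a (E' a (rshift w o))%:C * u a d) ^+ 2) ^+ 2
   <= 2 * (P o ^+ 2 + 6 * P o * Q + Q ^+ 2).
  move=> _; pose S d := \sum_a (E a o)%:C * u (lift ord0 a) d.
  have -> : \sum_d normc (\sum_a (E' a (lshift w o))%:C * u a d) ^+ 2 =
     \sum_d normc (S d + u ord0 d) ^+ 2.
    apply: eq_bigr => d _; rewrite big_ord_recl E'0 /sgn splitl mul1r addrC.
    congr (normc (_ + _) ^+ 2).
    by apply: eq_bigr => a _; rewrite E'S /red splitl.
  have -> : \sum_d normc (\sum_a (E' a (rshift w o))%:C * u a d) ^+ 2 =
     \sum_d normc (S d - u ord0 d) ^+ 2.
    apply: eq_bigr => d _; rewrite big_ord_recl E'0 /sgn splitr rmorphN mulN1r addrC.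
    congr (normc (_ + _) ^+ 2).
    by apply: eq_bigr => a _; rewrite E'S /red splitr.
  rewrite (sum_sqr_normcD S (u ord0)) (sum_sqr_normcD S (fun d => - u ord0 d)).
  rewrite re_dotN; under [\sum_d normc (- _) ^+ 2]eq_bigr do rewrite normcN.
  rewrite -/(P o) -/Q; have := sqr_re_dot S (u ord0); rewrite -/(P o) -/Q => h.
  nra.
apply: (le_trans (ler_sum _ le_o)).
rewrite -mulr_sumr !big_split/= sumr_const card_ord -mulr_suml -mulr_sumr sumP.
have := E4 D (fun a => u (lift ord0 a)); rewrite -/A => h.
have w0' : 0 <= w%:R :> R by exact: ler0n.
have Q0 : 0 <= Q by apply: sumr_ge0 => d _; exact: sqr_ge0.
have h1 : \sum_o P o ^+ 2 <= 3 * w%:R * A ^+ 2 by exact: h.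
rewrite natrD -[Q ^+ 2 *+ w]mulr_natl.
have := mulr_ge0 w0' (sqr_ge0 Q); nra.
Qed.

End rademacher.

(** * Forms of arrays, and chains of matrices *)

(** The counterpart of [all] for predicates, such as sup-norm bounds on
    functions, that are not boolean. *)
Fixpoint allp (T : Type) (P : T -> Prop) (s : seq T) : Prop :=
  if s is x :: s' then P x /\ allp P s' else True.

Lemma allp_cat T (P : T -> Prop) s1 s2 :
  allp P (s1 ++ s2) <-> allp P s1 /\ allp P s2.
Proof. by elim: s1 => [|x s1 IH] /=; tauto. Qed.

Lemma allp_rcons T (P : T -> Prop) s x : allp P (rcons s x) <-> allp P s /\ P x.
Proof. by rewrite -cats1 allp_cat/=; tauto. Qed.

Lemma allp_map T T' (f : T -> T') (P : T' -> Prop) s :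
  allp P (map f s) <-> allp (fun x => P (f x)) s.
Proof. by elim: s => [|x s IH] //=; tauto. Qed.

Lemma sub_allp T (P Q : T -> Prop) s :
  (forall x, P x -> Q x) -> allp P s -> allp Q s.
Proof. by move=> PQ; elim: s => //= x s IH [/PQ ? /IH]. Qed.

Section multilinear_arrays.
Context (A : comNzRingType) (X : finType).
Implicit Types (b : seq X -> A) (phi : X -> A) (phis : seq (X -> A)).

(** An array is a function of index sequences of unspecified length, so that
    arrays of all arities share a type and a form is a fold over its
    arguments. *)
Definition plug b phi : seq X -> A := fun s => \sum_x phi x * b (x :: s).

Definition mform b phis : A := foldl plug b phis [::].

Lemma mform_cat b phis1 phis2 : mform b (phis1 ++ phis2) = mform (foldl plug b phis1) phis2.
Proof. by rewrite /mform foldl_cat. Qed.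

Lemma plug_sum (I : finType) (f : I -> A) (B : I -> seq X -> A) phi :
  plug (fun s => \sum_i f i * B i s) phi = (fun s => \sum_i f i * plug (B i) phi s).
Proof.
apply/funext => s; rewrite /plug.
under eq_bigr => x _ do rewrite mulr_sumr.
rewrite exchange_big/=; apply: eq_bigr => i _; rewrite mulr_sumr.
by apply: eq_bigr => x _; rewrite mulrCA.
Qed.

Lemma foldl_plug_sum (I : finType) (f : I -> A) (B : I -> seq X -> A) phis :
  foldl plug (fun s => \sum_i f i * B i s) phis =
  (fun s => \sum_i f i * foldl plug (B i) phis s).
Proof. by elim: phis B => //= phi phis IH B; rewrite plug_sum IH. Qed.

Lemma mform_sum (I : finType) (f : I -> A) (B : I -> seq X -> A) phis :
  mform (fun s => \sum_i f i * B i s) phis = \sum_i f i * mform (B i) phis.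
Proof. by rewrite /mform foldl_plug_sum. Qed.

Lemma plug_slot (I : finType) (f : I -> A) b (Phi : I -> X -> A) :
  plug b (fun x => \sum_i f i * Phi i x) = (fun s => \sum_i f i * plug b (Phi i) s).
Proof.
apply/funext => s; rewrite /plug.
under eq_bigr => x _ do rewrite mulr_suml.
rewrite exchange_big/=; apply: eq_bigr => i _; rewrite mulr_sumr.
by apply: eq_bigr => x _; rewrite mulrA.
Qed.

Lemma mform_slot (I : finType) (f : I -> A) b (Phi : I -> X -> A) phis1 phis2 :
  mform b (phis1 ++ (fun x => \sum_i f i * Phi i x) :: phis2) =
  \sum_i f i * mform b (phis1 ++ Phi i :: phis2).
Proof.
rewrite mform_cat /mform/= plug_slot foldl_plug_sum.
by apply: eq_bigr => i _; rewrite /mform foldl_cat.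
Qed.

Lemma plugZ (c : A) b phi : plug (fun s => c * b s) phi = (fun s => c * plug b phi s).
Proof. by apply/funext => s; rewrite /plug mulr_sumr; apply: eq_bigr => x _; rewrite mulrCA. Qed.

Lemma mformZ (c : A) b phis : mform (fun s => c * b s) phis = c * mform b phis.
Proof. by rewrite /mform; elim: phis b => //= phi phis IH b; rewrite plugZ IH. Qed.

Lemma mform_cons b phi phis :
  mform b (phi :: phis) = \sum_x phi x * mform (fun s => b (x :: s)) phis.
Proof. by rewrite -mform_sum. Qed.

Lemma mformZ_prefix (c : A) b phis tl :
  mform b (map (fun phi x => c * phi x) phis ++ tl) = c ^+ size phis * mform b (phis ++ tl).
Proof.
elim: phis b => [|phi phis IH] b; first by rewrite mul1r.
rewrite /= !mform_cons mulr_sumr; apply: eq_bigr => x _.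
by rewrite IH exprS; ring.
Qed.

Lemma mformZ_all (c : A) b phis :
  mform b (map (fun phi x => c * phi x) phis) = c ^+ size phis * mform b phis.
Proof. by have := mformZ_prefix c b phis [::]; rewrite !cats0. Qed.

End multilinear_arrays.

Section matrix_arrays.
Context (R : realType) (X : finType) (v : nat).
Local Notation C := R[i].
Implicit Types (b : seq X -> C) (M : X -> 'M[C]_v) (Ms : seq (X -> 'M[C]_v)).

(** The form of b evaluated at matrices, the values being multiplied in the
    order of the slots. *)
Fixpoint mxform b Ms : 'M[C]_v :=
  if Ms is M :: Ms' then \sum_x M x *m mxform (fun s => b (x :: s)) Ms'
  else (b [::])%:M.

Lemma mxform_sum (I : finType) (f : I -> C) (B : I -> seq X -> C) Ms :
  mxform (fun s => \sum_i f i * B i s) Ms = \sum_i f i *: mxform (B i) Ms.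
Proof.
elim: Ms B => [|M Ms IH] B /=.
  rewrite raddf_sum; apply: eq_bigr => i _.
  by rewrite scale_scalar_mx.
under eq_bigr => x _ do rewrite IH mulmx_sumr.
rewrite exchange_big/=; apply: eq_bigr => i _; rewrite scaler_sumr.
by apply: eq_bigr => x _; rewrite scalemxAr.
Qed.

Lemma mxform_entry b M Ms a c :
  mxform b (M :: Ms) a c = \sum_e mxform (plug b (fun x => M x a e)) Ms e c.
Proof.
rewrite /= summxE.
transitivity (\sum_x \sum_e M x a e * mxform (fun s => b (x :: s)) Ms e c).
  apply: eq_bigr => x _.
  by rewrite mxE.
rewrite exchange_big/=; apply: eq_bigr => e _.
by rewrite mxform_sum summxE; apply: eq_bigr => x _; rewrite [RHS]mxE.
Qed.

Lemma mxform_slotD b Ms1 M M' Ms2 :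
  mxform b (Ms1 ++ (fun x => M x + M' x) :: Ms2) =
  mxform b (Ms1 ++ M :: Ms2) + mxform b (Ms1 ++ M' :: Ms2).
Proof.
elim: Ms1 b => [|M1 Ms1 IH] b /=; rewrite -big_split/=; apply: eq_bigr => x _.
  by rewrite mulmxDl.
by rewrite IH mulmxDr.
Qed.

Lemma mxform_slotZ b Ms1 (c : C) M Ms2 :
  mxform b (Ms1 ++ (fun x => c *: M x) :: Ms2) = c *: mxform b (Ms1 ++ M :: Ms2).
Proof.
elim: Ms1 b => [|M1 Ms1 IH] b /=; rewrite scaler_sumr; apply: eq_bigr => x _.
  by rewrite scalemxAl.
by rewrite IH scalemxAr.
Qed.

(** The square of the Hilbert-Schmidt norm. *)
Definition hs2 w w' (M : 'M[C]_(w, w')) : R := \sum_a \sum_c normc (M a c) ^+ 2.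

End matrix_arrays.

Section hilbert_schmidt.
Context (R : realType).
Local Notation C := R[i].

Lemma hs2_ge0 v w (M : 'M[C]_(v, w)) : 0 <= hs2 M.
Proof. by apply: sumr_ge0 => a _; apply: sumr_ge0 => c _; exact: sqr_ge0. Qed.

Lemma hs2Z v w c (M : 'M[C]_(v, w)) : hs2 (c *: M) = normc c ^+ 2 * hs2 M.
Proof.
rewrite /hs2 mulr_sumr; apply: eq_bigr => a _; rewrite mulr_sumr.
by apply: eq_bigr => e _; rewrite mxE normcM exprMn.
Qed.

Lemma sqr_normc_sum_mul (I : finType) (f g : I -> C) :
  normc (\sum_i f i * g i) ^+ 2 <=
    (\sum_i normc (f i) ^+ 2) * (\sum_i normc (g i) ^+ 2).
Proof.
apply: le_trans (cauchy_schwarz _ _); rewrite ler_sqr ?nnegrE ?normc_ge0//.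
  by apply: le_trans (ler_normc_sum _ _ _) _; apply: ler_sum => i _; rewrite normcM.
by apply: sumr_ge0 => i _; rewrite mulr_ge0 ?normc_ge0.
Qed.

Lemma hs2_mul v w u (M : 'M[C]_(v, w)) (M' : 'M[C]_(w, u)) :
  hs2 (M *m M') <= hs2 M * hs2 M'.
Proof.
rewrite /hs2 mulr_suml; apply: ler_sum => a _.
rewrite [X in _ <= _ * X]exchange_big/= mulr_sumr; apply: ler_sum => c _.
rewrite mxE; exact: sqr_normc_sum_mul.
Qed.

Lemma hs2_sum v w (I : finType) (M : I -> 'M[C]_(v, w)) :
  hs2 (\sum_i M i) <= #|I|%:R * \sum_i hs2 (M i).
Proof.
rewrite /hs2 [X in _ <= _ * X]exchange_big/= mulr_sumr; apply: ler_sum => a _.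
rewrite [X in _ <= _ * X]exchange_big/= mulr_sumr; apply: ler_sum => c _.
rewrite summxE.
have := sqr_normc_sum_mul (fun=> 1 : C) (fun i => M i a c).
under [\sum_i 1 * _]eq_bigr do rewrite mul1r.
by rewrite normc1 expr1n sumr_const -[X in X%:R]/#|I|.
Qed.

Lemma sqr_normc_trace_mul v (M M' : 'M[C]_v) :
  normc (\tr (M *m M')) ^+ 2 <= hs2 M * hs2 M'.
Proof.
rewrite /mxtrace; under eq_bigr do rewrite mxE.
rewrite pair_bigA/=.
apply: le_trans (sqr_normc_sum_mul (fun p => M p.1 p.2) (fun p => M' p.2 p.1)) _.
rewrite -(pair_bigA _ (fun a c => normc (M a c) ^+ 2))/=.
by rewrite -(pair_bigA _ (fun a c => normc (M' c a) ^+ 2))/= [X in _ * X]exchange_big.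
Qed.

End hilbert_schmidt.

(** * Traces of chains of Hilbert-Schmidt matrices *)

Section projective_boundedness.
Context (R : realType) (X : finType).
Local Notation C := R[i].
Implicit Types (b : seq X -> C).

(** For arity N this is the norm of the array in the injective tensor product of
    N copies of l_1, the entries of length N being the only ones that count. *)
Definition sup_bounded (N : nat) (K : R) b :=
  forall phis : seq (X -> C), size phis = N ->
    allp (fun phi => forall x, normc (phi x) <= 1) phis ->
    normc (mform b phis) <= K.

Lemma sup_bounded_plug N K b (rho : R) phi : 0 < rho ->
  sup_bounded N.+1 K b -> (forall x, normc (phi x) <= rho) ->
  sup_bounded N (rho * K) (plug b phi).
Proof.
move=> rho0 bK phi_rho phis sz hphis.
pose phi' x := (rho^-1)%:C * phi x.
have -> : plug b phi = (fun s => rho%:C * plug b phi' s).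
  apply/funext => s; rewrite /plug mulr_sumr; apply: eq_bigr => x _.
  by rewrite /phi' !mulrA -rmorphM divff ?gt_eqF// mul1r.
rewrite mformZ normcM normc_real gtr0_norm// ler_pM2l//.
apply: (bK (phi' :: phis)) => /=; first by rewrite sz.
split=> // x; rewrite /phi' normcM normc_real ger0_norm ?invr_ge0 ?(ltW rho0)//.
by rewrite mulrC ler_pdivrMr// mul1r.
Qed.

(** An entry of the product is a sum over the intermediate indices, which are
    v^(N-1) in number; each term is a value of the scalar form. *)
Lemma mxform_entry_bounded v (rho K : R) Ms b : 0 < rho ->
  sup_bounded (size Ms) K b ->
  allp (fun M : X -> 'M[C]_v => forall x a c, normc (M x a c) <= rho) Ms ->
  forall a c, normc (mxform b Ms a c) <= v%:R ^+ (size Ms).-1 * rho ^+ size Ms * K.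
Proof.
move=> rho0; elim: Ms b K => [|M Ms IH] b K bK.
  move=> _ a c; rewrite /= mulr1 mul1r mxE.
  have := bK [::] erefl I; rewrite /mform/= => h.
  by case: eqP => _; rewrite ?mulr1n// mulr0n normc0 (le_trans (normc_ge0 _) h).
move=> /= [M_rho Ms_rho] a c.
have bK' e : sup_bounded (size Ms) (rho * K) (plug b (fun x => M x a e)).
  by apply: sup_bounded_plug.
case: Ms IH bK Ms_rho bK' => [|M' Ms] IH bK Ms_rho bK'.
  rewrite -/(mxform b [:: M]) mxform_entry expr0 mul1r expr1 (bigD1 c)//=.
  rewrite big1 => [|e ec]; last by rewrite mxE (negPf ec).
  rewrite addr0 mxE eqxx mulr1n.
  exact: (bK' c [::] erefl I).
rewrite -/(mxform b [:: M, M' & Ms]) mxform_entry.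
apply: le_trans (ler_normc_sum _ _ _) _.
have : \sum_e normc (mxform (plug b (fun x => M x a e)) (M' :: Ms) e c) <=
    \sum_(e < v) v%:R ^+ (size Ms) * rho ^+ (size Ms).+1 * (rho * K).
  by apply: ler_sum => e _; apply: IH.
by move=> /le_trans; apply; rewrite sumr_const card_ord -[leLHS]mulr_natl !exprS; apply: le_of_eq; ring.
Qed.

Lemma mxform_trace_bounded v (rho K : R) Ms b : 0 < rho -> (0 < size Ms)%N ->
  sup_bounded (size Ms) K b ->
  allp (fun M : X -> 'M[C]_v => forall x a c, normc (M x a c) <= rho) Ms ->
  normc (\tr (mxform b Ms)) <= (v%:R * rho) ^+ size Ms * K.
Proof.
move=> rho0 Ms0 bK Ms_rho; rewrite /mxtrace.
apply: le_trans (ler_normc_sum _ _ _) _.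
have : \sum_a normc (mxform b Ms a a) <=
    \sum_(a < v) v%:R ^+ (size Ms).-1 * rho ^+ size Ms * K.
  by apply: ler_sum => e _; apply: mxform_entry_bounded.
move=> /le_trans; apply; rewrite sumr_const card_ord -[leLHS]mulr_natl exprMn !mulrA.
by rewrite -exprS prednK.
Qed.

(** Any bound that does not depend on the size of the matrices will do: it only
    starts the iteration of [trace_chain_le]. *)
Fixpoint crude_bound N b : R :=
  if N is N'.+1 then #|X|%:R * \sum_x crude_bound N' (fun s => b (x :: s))
  else normc (b [::]) ^+ 2.

Lemma crude_bound_ge0 N b : 0 <= crude_bound N b.
Proof.
elim: N b => [|N IH] b /=; first exact: sqr_ge0.
by rewrite mulr_ge0// sumr_ge0.
Qed.

Definition hs_unit v (M : X -> 'M[C]_v) := forall x, hs2 (M x) <= 1.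

Lemma hs2_mul_mxform v Ms b (Z : 'M[C]_v) : allp (@hs_unit v) Ms ->
  hs2 (Z *m mxform b Ms) <= crude_bound (size Ms) b * hs2 Z.
Proof.
elim: Ms b Z => [|M Ms IH] b Z /=.
  by rewrite mul_mx_scalar hs2Z.
move=> [M1 Ms1]; rewrite mulmx_sumr; apply: le_trans (hs2_sum _) _.
rewrite -mulrA ler_wpM2l// mulr_suml; apply: ler_sum => x _.
rewrite mulmxA; apply: le_trans (IH _ _ Ms1) _.
rewrite ler_wpM2l ?crude_bound_ge0//; apply: le_trans (hs2_mul _ _) _.
by rewrite ler_piMr ?hs2_ge0.
Qed.

Lemma hs2_mxform_cons v M Ms b : hs_unit M -> allp (@hs_unit v) Ms ->
  hs2 (mxform b (M :: Ms)) <= crude_bound (size Ms).+1 b.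
Proof.
move=> M1 Ms1 /=; apply: le_trans (hs2_sum _) _.
rewrite ler_wpM2l//; apply: ler_sum => x _.
apply: le_trans (hs2_mul_mxform _ _ Ms1) _.
by rewrite ler_piMr ?crude_bound_ge0.
Qed.

(** The constant has to hold for matrices of every size v. *)
Definition chain_bound N b (K : R) := forall v (Ms : seq (X -> 'M[C]_v)),
  size Ms = N -> allp (@hs_unit v) Ms -> normc (\tr (mxform b Ms)) <= K.

Lemma crude_chain_bound N b :
  chain_bound N.+2 b (\sum_x (1 + crude_bound N.+1 (fun s => b (x :: s)))).
Proof.
move=> v [|M [|M' Ms]]// [sz] [M1 [M'1 Ms1]].
rewrite -/(mxform b [:: M, M' & Ms]) [mxform _ _]/= -/(mxform _ (M' :: Ms)) raddf_sum/=.
apply: le_trans (ler_normc_sum _ _ _) _; apply: ler_sum => x _.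
set b' := fun s => b (x :: s).
have h1 := sqr_normc_trace_mul (M x) (mxform b' (M' :: Ms)).
have h2 : hs2 (mxform b' (M' :: Ms)) <= crude_bound N.+1 b'.
  by rewrite -sz; exact: hs2_mxform_cons.
have h3 := crude_bound_ge0 N.+1 b'.
have h4 : normc (\tr (M x *m mxform b' (M' :: Ms))) ^+ 2 <= crude_bound N.+1 b'.
  apply: le_trans h1 _; apply: le_trans h2.
  by rewrite ler_piMl ?hs2_ge0.
move: (normc_ge0 (\tr (M x *m mxform b' (M' :: Ms)))) h4 => /=.
set t := normc _; set k := crude_bound _ _ in h3 *; nra.
Qed.

Lemma chain_bound_slot N b K v (eps : R) Ms1 (M : X -> 'M[C]_v) Ms2 : 0 < eps ->
  chain_bound N b K -> size (Ms1 ++ M :: Ms2) = N ->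
  allp (@hs_unit v) Ms1 -> allp (@hs_unit v) Ms2 ->
  (forall x, hs2 (M x) <= eps ^+ 2) ->
  normc (\tr (mxform b (Ms1 ++ M :: Ms2))) <= eps * K.
Proof.
move=> e0 bK sz h1 h2 hM.
have -> : M = (fun x => eps%:C *: ((eps^-1)%:C *: M x)).
  by apply/funext => x; rewrite scalerA -rmorphM divff ?gt_eqF// scale1r.
rewrite mxform_slotZ mxtraceZ normcM normc_real gtr0_norm// ler_pM2l//.
apply: bK; first by move: sz; rewrite !size_cat.
apply/allp_cat; split=> //=; split=> // x.
rewrite hs2Z normc_real real_normK ?num_real// exprVn mulrC ler_pdivrMr ?mul1r//.
by rewrite exprn_gt0.
Qed.

End projective_boundedness.

Section randomization.
Context (R : realType) (X : finType) (v w : nat) (E : 'I_v -> 'I_w -> R).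
Hypothesis w0 : (0 < w)%N.
Hypothesis orthE : orthogonal_signs E.
Local Notation C := R[i].

Let Em : 'M[C]_(v, w) := \matrix_(a, o) (E a o)%:C.
Let wR0 : 0 < w%:R :> R. Proof. by rewrite ltr0n. Qed.

(** Conjugation by the isometry E / sqrt w: it preserves products, traces and
    Hilbert-Schmidt norms, and spreads the mass of a matrix evenly over the
    entries, as the fourth moments show. *)
Definition randomize (M : 'M[C]_v) : 'M[C]_w :=
  ((w%:R)^-1)%:C *: (Em^T *m M *m Em).

Let EmEmT : Em *m Em^T = (w%:R)%:C%:M.
Proof.
apply/matrixP => a b; rewrite mxE; under eq_bigr do rewrite !mxE -rmorphM.
rewrite -rmorph_sum orthE mxE; case: eqP => _; rewrite ?mulr1// mulr0.
by rewrite rmorph0.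
Qed.

Let wVw : ((w%:R)^-1)%:C * (w%:R)%:C = 1 :> C.
Proof. by rewrite -rmorphM mulVf ?gt_eqF. Qed.

Lemma trace_randomize M : \tr (randomize M) = \tr M.
Proof.
rewrite /randomize mxtraceZ mxtrace_mulC mulmxA EmEmT mul_scalar_mx mxtraceZ.
by rewrite mulrA wVw mul1r.
Qed.

Lemma mxform_randomize (b : seq X -> C) M Ms :
  mxform b (map (fun M x => randomize (M x)) (M :: Ms)) =
  randomize (mxform b (M :: Ms)).
Proof.
have sumE (Y : X -> 'M[C]_v) : randomize (\sum_x Y x) = \sum_x randomize (Y x).
  by rewrite /randomize mulmx_sumr mulmx_suml scaler_sumr.
elim: Ms M b => [|M' Ms IH] M b.
  rewrite /= sumE; apply: eq_bigr => x _; rewrite !mul_mx_scalar /randomize.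
  by rewrite -scalemxAr -scalemxAl !scalerA mulrC.
rewrite /=  in IH *; rewrite sumE; apply: eq_bigr => x _.
rewrite (IH M' (fun s => b (x :: s))).
set Y := \sum_y _; rewrite /randomize -!scalemxAl -!scalemxAr scalerA.
rewrite -(mulmxA _ Em) (mulmxA Em) (mulmxA Em) EmEmT mul_scalar_mx.
rewrite -!scalemxAl -!scalemxAr scalerA -mulrA wVw mulr1.
by rewrite !mulmxA.
Qed.

Let randE M o o' : randomize M o o' =
  ((w%:R)^-1)%:C * \sum_a (E a o)%:C * \sum_b (E b o')%:C * M a b.
Proof.
rewrite !mxE; congr (_ * _).
under eq_bigr => b _ do rewrite !mxE mulr_suml.
rewrite exchange_big/=; apply: eq_bigr => a _; rewrite mulr_sumr.
by apply: eq_bigr => b _; rewrite !mxE; ring.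
Qed.

Lemma hs2_randomize M : hs2 (randomize M) = hs2 M.
Proof.
rewrite /hs2; under eq_bigr => o _ do (under eq_bigr => o' _ do rewrite randE sqr_normc_scale).
rewrite exchange_big/=; under eq_bigr => o' _ do rewrite -mulr_sumr second_moment//.
rewrite -!mulr_sumr exchange_big/=.
under eq_bigr => a _ do rewrite second_moment//.
rewrite -mulr_sumr !mulrA [X in X * _](_ : _ = 1) ?mul1r//.
by field; rewrite gt_eqF.
Qed.

Hypothesis E4 : forall (D : finType) (u : 'I_v -> D -> C),
    \sum_o (\sum_d normc (\sum_a (E a o)%:C * u a d) ^+ 2) ^+ 2 <=
      3 * w%:R * (\sum_a \sum_d normc (u a d) ^+ 2) ^+ 2.

(** The moment inequality for signs, once for the rows and once for the
    columns. *)
Lemma fourth_moment_randomize M :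
  \sum_o \sum_o' normc (randomize M o o') ^+ 4 <= 9 / w%:R ^+ 2 * hs2 M ^+ 2.
Proof.
pose z o' a := \sum_b (E b o')%:C * M a b.
have sum_unit (f : unit -> R) : \sum_d f d = f tt.
  by rewrite (big_pred1 tt)//; case.
have h1 o' : \sum_o normc (\sum_a (E a o)%:C * z o' a) ^+ 4 <=
    3 * w%:R * (\sum_a normc (z o' a) ^+ 2) ^+ 2.
  have := E4 (fun a (_ : unit) => z o' a).
  under eq_bigr => o _ do rewrite sum_unit -exprM.
  by under [X in _ <= _ * X ^+ 2]eq_bigr => a _ do rewrite sum_unit.
have h2 := E4 (fun b a => M a b); rewrite -/(z _ _) in h2.
under eq_bigr => o _ do (under eq_bigr => o' _ do
  rewrite randE -/(z _ _) normcM normc_real ger0_norm ?invr_ge0// exprMn).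
rewrite exchange_big/=; under eq_bigr => o' _ do rewrite -mulr_sumr.
rewrite -mulr_sumr.
have : \sum_o' \sum_o normc (\sum_a (E a o)%:C * z o' a) ^+ 4 <=
    3 * w%:R * (3 * w%:R * hs2 M ^+ 2).
  apply: (le_trans (ler_sum _ (fun o' _ => h1 o'))); rewrite -mulr_sumr.
  by rewrite ler_wpM2l ?mulr_ge0// (le_trans h2)// [X in X ^+ 2]exchange_big.
move=> h; have h0 : 0 <= w%:R^-1 ^+ 4 :> R by rewrite exprn_ge0 ?invr_ge0.
apply: le_trans (ler_wpM2l h0 h) _; apply: le_of_eq.
by field; rewrite gt_eqF.
Qed.

Definition truncate (rho : R) (M : 'M[C]_w) : 'M[C]_w :=
  \matrix_(o, o') if normc (M o o') <= rho then M o o' else 0.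

Lemma truncate_le rho M o o' : 0 < rho -> normc (truncate rho M o o') <= rho.
Proof. by move=> r0; rewrite mxE; case: ifP => // _; rewrite normc0 ltW. Qed.

Lemma hs2_truncate rho M : hs2 (truncate rho M) <= hs2 M.
Proof.
apply: ler_sum => o _; apply: ler_sum => o' _; rewrite mxE.
by case: ifP => // _; rewrite normc0 expr0n sqr_ge0.
Qed.

Lemma hs2_truncate_error rho M : 0 < rho ->
  hs2 (M - truncate rho M) <= (\sum_o \sum_o' normc (M o o') ^+ 4) / rho ^+ 2.
Proof.
move=> r0; rewrite mulr_suml; apply: ler_sum => o _.
rewrite mulr_suml; apply: ler_sum => o' _; rewrite !mxE.
case: ifPn => [_|]; first by rewrite subrr normc0 expr0n/= mulr_ge0 ?invr_ge0 ?exprn_ge0 ?normc_ge0// ltW.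
rewrite -ltNge subr0 => h; rewrite ler_pdivlMr ?exprn_gt0//.
have := ltW h; set t := normc _ in h *; move=> h'.
rewrite (_ : t ^+ 4 = t ^+ 2 * t ^+ 2); last by ring.
by rewrite ler_wpM2l ?sqr_ge0// ler_sqr ?nnegrE ?normc_ge0// ltW.
Qed.

End randomization.

Section projective_boundedness_of_chains.
Context (R : realType) (X : finType).
Local Notation C := R[i].
Implicit Types (b : seq X -> C).

(** After randomization the entries that are large compared with 1 / w carry a
    small Hilbert-Schmidt mass.  Cutting the entries at tau / w costs, slot by
    slot, a factor 3 / tau of the known bound K, while the chain of cut matrices
    is bounded by tau^N, directly from boundedness of the scalar form.  With
    tau = 6 N the loss is K / 2. *)
Lemma chain_bound_improve N b (K : R) : (2 <= N)%N -> 0 <= K ->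
  sup_bounded N 1 b -> chain_bound N b K ->
  chain_bound N b ((6 * N%:R) ^+ N + K / 2).
Proof.
move=> N2 K0 b1 bK v Ms sz Ms1.
have N0 : 0 < N%:R :> R by rewrite ltr0n (leq_trans _ N2).
have [w [E [w0 orthE E4]]] := rademacher_signs R v.
have wR0 : 0 < w%:R :> R by rewrite ltr0n.
pose tau : R := 6 * N%:R; have tau0 : 0 < tau by rewrite mulr_gt0.
pose rd (M : X -> 'M[C]_v) x := randomize E (M x).
pose tr (M : X -> 'M[C]_v) x := truncate (tau / w%:R) (rd M x).
have rho0 : 0 < tau / w%:R by rewrite divr_gt0.
have -> : \tr (mxform b Ms) = \tr (mxform b (map rd Ms)).
  case: Ms sz {Ms1} => [|M Ms] sz; first by rewrite -sz in N2.
  by rewrite mxform_randomize// trace_randomize.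
(* The slots of Ms2 are cut one after the other; those of Ms1' have been cut. *)
have telescope Ms1' Ms2 : size (Ms1' ++ map tr Ms2) = N ->
    allp (@hs_unit R X w) Ms1' -> allp (@hs_unit R X v) Ms2 ->
    normc (\tr (mxform b (Ms1' ++ map rd Ms2)) - \tr (mxform b (Ms1' ++ map tr Ms2)))
      <= (size Ms2)%:R * (3 / tau * K).
  elim: Ms2 Ms1' => [|M Ms2 IH] Ms1' sz' h1 /=.
    by rewrite subrr normc0 mul0r.
  move=> [M1 h2].
  have rd1 : hs_unit (rd M) by move=> x; rewrite /rd hs2_randomize.
  have tr1 : hs_unit (tr M) by move=> x; apply: le_trans (hs2_truncate _ _) (rd1 x).
  have allrd : allp (@hs_unit R X w) (map rd Ms2).
    by apply/allp_map; apply: sub_allp h2 => M' M'1 x; rewrite /rd hs2_randomize.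
  have -> : rd M = (fun x => (rd M x - tr M x) + tr M x).
    by apply/funext => x; rewrite subrK.
  rewrite mxform_slotD mxtraceD -addrA.
  apply: le_trans (le_normcD _ _) _.
  rewrite -natr1 mulrDl mul1r [leRHS]addrC lerD//; last first.
    rewrite -!cat_rcons; apply: IH => //; first by rewrite cat_rcons.
    exact/allp_rcons.
  apply: (@chain_bound_slot _ _ N) => //.
  - by rewrite divr_gt0.
  - by rewrite -sz' !size_cat/= !size_map.
  - move=> x; have := hs2_truncate_error (rd M x) rho0.
    rewrite -/(tr M x); move/le_trans; apply.
    rewrite ler_pdivrMr ?exprn_gt0//.
    have := fourth_moment_randomize w0 E4 (M x).
    rewrite -/(rd M x); move/le_trans; apply.
    apply: (@le_trans _ _ (9 / w%:R ^+ 2 * 1)).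
      rewrite ler_wpM2l ?divr_ge0 ?exprn_ge0//.
      by rewrite -[X in _ <= X](expr1n _ 2) ler_sqr ?nnegrE ?hs2_ge0// M1.
    apply: le_of_eq; field.
    by rewrite !gt_eqF.
have h1 := telescope [::] Ms; rewrite /= in h1.
rewrite -[X in normc X](subrK (\tr (mxform b (map tr Ms)))) addrC.
apply: le_trans (le_normcD _ _) _; apply: lerD.
  have -> : (6 * N%:R) ^+ N = (w%:R * (tau / w%:R)) ^+ N * 1.
    by rewrite mulr1 [w%:R * _]mulrC divfK// gt_eqF.
  have sz' : size (map tr Ms) = N by rewrite size_map.
  rewrite -sz'; apply: mxform_trace_bounded; rewrite ?sz'//.
    by rewrite (leq_trans _ N2).
  apply/allp_map; apply: sub_allp Ms1 => M _ x a c; exact: truncate_le.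
apply: le_trans (h1 _ I Ms1) _; first by rewrite size_map.
rewrite sz /tau; apply: le_of_eq; field.
by rewrite gt_eqF.
Qed.

(** The fixed point of the improvement K |-> c + K / 2. *)
Lemma trace_chain_le N b : (2 <= N)%N -> sup_bounded N 1 b ->
  chain_bound N b (2 * (6 * N%:R) ^+ N).
Proof.
case: N => [|[|N]]// _ b1; set c := _ ^+ _.
have c0 : 0 <= c by rewrite exprn_ge0// mulr_ge0.
pose K0 := \sum_x (1 + crude_bound N.+1 (fun s => b (x :: s))).
have K00 : 0 <= K0 by apply: sumr_ge0 => x _; rewrite addr_ge0 ?crude_bound_ge0.
have step i : chain_bound N.+2 b (2 * c + K0 / 2 ^+ i).
  elim: i => [|i IH].
    rewrite expr0 divr1 => v Ms sz h; apply: le_trans (@crude_chain_bound R X N b v Ms sz h) _.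
    by rewrite lerDr mulr_ge0.
  have := chain_bound_improve (isT : 2 <= N.+2)%N _ b1 IH.
  have -> : c + (2 * c + K0 / 2 ^+ i) / 2 = 2 * c + K0 / 2 ^+ i.+1.
    have : (2 ^+ i : R) != 0 by rewrite expf_neq0// pnatr_eq0.
    by rewrite exprS; move: (2 ^+ i) => q q0; field.
  by apply; apply: addr_ge0; [exact: mulr_ge0|apply: divr_ge0 => //; exact: exprn_ge0].
move=> v Ms sz h; rewrite leNgt; apply/negP => lt_c.
pose d := normc (\tr (mxform b Ms)) - 2 * c; have d0 : 0 < d by rewrite subr_gt0.
have := archi_boundP (divr_ge0 K00 (ltW d0)); set i := Num.bound _ => hi.
have := @step i v Ms sz h; rewrite leNgt => /negP; apply.
rewrite -ltrBrDl -/d ltr_pdivrMr ?exprn_gt0// mulrC -ltr_pdivrMr//.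
apply: lt_trans hi _; rewrite -natrX ltr_nat; exact: ltn_expl.
Qed.

End projective_boundedness_of_chains.

(** * The multilinear Grothendieck inequality *)

Section grothendieck_forms.
Context (R : realType) (X : finType).
Local Notation C := R[i].
Implicit Types (b : seq X -> C).

Lemma mxform0 v (Ms : seq (X -> 'M[C]_v)) : mxform (fun=> 0) Ms = 0.
Proof.
elim: Ms => [|M Ms IH] /=; first exact: raddf0.
by rewrite big1// => x _; rewrite IH mulmx0.
Qed.

Lemma plug0 b : plug b (fun=> 0) = (fun=> 0).
Proof. by apply/funext => s; rewrite /plug big1// => x _; rewrite mul0r. Qed.

(** The sum over j and l is the trace of a chain of matrices: the first argument
    is placed in a row, the middle ones on diagonals, the weights c join the
    index j to the index l in the last but one, and psi is a column. *)
Section square_index.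
Context (v : nat).
Implicit Types (y psi : 'I_v.+1 -> X -> C).

Let rowm y x : 'M[C]_v.+1 := \matrix_(a, e) if a == ord0 then y e x else 0.
Let diagm y x : 'M[C]_v.+1 := \matrix_(a, e) if a == e then y a x else 0.
Let weightm (c : 'I_v.+1 -> 'I_v.+1 -> C) y x : 'M[C]_v.+1 :=
  \matrix_(a, e) (c a e * y a x).
Let colm y x : 'M[C]_v.+1 := \matrix_(a, e) if e == ord0 then y a x else 0.

Let mxform_diag b ys Ms j d :
  mxform b (map diagm ys ++ Ms) j d = mxform (foldl (@plug _ X) b (map (fun y => y j) ys)) Ms j d.
Proof.
elim: ys b => //= y ys IH b; rewrite -IH.
rewrite -/(mxform b (diagm y :: map diagm ys ++ Ms)) mxform_entry (bigD1 j)//=.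
rewrite big1 => [|e ej]; last first.
  rewrite (_ : plug b _ = fun=> 0) ?mxform0 ?mxE// -(plug0 b).
  by congr plug; apply/funext => x; rewrite mxE eq_sym (negPf ej).
rewrite addr0; congr (mxform (plug b _) _ _ _).
by apply/funext => x; rewrite mxE eqxx.
Qed.

Let mxform_end b c y psi j :
  mxform b [:: weightm c y; colm psi] j ord0 =
  \sum_l c j l * mform b [:: y j; psi l].
Proof.
rewrite mxform_entry; apply: eq_bigr => l _; rewrite mxform_entry (bigD1 ord0)//=.
rewrite big1 => [|e e0]; last by rewrite mxE (negPf e0).
rewrite addr0 mxE eqxx mulr1n -mformZ /mform/=; congr (plug _ _ _).
  rewrite plugZ; apply/funext => s; rewrite /plug mulr_sumr.
  by apply: eq_bigr => x _; rewrite mxE mulrA.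
by apply/funext => x; rewrite mxE eqxx.
Qed.

Lemma grothendieck_square b y1 ys yn c psi :
  sup_bounded (size ys).+3 1 b ->
  allp (fun y => forall x, \sum_j normc (y j x) ^+ 2 <= 1) (y1 :: rcons ys yn) ->
  (forall j, \sum_l normc (c j l) ^+ 2 <= 1) ->
  (forall x, \sum_l normc (psi l x) ^+ 2 <= 1) ->
  normc (\sum_j \sum_l c j l *
    mform b (rcons (map (fun y => y j) (y1 :: rcons ys yn)) (psi l))) <=
  2 * (6 * (size ys).+3%:R) ^+ (size ys).+3.
Proof.
move=> b1 [y1_le /allp_rcons[ys_le yn_le]] c_le psi_le.
pose Ms := rowm y1 :: map diagm ys ++ [:: weightm c yn; colm psi].
have -> : \sum_j \sum_l c j l *
    mform b (rcons (map (fun y => y j) (y1 :: rcons ys yn)) (psi l)) =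
    \tr (mxform b Ms).
  rewrite /mxtrace [RHS](bigD1 ord0)// [X in _ = _ + X]big1 ?addr0 => [|a a0]; last first.
    rewrite mxform_entry big1// => e _.
    rewrite (_ : plug b _ = fun=> 0) ?mxform0 ?mxE// -(plug0 b).
    by congr plug; apply/funext => x; rewrite mxE (negPf a0).
  rewrite mxform_entry; apply: eq_bigr => j _.
  rewrite mxform_diag mxform_end; apply: eq_bigr => l _; congr (_ * _).
  rewrite (_ : plug b _ = plug b (y1 j)); last first.
    by congr plug; apply/funext => x; rewrite mxE eqxx.
  by rewrite /= map_rcons -cats1 -cats1 -catA -cat_cons mform_cat.
apply: (trace_chain_le _ b1) => //.
  by rewrite /Ms/= size_cat size_map addn2.
split; first (move=> x; apply: le_trans (y1_le x)).
  rewrite /hs2 (bigD1 ord0)//= [X in _ + X]big1 ?addr0 => [|a a0].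
    by apply: ler_sum => e _; rewrite mxE eqxx.
  by rewrite big1// => e _; rewrite mxE (negPf a0) normc0 expr0n.
apply/allp_cat; split; first apply/allp_map.
  apply: sub_allp ys_le => y y_le x; apply: le_trans (y_le x).
  apply: ler_sum => a _; rewrite (bigD1 a)//= big1 => [|e ea].
    by rewrite addr0 mxE eqxx.
  by rewrite mxE eq_sym (negPf ea) normc0 expr0n.
split; last split=> //.
  move=> x; apply: le_trans (yn_le x); apply: ler_sum => a _.
  under eq_bigr => e _ do rewrite mxE normcM exprMn.
  by rewrite -mulr_suml ler_piMl ?sqr_ge0.
move=> x; apply: le_trans (psi_le x); apply: ler_sum => a _.
rewrite (bigD1 ord0)//= big1 => [|e e0]; first by rewrite addr0 mxE eqxx.
by rewrite mxE (negPf e0) normc0 expr0n.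
Qed.

End square_index.

(** Every finite index is padded with zero terms to a common ordinal. *)
Let pad (J : finType) (v : nat) (i : 'I_v.+1) : option J :=
  nth None (map Some (enum J)) i.

Lemma sum_pad (V : nmodType) (J : finType) (v : nat) (G : option J -> V) :
  (#|J| <= v.+1)%N -> G None = 0 ->
  \sum_(i < v.+1) G (pad J i) = \sum_j G (Some j).
Proof.
move=> Jv G0; rewrite -(big_mkord xpredT (fun i => G (nth None (map Some (enum J)) i))).
rewrite (big_cat_nat _ Jv)//=.
have -> : \sum_(#|J| <= i < v.+1) G (nth None (map Some (enum J)) i) = 0.
  rewrite big_nat_cond big1// => i /andP[/andP[h _] _].
  by rewrite nth_default// size_map -cardE.
rewrite addr0 -big_enum -(big_map Some xpredT G) [RHS](big_nth None) size_map -cardE.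
exact: eq_bigr.
Qed.

Definition grothendieck_const n : R := 2 * (6 * n.+1%:R) ^+ n.+1.

(** The inequality of Blei and Tonge for forms of n + 1 >= 3 variables.  For two
    variables the chain would have no slot left for the weights c. *)
Lemma grothendieck_blei n b (J L : finType) ys (c : J -> L -> C)
    (psi : L -> X -> C) :
  (2 <= n)%N -> size ys = n -> sup_bounded n.+1 1 b ->
  allp (fun y => forall x, \sum_j normc (y j x) ^+ 2 <= 1) ys ->
  (forall j, \sum_l normc (c j l) ^+ 2 <= 1) ->
  (forall x, \sum_l normc (psi l x) ^+ 2 <= 1) ->
  normc (\sum_j \sum_l c j l * mform b (rcons (map (fun y => y j) ys) (psi l))) <=
  grothendieck_const n.
Proof.
move=> n2 sz b1 ys_le c_le psi_le; pose v := (#|J| + #|L|)%N.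
have Jv : (#|J| <= v.+1)%N by rewrite ltnW// ltnS leq_addr.
have Lv : (#|L| <= v.+1)%N by rewrite ltnW// ltnS leq_addl.
pose padf (I : finType) (y : I -> X -> C) (i : 'I_v.+1) :=
  oapp y (fun=> 0) (pad I i).
pose c' (i l : 'I_v.+1) :=
  if (pad J i, pad L l) is (Some j, Some k) then c j k else 0.
have padf_le (I : finType) (y : I -> X -> C) : (#|I| <= v.+1)%N ->
    (forall x, \sum_i normc (y i x) ^+ 2 <= 1) ->
    forall x, \sum_i normc (padf I y i x) ^+ 2 <= 1.
  move=> Iv y_le x; apply: le_trans (y_le x).
  rewrite (@sum_pad _ I v (fun o => normc (oapp y (fun=> 0) o x) ^+ 2))//.
  by rewrite -[LHS]/(normc 0 ^+ 2) normc0 expr0n.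
have -> : \sum_j \sum_l c j l * mform b (rcons (map (fun y => y j) ys) (psi l)) =
  \sum_i \sum_l c' i l *
    mform b (rcons (map (fun y => y i) (map (@padf J) ys)) (padf L psi l)).
  pose G o := oapp (fun j => \sum_l c j l *
    mform b (rcons (map (fun y => y j) ys) (psi l))) 0 o.
  rewrite -(@sum_pad _ J v G)//; apply: eq_bigr => i _.
  rewrite /c' /G; case pi : (pad J i) => [j|] /=; last first.
    by rewrite big1// => l _; rewrite mul0r.
  pose H o := oapp (fun l => c j l *
    mform b (rcons (map (fun y => y j) ys) (psi l))) 0 o.
  rewrite -(@sum_pad _ L v H)//; apply: eq_bigr => l _.
  rewrite /H /padf; case: (pad L l) => [k|] /=; last by rewrite mul0r.
  by rewrite -map_comp/= /comp pi.
have {}c_le i : \sum_l normc (c' i l) ^+ 2 <= 1.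
  rewrite /c'; case: (pad J i) => [j|]; last first.
    by rewrite big1// => l _; rewrite normc0 expr0n.
  apply: le_trans (c_le j).
  rewrite (@sum_pad _ L v (fun o => normc (if o is Some k then c j k else 0) ^+ 2))//.
  by rewrite normc0 expr0n.
have {}psi_le := padf_le _ _ Lv psi_le.
have {}ys_le : allp (fun y => forall x, \sum_j normc (y j x) ^+ 2 <= 1)
    (map (@padf J) ys).
  by apply/allp_map; apply: sub_allp ys_le => y; exact: padf_le.
move: ys_le; set zs := map _ ys => zs_le.
have {}sz : size zs = n by rewrite size_map.
case: zs sz zs_le => [|z1 zs]; first by move=> sz; rewrite -sz in n2.
case/lastP: zs => [|zs zn] sz zs_le; first by rewrite -sz in n2.
move: sz; rewrite /= size_rcons => sz.
by rewrite /grothendieck_const -sz; apply: grothendieck_square; rewrite // sz.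
Qed.

End grothendieck_forms.

(** * Cauchy estimates and dyadic levels *)

Section cauchy_estimates.
Context (R : rcfType).
Local Notation C := R[i].

Lemma complex_prim_root n : (0 < n)%N -> exists z : C, n.-primitive_root z.
Proof.
move=> n0; pose p : {poly C} := 'X^n - 1; have [r Dp] := closed_field_poly_normal p.
rewrite (monicP _) ?monicXnsubC // scale1r in Dp.
have rn1 : all n.-unity_root r by apply/allP=> z; rewrite -root_prod_XsubC -Dp.
have sz_r : (n < (size r).+1)%N.
  by rewrite -(size_prod_XsubC r id) -Dp size_XnsubC.
have [|z] := hasP (has_prim_root n0 rn1 _ sz_r); last by exists z.
by rewrite -separable_prod_XsubC -Dp separable_Xn_sub_1 // pnatr_eq0 -lt0n.
Qed.

Lemma normc_prim_root n (z : C) : n.-primitive_root z -> normc z = 1.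
Proof.
move=> zn; have n0 := prim_order_gt0 zn.
apply/eqP; rewrite -(@pexpr_eq1 _ _ n)// ?normc_ge0//.
by rewrite -normcX (prim_expr_order zn) normc1.
Qed.

(** The integral formula for a coefficient, discretized at n-th roots of unity
    with n above the degree. *)
Lemma cauchy_estimate (P : {poly C}) (rho B : R) m : 0 < rho ->
  (forall z, normc z = 1 -> normc P.[rho%:C * z] <= B) ->
  normc P`_m * rho ^+ m <= B.
Proof.
move=> rho0 PB; pose n := (maxn (size P) m.+1).
have n0 : (0 < n)%N by rewrite /n leq_max orbT.
have mn : (m < n)%N by rewrite /n leq_max ltnSn orbT.
have [w wn] := complex_prim_root n0; have w1 := normc_prim_root wn.
have w0 : w != 0 by apply: contra_eq_neq w1 => ->; rewrite normc0 eq_sym oner_eq0.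
have sumE : \sum_(t < n) P.[rho%:C * w ^+ t] * (w ^+ m) ^- t =
    n%:R * (P`_m * rho%:C ^+ m).
  transitivity (\sum_(t < n) \sum_(i < n) P`_i * rho%:C ^+ i * (w ^+ i / w ^+ m) ^+ t).
    apply: eq_bigr => t _; rewrite (horner_coef_wide _ (leq_maxl _ m.+1)) mulr_suml.
    apply: eq_bigr => i _; rewrite exprMn -mulrA -mulrA -mulrA; congr (_ * (_ * _)).
    by rewrite exprMn exprVn -!exprM [(t * i)%N]mulnC.
  rewrite exchange_big/= (bigD1 (Ordinal mn))//= divff ?expf_neq0//.
  under eq_bigr do rewrite expr1n mulr1.
  rewrite sumr_const card_ord [X in _ + X]big1 ?addr0 ?mulr_natl// => i im.
  rewrite -mulr_sumr; set u := w ^+ i / w ^+ m.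
  have u1 : u - 1 != 0.
    rewrite subr_eq0; apply: contra im => /eqP uE; apply/eqP/val_inj => /=.
    have : w ^+ i == w ^+ m by rewrite -[X in X == _](@divfK _ (w ^+ m)) ?expf_neq0// -/u uE mul1r.
    by rewrite (eq_prim_root_expr wn) !modn_small// => /eqP.
  rewrite [X in _ * X](_ : _ = 0) ?mulr0//; apply: (mulfI u1).
  rewrite -subrX1 mulr0 /u expr_div_n -!exprM ![(_ * n)%N]mulnC !exprM.
  by rewrite (prim_expr_order wn) !expr1n divr1 subrr.
have : normc (n%:R * (P`_m * rho%:C ^+ m)) <= n%:R * B.
  rewrite -sumE; apply: le_trans (ler_normc_sum _ _ _) _.
  have : \sum_(t < n) normc (P.[rho%:C * w ^+ t] * (w ^+ m) ^- t) <= \sum_(t < n) B.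
    apply: ler_sum => t _; rewrite normcM normcV !normcX w1 !expr1n invr1 mulr1.
    by apply: PB; rewrite normcX w1 expr1n.
  by move=> /le_trans; apply; rewrite sumr_const card_ord mulr_natl.
rewrite !normcM normcX -(rmorph_nat (real_complex R)) !normc_real normr_nat.
by rewrite gtr0_norm// ler_pM2l// ltr0n.
Qed.

End cauchy_estimates.

Section bounds_on_arrays.
Context (R : realType) (X : finType).
Local Notation C := R[i].
Implicit Types (b : seq X -> C).

Lemma mform_rmorph (A B : comNzRingType) (f : {rmorphism A -> B}) (b : seq X -> A) phis :
  f (mform b phis) = mform (fun s => f (b s)) (map (fun phi x => f (phi x)) phis).
Proof.
elim: phis b => // phi phis IH b; rewrite /= !mform_cons rmorph_sum.
by apply: eq_bigr => x _; rewrite rmorphM IH.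
Qed.

(** The tail takes the arguments that are not rescaled. *)
Lemma sup_bounded_scale b phis tl (rho : R) : 0 < rho ->
  sup_bounded (size phis + size tl) 1 b ->
  allp (fun phi => forall x, normc (phi x) <= rho) phis ->
  allp (fun phi => forall x, normc (phi x) <= 1) tl ->
  normc (mform b (phis ++ tl)) <= rho ^+ size phis.
Proof.
move=> rho0 b1 phis_rho tl1.
have -> : phis = map (fun phi x => rho%:C * phi x)
    (map (fun phi x => (rho^-1)%:C * phi x) phis).
  rewrite -map_comp -[LHS]map_id; apply: eq_map => phi; apply/funext => x /=.
  by rewrite mulrA -rmorphM divff ?gt_eqF// mul1r.
rewrite mformZ_prefix normcM normcX normc_real gtr0_norm// !size_map.
rewrite ler_piMr ?exprn_ge0 ?(ltW rho0)//; apply: b1.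
  by rewrite size_cat size_map.
apply/allp_cat; split=> //; apply/allp_map; apply: sub_allp phis_rho => phi h x.
by rewrite normcM normc_real ger0_norm ?invr_ge0 ?(ltW rho0)// mulrC ler_pdivrMr// mul1r.
Qed.

End bounds_on_arrays.

Section dyadic_levels.
Context (R : realType).
Implicit Types t : R.

(** For t >= 1 the integer part of the base 2 logarithm. *)
Definition level t : nat := trunc_log 2 (Num.truncn t).

Lemma levelP t : 1 <= t -> 2 ^+ level t <= t < 2 ^+ (level t).+1.
Proof.
move=> t1; have /andP[le_t lt_t] := truncn_itv (le_trans ler01 t1).
have n0 : (0 < Num.truncn t)%N by rewrite truncn_gt0.
have /andP[h1 h2] := trunc_log_bounds (isT : 1 < 2)%N n0.
apply/andP; split; first by apply: le_trans le_t; rewrite -natrX ler_nat.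
by apply: lt_le_trans lt_t _; rewrite -natrX ler_nat.
Qed.

Lemma exists_scale (I : finType) (a : I -> R) :
  exists h, forall i, 0 < a i -> 1 <= a i * 2 ^+ h.
Proof.
exists (\sum_i Num.bound (a i)^-1)%N => i ai; set h := (\sum_i _)%N.
rewrite -[leLHS](@divff _ (a i)) ?gt_eqF// ler_pM2l//.
have := archi_boundP (_ : 0 <= (a i)^-1); rewrite invr_ge0 ltW// => /(_ isT) /ltW.
move=> /le_trans; apply; rewrite -natrX ler_nat.
apply: (@leq_trans h); last exact/ltnW/ltn_expl.
by rewrite /h (bigD1 i)//= leq_addr.
Qed.

End dyadic_levels.

(** * Interpolation in the summability exponent *)

Lemma allp_nth T (P : T -> Prop) (x0 : T) s :
  (forall i, (i < size s)%N -> P (nth x0 s i)) -> allp P s.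
Proof.
elim: s => //= x s IH h; split; first exact: (h 0%N).
by apply: IH => i; exact: (h i.+1).
Qed.

Lemma nth_allp T (P : T -> Prop) (x0 : T) s i :
  allp P s -> (i < size s)%N -> P (nth x0 s i).
Proof. by elim: s i => //= x s IH [|i] [Px Ps]//=; apply: IH. Qed.

Lemma le_powR_base (R : realType) (r x y : R) : 0 <= r -> 0 <= x -> x <= y ->
  x `^ r <= y `^ r.
Proof.
by move=> r0 x0 xy; apply: ge0_ler_powR; rewrite ?nnegrE// (le_trans x0).
Qed.

Section geometric_sums.
Context (R : realType).

Lemma geometric_le (q : R) N : 0 <= q < 1 -> \sum_(i < N) q ^+ i <= (1 - q)^-1.
Proof.
move=> /andP[q0 q1]; have h : 0 < 1 - q by rewrite subr_gt0.
rewrite -[leRHS]mul1r ler_pdivlMr// mulrC -opprB mulNr -subrX1 opprB.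
by rewrite lerBlDr lerDl exprn_ge0.
Qed.

Lemma sum_two_pow_le H : \sum_(i < H) 2 ^+ i <= 2 ^+ H :> R.
Proof.
have := subrX1 (2 : R) H; rewrite (_ : 2 - 1 = 1) ?mul1r; last by ring.
by move=> <-; rewrite lerBlDr lerDl.
Qed.

(** A quantitative form of the three circles theorem, for the circles of radii
    1, 2 and 2^s: below the degree H the Cauchy estimate on the first circle is
    used, and above it the one on the third, where the ratio 2^(1-s) makes the
    sum converge. *)
Lemma horner2_le (P : {poly R[i]}) (A G s : R) (H : nat) :
  1 < s -> 0 <= A -> 0 <= G ->
  (forall m, normc P`_m <= A) ->
  (forall m, normc P`_m * (2 `^ s) ^+ m <= A * G * (2 `^ s) ^+ H) ->
  normc P.[2] <= 2 ^+ H * (A * (1 + G / (1 - 2 `^ (1 - s)))).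
Proof.
move=> s1 A0 G0 PA PG; set q := 2 `^ (1 - s).
have q01 : 0 <= q < 1.
  rewrite powR_ge0/= -(powRr0 2) /q /powR pnatr_eq0/= ltr_expR.
  by rewrite ltr_pM2r ?subr_lt0// ln_gt0// ltr1n.
have qE : 2 = q * 2 `^ s.
  by rewrite /q -powRD ?subrK ?powRr1//; apply/implyP => _; rewrite pnatr_eq0.
have r0 : 0 < 2 `^ s :> R by exact: powR_gt0.
rewrite (horner_coef_wide _ (leq_addl H (size P))).
apply: le_trans (ler_normc_sum _ _ _) _.
have -> : \sum_(i < H + size P) normc (P`_i * 2 ^+ i) =
    \sum_(0 <= i < H + size P) normc P`_i * 2 ^+ i.
  rewrite big_mkord; apply: eq_bigr => i _; rewrite normcM normcX.
  by rewrite -(rmorph_nat (real_complex R)) normc_real ger0_norm.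
rewrite (big_cat_nat _ (leq_addr (size P) H))//=.
rewrite mulrDr mulr1 mulrDr lerD//.
  apply: le_trans (_ : \sum_(0 <= i < H) A * 2 ^+ i <= _).
    by apply: ler_sum => i _; rewrite ler_wpM2r ?exprn_ge0.
  by rewrite -mulr_sumr big_mkord mulrC ler_wpM2r// sum_two_pow_le.
rewrite -{1}[H]add0n big_addn addKn.
apply: le_trans (_ : \sum_(0 <= i < size P) 2 ^+ H * (A * G) * q ^+ i <= _).
  apply: ler_sum => i _; have PGi := PG (i + H)%N.
  have u0 : (2 `^ s : R) ^+ i != 0 by rewrite expf_neq0// gt_eqF.
  have v0 : (2 `^ s : R) ^+ H != 0 by rewrite expf_neq0// gt_eqF.
  have uv0 : 0 < (2 `^ s) ^+ (i + H) :> R by rewrite exprn_gt0.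
  rewrite -(ler_pM2r uv0) mulrAC; apply: le_trans (ler_wpM2r _ PGi) _.
    by rewrite exprn_ge0.
  have -> : (2 : R) ^+ (i + H) = (2 ^+ H) * (q ^+ i * (2 `^ s) ^+ i).
    by rewrite -exprMn -qE -exprD addnC.
  rewrite exprD; apply: le_of_eq; ring.
rewrite -mulr_sumr big_mkord -!mulrA ler_wpM2l ?exprn_ge0// ler_wpM2l//.
by rewrite ler_wpM2l// geometric_le.
Qed.

End geometric_sums.

Section interpolation.
Context (R : realType) (X : finType).
Local Notation C := R[i].
Implicit Types (b : seq X -> C).

Definition interpolation_const n (s : R) : R :=
  2 ^+ n * (1 + grothendieck_const R n / (1 - 2 `^ (1 - s))).

Lemma sum_mform_rcons (I : finType) b phis (f : I -> C) (psi : I -> X -> C) :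
  \sum_i f i * mform b (rcons phis (psi i)) =
  mform b (rcons phis (fun x => \sum_i f i * psi i x)).
Proof. by rewrite -cats1 mform_slot; apply: eq_bigr => i _; rewrite cats1. Qed.

Lemma normc_sum_mul_le1 (I : finType) (f g : I -> C) :
  \sum_i normc (f i) ^+ 2 <= 1 -> \sum_i normc (g i) ^+ 2 <= 1 ->
  normc (\sum_i f i * g i) <= 1.
Proof.
move=> f1 g1; rewrite -(@ler_sqr _ _ 1) ?nnegrE ?normc_ge0// expr1n.
apply: le_trans (sqr_normc_sum_mul _ _) _.
by rewrite mulr_ile1// sumr_ge0// => i _; exact: sqr_ge0.
Qed.

(** The weights D_j^(1 - 1/s) interpolate between D_j at s = oo, where the sum is
    a convex combination of values of the form, and 1 at s = 1, which is
    [grothendieck_blei].  The arguments y_j / D_j^(1/(s n)) are written as 2^k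
    times a factor of modulus at most 2, and 2 is replaced by a complex variable
    z.  The resulting polynomial is bounded on |z| = 1 because the form is, on
    |z| = 2^s because raising the moduli to the power s brings them back to the
    Hilbert case, and its value at 2 is the sum in question. *)
Lemma interpolated_grothendieck n b (J L : finType) ys (c : J -> L -> C)
    (psi : L -> X -> C) (D : J -> R) (s : R) :
  (2 <= n)%N -> size ys = n -> sup_bounded n.+1 1 b -> 1 < s ->
  allp (fun y => forall x, \sum_j normc (y j x) `^ (2 * s) <= 1) ys ->
  (forall j, 0 < D j) -> \sum_j D j <= 1 ->
  (forall j, \sum_l normc (c j l) ^+ 2 <= 1) ->
  (forall x, \sum_l normc (psi l x) ^+ 2 <= 1) ->
  normc (\sum_j \sum_l (D j `^ (1 - s^-1))%:C * c j l *
    mform b (rcons (map (fun y => y j) ys) (psi l))) <= interpolation_const n s.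
Proof.
move=> n2 sz b1 s1 ys_le D0 D1 c_le psi_le.
have s0 : 0 < s by exact: lt_trans s1.
have n0 : 0 < n%:R :> R by rewrite ltr0n (leq_trans _ n2).
pose de j := D j `^ (s * n%:R)^-1.
have de0 j : 0 < de j by exact: powR_gt0.
pose a (y : J -> X -> C) j x := normc (y j x) / de j.
(* The shift by h makes all exponents of z nonnegative. *)
have [h hP] : exists h, allp (fun y => forall j x, y j x != 0 ->
    1 <= a y j x * 2 ^+ h) ys.
  pose y0 : J -> X -> C := fun _ _ => 0.
  have [h hP] := exists_scale (fun i : 'I_n * J * X => a (nth y0 ys i.1.1) i.1.2 i.2).
  exists h; apply: (@allp_nth _ _ y0) => i; rewrite sz => ni j x yN0.
  apply: (hP (Ordinal ni, j, x)); rewrite divr_gt0// lt0r normc_ge0 andbT.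
  by apply: contraNneq yN0 => /eq0_normc ->.
pose lev y j x := level (a y j x * 2 ^+ h).
pose xh y j x : C := (2 ^+ h / (2 ^+ lev y j x * de j))%:C * y j x.
have xhE y j x : normc (xh y j x) = a y j x * 2 ^+ h / 2 ^+ lev y j x.
  rewrite normcM normc_real ger0_norm; last first.
    by rewrite divr_ge0 ?mulr_ge0 ?exprn_ge0// ltW.
  by rewrite /a invfM [LHS]mulrC -!mulrA; congr (_ * _); rewrite [RHS]mulrCA; congr (_ * _); exact: mulrC.
have y0N y j x : y j x = 0 -> xh y j x = 0 by rewrite /xh => ->; rewrite mulr0.
have xh2 : allp (fun y => forall j x, normc (xh y j x) <= 2) ys.
  apply: sub_allp hP => y hy j x; have [/y0N ->|/hy/levelP/andP[_ lt_lev]] := eqVneq (y j x) 0.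
    by rewrite normc0.
  by rewrite xhE ler_pdivrMr ?exprn_gt0// -exprS ltW.
pose P : {poly C} := \sum_j \sum_l (c j l * (D j)%:C)%:P *
  mform (fun s => (b s)%:P)
    (rcons (map (fun y x => 'X^(lev y j x) * (xh y j x)%:P) ys)
           (fun x => (psi l x)%:P)).
have PE z : P.[z] = \sum_j \sum_l c j l * (D j)%:C *
    mform b (rcons (map (fun y x => z ^+ lev y j x * xh y j x) ys) (psi l)).
  rewrite horner_sum; apply: eq_bigr => j _; rewrite horner_sum.
  apply: eq_bigr => l _; rewrite hornerM hornerC; congr (_ * _).
  rewrite -/(horner_eval z _) mform_rmorph map_rcons -map_comp; congr mform.
    by apply/funext => s'; exact: hornerC.
  congr rcons; last by apply/funext => x; exact: hornerC.
  apply: eq_map => y; apply/funext => x /=.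
  by rewrite /horner_eval hornerM hornerXn hornerC.
(* As the D j have sum at most 1, each j is bounded separately, and the sum over
   l is absorbed in the last slot of the form. *)
have bnd_one z : normc z = 1 -> normc P.[z] <= 2 ^+ n.
  move=> z1; rewrite PE; apply: le_trans (ler_normc_sum _ _ _) _.
  apply: le_trans (_ : \sum_j D j * 2 ^+ n <= _); last first.
    by rewrite -mulr_suml ler_piMl ?exprn_ge0.
  apply: ler_sum => j _.
  under eq_bigr => l _ do rewrite [c j l * _]mulrC -mulrA.
  rewrite -mulr_sumr normcM normc_real gtr0_norm// ler_pM2l//.
  rewrite sum_mform_rcons -cats1 -sz -(size_map (fun y x => z ^+ lev y j x * xh y j x)).
  apply: sup_bounded_scale => //=; first by rewrite size_map sz addn1.
    apply/allp_map; apply: sub_allp xh2 => y y2 x.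
    by rewrite normcM normcX z1 expr1n mul1r.
  by split=> // x; apply: normc_sum_mul_le1.
pose la : R := 2 * (2 ^+ h) `^ s.
have la0 : 0 < la by rewrite mulr_gt0// powR_gt0// exprn_gt0.
(* The factor la absorbs the shift and the rounding to powers of 2; what is left
   has squared moduli summing to at most 1, as in the case s = 1. *)
have bnd_two z : normc z = 2 `^ s -> normc P.[z] <= la ^+ n * grothendieck_const R n.
  move=> zs.
  pose Y (y : J -> X -> C) j x := (D j `^ n%:R^-1 / la)%:C * (z ^+ lev y j x * xh y j x).
  have -> : P.[z] = (la ^+ n)%:C * \sum_j \sum_l c j l *
      mform b (rcons (map (fun y => y j) (map Y ys)) (psi l)).
    rewrite PE mulr_sumr; apply: eq_bigr => j _; rewrite mulr_sumr.
    apply: eq_bigr => l _; rewrite -map_comp.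
    have -> : [seq ((fun y => y j) \o Y) i | i <- ys] =
        map (fun phi x => (D j `^ n%:R^-1 / la)%:C * phi x)
          (map (fun y x => z ^+ lev y j x * xh y j x) ys) by rewrite -map_comp.
    rewrite -[in RHS]cats1 mformZ_prefix cats1 size_map sz.
    rewrite -!mulrA [RHS]mulrCA; congr (_ * _); rewrite !mulrA -rmorphXn -rmorphM; congr (_%:C * _).
    rewrite expr_div_n -[X in _ * (X / _)]powR_mulrn ?powR_ge0// -powRrM mulVf ?gt_eqF//.
    by rewrite powRr1 ?ltW// [RHS]mulrC divfK// expf_neq0// gt_eqF.
  rewrite normcM normc_real ger0_norm ?exprn_ge0 ?(ltW la0)// ler_wpM2l ?exprn_ge0 ?(ltW la0)//.
  apply: grothendieck_blei => //; rewrite ?size_map//.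
  apply/allp_map; have := conj ys_le hP.
  move: {sz} ys_le hP => {xh2 P PE bnd_one} ; elim: (ys) => //= y ys' IH [y_le ys_le] [hy hys] _.
  split; last exact: IH.
  move=> x; apply: le_trans (y_le x); apply: ler_sum => j _.
  rewrite mulrC powRrM [leRHS]powR_mulrn ?powR_ge0//.
  rewrite ler_sqr ?nnegrE ?normc_ge0 ?powR_ge0//.
  have [yj0|yj0] := eqVneq (y j x) 0.
    by rewrite /Y y0N// !mulr0 normc0 powR_ge0.
  have /andP[le_lev lt_lev] := levelP (hy j x yj0); rewrite -/(lev y j x) in le_lev lt_lev.
  rewrite normcM normc_real ger0_norm ?divr_ge0 ?powR_ge0 ?(ltW la0)// normcM.
  rewrite normcX zs.
  have h1 : (2 `^ s) ^+ lev y j x <= (a y j x * 2 ^+ h) `^ s.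
    rewrite -powR_mulrn ?powR_ge0// -powRrM mulrC powRrM powR_mulrn//.
    by apply: le_powR_base => //; rewrite ?(ltW s0)// exprn_ge0.
  have h2 : normc (xh y j x) <= 2.
    by rewrite xhE ler_pdivrMr ?exprn_gt0// -exprS ltW.
  have a0 : 0 <= a y j x by rewrite divr_ge0 ?normc_ge0// ltW.
  have h3 : (a y j x * 2 ^+ h) `^ s = normc (y j x) `^ s / D j `^ n%:R^-1 * (2 ^+ h) `^ s.
    rewrite powRM ?exprn_ge0//; congr (_ * _).
    rewrite /a powRM ?normc_ge0 ?invr_ge0 ?(ltW (de0 j))//; congr (_ * _).
    rewrite -powR_inv1 ?(ltW (de0 j))// -powRrM mulN1r powRN /de -powRrM.
    by rewrite invfM mulrAC mulVf ?mul1r// gt_eqF.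
  have h4 : (2 `^ s) ^+ lev y j x * normc (xh y j x) <= (a y j x * 2 ^+ h) `^ s * 2.
    by apply: ler_pM; rewrite ?exprn_ge0 ?powR_ge0 ?normc_ge0.
  apply: le_trans (ler_wpM2l _ h4) _; first by rewrite divr_ge0 ?powR_ge0 ?ltW.
  rewrite h3 /la; apply: le_of_eq.
  have : D j `^ n%:R^-1 != 0 by rewrite gt_eqF ?powR_gt0.
  have : (2 ^+ h) `^ s != 0 :> R by rewrite gt_eqF ?powR_gt0 ?exprn_gt0.
  move: (_ `^ s) (_ `^ n%:R^-1) (_ `^ s) => u v w w0 v0; field.
  by rewrite v0 w0.
have P2E : P.[2] = (2 ^+ (h * n))%:C * \sum_j \sum_l (D j `^ (1 - s^-1))%:C * c j l *
    mform b (rcons (map (fun y => y j) ys) (psi l)).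
  rewrite PE mulr_sumr; apply: eq_bigr => j _; rewrite mulr_sumr.
  apply: eq_bigr => l _.
  have -> : map (fun y x => 2 ^+ lev y j x * xh y j x) ys =
      map (fun phi x => (2 ^+ h / de j)%:C * phi x) (map (fun y => y j) ys).
    rewrite -map_comp; apply: eq_map => y; apply/funext => x /=.
    rewrite /xh mulrA -(rmorph_nat (real_complex R)) -rmorphXn -rmorphM.
    congr (_%:C * _); rewrite invfM [LHS]mulrCA; congr (_ * _); rewrite mulrA divff ?mul1r//.
  rewrite -[in LHS]cats1 mformZ_prefix cats1 size_map sz !mulrA; congr (_ * _).
  rewrite -mulrA -rmorphXn -!rmorphM [RHS]mulrC; congr (_ * _%:C).
  rewrite expr_div_n -exprM mulrCA; congr (_ * _).
  rewrite /de -powR_mulrn ?powR_ge0// -powRrM invfM mulfVK ?gt_eqF//.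
  rewrite powRB; last by apply/implyP => _; rewrite gt_eqF.
  by rewrite powRr1 ?(ltW (D0 j)).
have h2 : normc P.[2] <= 2 ^+ (h * n) * interpolation_const n s.
  apply: horner2_le => //.
  - by rewrite /grothendieck_const mulr_ge0// exprn_ge0// mulr_ge0.
  - move=> m; have := @cauchy_estimate _ P 1 (2 ^+ n) m ltr01.
    rewrite expr1n mulr1; apply => z z1; apply: bnd_one.
    by rewrite mul1r.
  - move=> m; apply: cauchy_estimate; first exact: powR_gt0.
    move=> z z1; apply: le_trans (bnd_two _ _) _.
      by rewrite normcM normc_real z1 mulr1 ger0_norm// powR_ge0.
    rewrite /la exprMn mulrAC ler_wpM2l// ?mulr_ge0 ?exprn_ge0//.
    apply: le_of_eq.
    rewrite exprM; congr (_ ^+ n).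
    by rewrite -[in LHS]powR_mulrn// -powRrM mulrC powRrM powR_mulrn ?powR_ge0.
by move: h2; rewrite P2E normcM normc_real ger0_norm ?exprn_ge0// ler_pM2l.
Qed.

End interpolation.

(** * Hilbert summability *)

Section summability.
Context (R : realType).
Local Notation C := R[i].

(** Up to the exponent, the summability in j of the Hilbert norms of the images of
    a_j under any operator from l_1 to l_2 of norm at most 1, the columns of psi
    being the images of the unit vectors. *)
Definition hilbert_summable (J X : finType) (sigma K : R) (a : J -> X -> C) :=
  forall (L : finType) (psi : L -> X -> C),
    (forall i, \sum_l normc (psi l i) ^+ 2 <= 1) ->
    \sum_j (\sum_l normc (\sum_i psi l i * a j i) ^+ 2) `^ sigma <= K.

Definition form_const n (s : R) : R :=
  if s == 1 then grothendieck_const R n else interpolation_const n s.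

Lemma grothendieck_const_ge0 n : 0 <= grothendieck_const R n.
Proof. by rewrite /grothendieck_const mulr_ge0// exprn_ge0// mulr_ge0. Qed.

Lemma form_const_ge0 n (s : R) : 1 <= s -> 0 <= form_const n s.
Proof.
rewrite le_eqVlt eq_sym /form_const => /orP[->|s1]; first exact: grothendieck_const_ge0.
rewrite gt_eqF// /interpolation_const mulr_ge0 ?exprn_ge0// addr_ge0//.
rewrite divr_ge0 ?grothendieck_const_ge0// subr_ge0 ltW//.
rewrite -[ltRHS](powRr0 2) /powR pnatr_eq0/= ltr_expR.
by rewrite ltr_pM2r ?subr_lt0// ln_gt0// ltr1n.
Qed.

Lemma normc_conj_mul (z : C) : z^* * z = (normc z ^+ 2)%:C.
Proof. by rewrite sqr_normc; case: z => a b /=; apply/eqP; rewrite eq_complex/=; apply/andP; split; apply/eqP; ring. Qed.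

Lemma normc_conj (z : C) : normc z^* = normc z.
Proof. by case: z => a b /=; rewrite sqrrN. Qed.

(** Duality in the Hilbert norm turns the left-hand side into the sums bounded by
    Grothendieck's inequality, with weights D_j that may be chosen freely.
    Taking D_j proportional to the terms of the sum M to be estimated gives
    M <= C (2 M)^(1 - 1/s), hence a bound on M. *)
Lemma multilinear_hilbert_summable (X : finType) (b : seq X -> C) n
    (J : finType) (ys : seq (J -> X -> C)) (s : R) :
  (2 <= n)%N -> size ys = n -> sup_bounded n.+1 1 b -> 1 <= s ->
  allp (fun y => forall x, \sum_j normc (y j x) `^ (2 * s) <= 1) ys ->
  hilbert_summable (s / 2) ((2 * form_const n s) `^ s)
    (fun j i => mform b (rcons (map (fun y => y j) ys) (fun x => (x == i)%:R))).
Proof.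
move=> n2 sz b1 s1 ys_le L psi psi_le.
have s0 : 0 < s by exact: lt_le_trans s1.
pose Z j l := mform b (rcons (map (fun y => y j) ys) (psi l)).
have ZE j l : \sum_i psi l i * mform b (rcons (map (fun y => y j) ys)
    (fun x => (x == i)%:R)) = Z j l.
  rewrite sum_mform_rcons; congr (mform b (rcons _ _)); apply/funext => x.
  rewrite (bigD1 x)//= eqxx mulr1 big1 ?addr0// => i ix.
  by rewrite eq_sym (negPf ix) mulr0.
under eq_bigr => j _ do under eq_bigr => l _ do rewrite ZE.
pose N j := \sum_l normc (Z j l) ^+ 2.
have N0 j : 0 <= N j by apply: sumr_ge0 => l _; exact: sqr_ge0.
set M := \sum_j _.
have {M} -> : M = \sum_j N j `^ (s / 2) by [].
set M := \sum_j _.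
have K0 := form_const_ge0 n s1.
have [M0|Mneq0] := eqVneq M 0; first by rewrite M0 powR_ge0.
have M_gt0 : 0 < M by rewrite lt0r Mneq0 sumr_ge0// => j _; exact: powR_ge0.
have J0 : 0 < #|J|%:R :> R.
  rewrite ltr0n lt0n; apply: contraNneq Mneq0 => /card0_eq J0.
  by apply/eqP; rewrite /M big1// => j _; have := J0 j.
pose Q j := N j `^ 2^-1.
have Q0 j : 0 <= Q j by exact: powR_ge0.
have QQ j : Q j ^+ 2 = N j.
  by rewrite /Q -powR_mulrn ?powR_ge0// -powRrM mulVf ?powRr1// pnatr_eq0.
pose c j l : C := ((Q j)^-1)%:C * (Z j l)^*.
have c_le j : \sum_l normc (c j l) ^+ 2 <= 1.
  under eq_bigr => l _ do rewrite sqr_normc_scale normc_conj.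
  rewrite -mulr_sumr -/(N j) -QQ exprVn.
  by have [->|qj] := eqVneq (Q j) 0; rewrite ?expr0n/= ?mulr0// mulVf ?expf_neq0.
have cZ j : \sum_l c j l * Z j l = (Q j)%:C.
  under eq_bigr => l _ do rewrite /c -mulrA normc_conj_mul.
  rewrite -mulr_sumr -rmorph_sum -/(N j) -QQ -rmorphM; congr (_%:C).
  by have [->|qj] := eqVneq (Q j) 0; rewrite ?invr0 ?mul0r// expr2 mulKf.
(* The second summand only serves to make D j positive. *)
pose D j := (N j `^ (s / 2) / M + #|J|%:R^-1) / 2.
have D0 j : 0 < D j.
  by rewrite divr_gt0// ltr_wpDl ?invr_gt0// divr_ge0 ?powR_ge0 ?ltW.
have D1 : \sum_j D j <= 1.
  rewrite -mulr_suml big_split/= -mulr_suml divff// sumr_const -[X in _ + X]mulr_natl.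
  by rewrite -[X in X%:R * _]/#|J| divff ?gt_eqF//; lra.
have main : \sum_j D j `^ (1 - s^-1) * Q j <= form_const n s.
  have -> : \sum_j D j `^ (1 - s^-1) * Q j =
      normc (\sum_j \sum_l (D j `^ (1 - s^-1))%:C * c j l * Z j l).
    rewrite (_ : \sum_j _ = (\sum_j D j `^ (1 - s^-1) * Q j)%:C).
      rewrite normc_real ger0_norm// sumr_ge0// => j _.
      by rewrite mulr_ge0 ?powR_ge0.
    rewrite rmorph_sum; apply: eq_bigr => j _; rewrite [RHS]rmorphM/= -cZ mulr_sumr.
    by apply: eq_bigr => l _; rewrite [RHS]mulrA.
  rewrite /form_const; have [s_eq1|sneq1] := eqVneq s 1; last first.
    apply: interpolated_grothendieck => //.
    by rewrite lt_def sneq1.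
  rewrite [X in normc X](_ : _ = \sum_j \sum_l c j l * Z j l); last first.
    apply: eq_bigr => j _; apply: eq_bigr => l _.
    by rewrite s_eq1 invr1 subrr powRr0 rmorph1 mul1r.
  apply: grothendieck_blei => //; apply: sub_allp ys_le => y y_le x.
  apply: le_trans (y_le x); apply: ler_sum => j _.
  by rewrite s_eq1 mulr1 powR_mulrn ?normc_ge0.
have e0 : 0 <= 1 - s^-1 by rewrite subr_ge0 invf_le1.
have hM : M <= form_const n s * (2 * M) `^ (1 - s^-1).
  rewrite -ler_pdivrMr ?powR_gt0 ?mulr_gt0//; apply: le_trans main.
  rewrite mulr_suml; apply: ler_sum => j _.
  have h1 : (N j `^ (s / 2) / (2 * M)) `^ (1 - s^-1) <= D j `^ (1 - s^-1).
    apply: le_powR_base => //; first by rewrite divr_ge0 ?powR_ge0 ?mulr_ge0 ?ltW.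
    rewrite /D invfM [2^-1 * _]mulrC mulrA ler_wpM2r ?invr_ge0//.
    by rewrite lerDl invr_ge0.
  apply: le_trans (ler_wpM2r (Q0 j) h1).
  rewrite [(_ / _) `^ _]powRM ?powR_ge0 ?invr_ge0 ?mulr_ge0 ?(ltW M_gt0)//.
  have -> : (2 * M)^-1 `^ (1 - s^-1) = ((2 * M) `^ (1 - s^-1))^-1.
    by rewrite -[in LHS](@powR_inv1 _ (2 * M)) ?mulr_ge0 ?(ltW M_gt0)// -powRrM mulN1r powRN.
  have eE : s / 2 * (1 - s^-1) + 2^-1 = s / 2 by field; rewrite gt_eqF.
  rewrite [leRHS]mulrAC ler_wpM2r ?invr_ge0 ?powR_ge0// -powRrM /Q -powRD eE//.
  by apply/implyP; rewrite mulf_eq0 invr_eq0 pnatr_eq0 (gt_eqF s0).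
have M1 : M `^ s^-1 <= 2 * form_const n s.
  rewrite -(ler_pM2r (_ : 0 < M `^ (1 - s^-1))) ?powR_gt0//.
  rewrite -powRD ?subrKC; last by apply/implyP => _; rewrite gt_eqF.
  rewrite powRr1 ?(ltW M_gt0)//; apply: le_trans hM _.
  rewrite [2 * form_const _ _]mulrC -mulrA ler_wpM2l// powRM ?(ltW M_gt0)// ler_wpM2r ?powR_ge0//.
  rewrite -[leRHS]powRr1//; apply: ler_powR; rewrite ?ler1n// gerBl.
  by rewrite invr_ge0 ltW.
have := le_powR_base (ltW s0) (powR_ge0 _ _) M1.
by rewrite -powRrM mulVf ?gt_eqF// powRr1// ltW.
Qed.

End summability.

(** * Change of density *)

Section finite_holder.
Context (R : realType).
Implicit Types x y : R.

Lemma weighted_amgm (al be x y : R) : 0 <= al -> 0 <= be -> al + be = 1 ->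
  0 <= x -> 0 <= y -> x `^ al * y `^ be <= al * x + be * y.
Proof.
rewrite le_eqVlt => /predU1P[<- _|al0].
  by rewrite add0r => -> _ y0; rewrite powRr0 powRr1// mul0r add0r mul1r.
rewrite le_eqVlt => /predU1P[<-|be0].
  by rewrite addr0 => -> x0 _; rewrite powRr0 powRr1// mul0r addr0 mulr1 mul1r.
move=> albe x0 y0.
have := @conjugate_powR R (x `^ al) (y `^ be) al^-1 be^-1 (powR_ge0 _ _) (powR_ge0 _ _).
rewrite !invr_gt0 !invrK -!powRrM !divff ?gt_eqF// !powRr1// [x * _]mulrC [y * _]mulrC.
exact.
Qed.

Lemma holder_sum (J : finType) (al be : R) (u v : J -> R) :
  0 <= al -> 0 <= be -> al + be = 1 ->
  (forall j, 0 <= u j) -> (forall j, 0 <= v j) ->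
  \sum_j u j `^ al * v j `^ be <= (\sum_j u j) `^ al * (\sum_j v j) `^ be.
Proof.
move=> al0 be0 albe u0 v0.
have [alE|al_neq0] := eqVneq al 0.
  rewrite alE add0r in albe; rewrite alE albe powRr0 mul1r powRr1 ?sumr_ge0//.
  by apply: ler_sum => j _; rewrite powRr0 mul1r powRr1.
have [beE|be_neq0] := eqVneq be 0.
  rewrite beE addr0 in albe; rewrite beE albe powRr0 mulr1 powRr1 ?sumr_ge0//.
  by apply: ler_sum => j _; rewrite powRr0 mulr1 powRr1.
have sum0 (w : J -> R) : (forall j, 0 <= w j) -> \sum_j w j = 0 -> forall j, w j = 0.
  move=> w0 /eqP; rewrite psumr_eq0// => /allP h j; apply/eqP.
  by apply: h; rewrite mem_index_enum.
have [U0|Uneq0] := eqVneq (\sum_j u j) 0.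
  rewrite big1 ?mulr_ge0 ?powR_ge0// => j _.
  by rewrite (sum0 u)// powR0// mul0r.
have [V0|Vneq0] := eqVneq (\sum_j v j) 0.
  rewrite big1 ?mulr_ge0 ?powR_ge0// => j _.
  by rewrite (sum0 v)// (powR0 be_neq0) mulr0.
set U := \sum_j u j; set V := \sum_j v j.
have Ugt0 : 0 < U by rewrite lt0r Uneq0 sumr_ge0.
have Vgt0 : 0 < V by rewrite lt0r Vneq0 sumr_ge0.
have E j : u j `^ al * v j `^ be =
    (u j / U) `^ al * (v j / V) `^ be * (U `^ al * V `^ be).
  rewrite mulrACA -!powRM ?divr_ge0 ?(ltW Ugt0) ?(ltW Vgt0)//.
  by rewrite !divfK.
under eq_bigr do rewrite E.
rewrite -mulr_suml ler_piMl ?mulr_ge0 ?powR_ge0//.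
apply: (@le_trans _ _ (\sum_j (al * (u j / U) + be * (v j / V)))).
  by apply: ler_sum => j _; apply: weighted_amgm;
    rewrite ?divr_ge0 ?(ltW Ugt0) ?(ltW Vgt0).
by rewrite big_split/= -!mulr_sumr -!mulr_suml !divff// !mulr1 albe.
Qed.

(** The largest term is at least the average. *)
Lemma powR_sum_le (I : finType) (x : I -> R) (sigma : R) : 0 < sigma ->
  (forall i, 0 <= x i) -> (\sum_i x i) `^ sigma <= \sum_i (#|I|%:R * x i) `^ sigma.
Proof.
move=> s0 x0; have [i0 _|I0] := pickP (@predT I); last first.
  rewrite [X in X `^ _]big1 => [|i _]; last by have := I0 i.
  by rewrite powR0 ?gt_eqF// sumr_ge0// => i _; exact: powR_ge0.
have [i _ imax] := Order.TotalTheory.arg_maxP x (erefl : xpredT i0).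
apply: (@le_trans _ _ ((#|I|%:R * x i) `^ sigma)).
  apply: le_powR_base; rewrite ?(ltW s0) ?sumr_ge0//.
  apply: le_trans (_ : \sum_(j : I) x i <= _); last by rewrite sumr_const mulr_natl.
  by apply: ler_sum => j _; exact: imax.
by rewrite (bigD1 i)//= lerDl sumr_ge0// => j _; exact: powR_ge0.
Qed.

Lemma powRD_le (sigma x y : R) : 0 <= sigma <= 1 -> 0 <= x -> 0 <= y ->
  (x + y) `^ sigma <= 2 * (x `^ sigma + y `^ sigma).
Proof.
move=> /andP[s0 s1]; wlog : x y / x <= y => [wl|xy] x0 y0.
  have [xy|/ltW yx] := leP x y; first exact: wl.
  by rewrite addrC [X in _ * X]addrC wl.
apply: (@le_trans _ _ ((2 * y) `^ sigma)).
  by apply: le_powR_base; rewrite ?addr_ge0//; lra.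
rewrite powRM// mulrDr ler_wpDl ?mulr_ge0 ?powR_ge0//.
rewrite ler_wpM2r ?powR_ge0// -[leRHS]powRr1//; apply: ler_powR => //.
by rewrite ler1n.
Qed.

(** A quadratic lower bound for a concave power near 1, obtained from the weighted
    arithmetic-geometric inequality for the complementary exponent. *)
Lemma powR_tangent (sigma u : R) : 0 < sigma < 1 -> - (2^-1) <= u ->
  1 + sigma * u - u ^+ 2 <= (1 + u) `^ sigma.
Proof.
move=> /andP[s0 s1] hu; have u1 : 0 < 1 + u by lra.
have := @weighted_amgm (1 - sigma) sigma (1 + u) 1 _ _ _ (ltW u1) ler01.
rewrite subr_ge0 (ltW s1) (ltW s0) subrK powR1 !mulr1 => /(_ isT isT erefl).
set q := (1 - sigma) * (1 + u) + sigma => hq; set p := _ `^ sigma.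
have qE : q = 1 + (1 - sigma) * u by rewrite /q; ring.
have pq : 1 + u <= p * q.
  have uE : 1 + u = (1 + u) `^ sigma * (1 + u) `^ (1 - sigma).
    rewrite -powRD ?subrKC ?powRr1 ?(ltW u1)//.
    by apply/implyP => _; rewrite gt_eqF.
  by rewrite [leLHS]uE ler_wpM2l ?powR_ge0.
have q0 : 0 < q by rewrite qE; nra.
rewrite -(ler_pM2r q0); apply: le_trans pq; rewrite qE.
have : 0 <= u ^+ 2 by exact: sqr_ge0.
have : 0 <= 1 - sigma * (1 - sigma) + (1 - sigma) * u by nra.
nra.
Qed.

Lemma powR_tangent_scaled (sigma y d : R) : 0 < sigma < 1 -> 0 < y -> - (y / 2) <= d ->
  y `^ sigma + sigma * (y `^ (sigma - 1) * d) - y `^ sigma * (d / y) ^+ 2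
    <= (y + d) `^ sigma.
Proof.
move=> s01 y0 yd; have := @powR_tangent sigma (d / y) s01 _.
rewrite ler_pdivlMr// mulNr [2^-1 * y]mulrC => /(_ yd) h.
have -> : y + d = y * (1 + d / y) by field; rewrite gt_eqF.
have u1 : 0 <= 1 + d / y.
  have : - 2^-1 <= d / y by rewrite ler_pdivlMr// mulNr [2^-1 * y]mulrC.
  by lra.
rewrite powRM ?(ltW y0)//; apply: le_trans (ler_wpM2l (powR_ge0 _ _) h).
rewrite powRB; last by apply/implyP => _; rewrite gt_eqF.
rewrite powRr1 ?(ltW y0)//; apply: le_of_eq; ring.
Qed.

End finite_holder.

Section density.
Context (R : realType).

(** Maurey's change of density: at a maximizer mu of the concave functional
    sum_j v_j^sigma on the convex set W, first order optimality says
    sum_j mu_j^(sigma-1) (w_j - mu_j) <= 0 for all w in W.  As W need not be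
    compact, an almost maximizer of sum_j (v_j + eta)^sigma is used; the shift
    eta > 0 bounds the second order term uniformly, so that moving from v
    towards w by a small t and comparing with the supremum suffices. *)
Lemma exists_density (J : finType) (W : set (J -> R)) (sigma B : R) :
  0 < sigma < 1 -> W !=set0 ->
  (forall v, W v -> forall j, 0 <= v j) ->
  (forall v w t, W v -> W w -> 0 <= t <= 1 -> W (fun j => v j + t * (w j - v j))) ->
  (forall v, W v -> \sum_j v j `^ sigma <= B) ->
  exists mu : J -> R, [/\ forall j, 0 < mu j,
    \sum_j mu j `^ sigma <= 2 * (B + 1) &
    forall w, W w -> \sum_j mu j `^ (sigma - 1) * w j <= 2 * (B + 1) + 1].
Proof.
move=> s01 [v0 Wv0] Wge0 Wconv WB; have /andP[s0 s1] := s01.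
have B0 : 0 <= B by apply: le_trans (WB _ Wv0); apply: sumr_ge0 => j _; exact: powR_ge0.
pose c : R := (#|J|.+1%:R)^-1; have c0 : 0 < c by rewrite invr_gt0.
pose eta := c `^ sigma^-1; have eta0 : 0 < eta by exact: powR_gt0.
have etaE : eta `^ sigma = c by rewrite /eta -powRrM mulVf ?powRr1 ?gt_eqF// ltW.
pose G (v : J -> R) := \sum_j (v j + eta) `^ sigma.
have GB v : W v -> G v <= 2 * (B + 1).
  move=> Wv; apply: (@le_trans _ _ (\sum_j 2 * (v j `^ sigma + c))).
    apply: ler_sum => j _; rewrite -etaE; apply: powRD_le; rewrite ?(ltW s0) ?(ltW s1)//.
      exact: Wge0.
    exact: ltW.
  rewrite -mulr_sumr ler_wpM2l// big_split/= lerD ?WB// sumr_const -[X in _ *+ X]/#|J|.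
  by rewrite -[leLHS]mulr_natl /c ler_pdivrMr// mul1r ler_nat.
pose M := B `^ sigma^-1.
have WM w : W w -> forall j, w j <= M.
  move=> Ww j; have wj0 := Wge0 _ Ww j.
  rewrite -[leLHS]powRr1// -(@divff _ sigma) ?gt_eqF// powRrM.
  apply: le_powR_base; rewrite ?invr_ge0 ?(ltW s0) ?powR_ge0//.
  apply: le_trans (WB _ Ww); rewrite (bigD1 j)//= lerDl sumr_ge0// => i _.
  exact: powR_ge0.
have M0 : 0 <= M by exact: powR_ge0.
pose Q := 2 * (B + 1) * (M / eta) ^+ 2.
have Q0 : 0 <= Q by rewrite mulr_ge0 ?sqr_ge0// mulr_ge0// addr_ge0.
pose t := Num.min (2^-1) (sigma / (1 + Q)).
have t0 : 0 < t by rewrite lt_min invr_gt0 ltr0n/= divr_gt0// ltr_wpDr.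
have t2 : t <= 2^-1 by rewrite ge_min lexx.
have tQ : t * (1 + Q) <= sigma.
  by rewrite -ler_pdivlMr ?ltr_wpDr// ge_min lexx orbT.
have Gsup : has_sup (G @` W).
  by split; [exists (G v0); exists v0 | exists (2 * (B + 1)) => _ [v Wv <-]; exact: GB].
have [_ [v Wv <-] supv] := sup_adherent (exprn_gt0 2 t0) Gsup.
pose y j := v j + eta.
have y0 j : 0 < y j by rewrite ltr_wpDl// Wge0.
exists y; split=> // [|w Ww]; first exact: GB.
have wge0 := Wge0 _ Ww; have vge0 := Wge0 _ Wv.
have W' := Wconv _ _ t Wv Ww; rewrite (ltW t0) (le_trans t2)/= in W'; last first.
  by rewrite invf_le1// ler1n.
have Gsup' : G (fun j => v j + t * (w j - v j)) <= sup (G @` W).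
  by apply: ub_le_sup; [case: Gsup | exists (fun j => v j + t * (w j - v j)) => //; exact: W'].
have lower : \sum_j (y j `^ sigma + sigma * (y j `^ (sigma - 1) * (t * (w j - v j)))
     - y j `^ sigma * (t * (M / eta)) ^+ 2) <= G (fun j => v j + t * (w j - v j)).
  apply: ler_sum => j _.
  have -> : v j + t * (w j - v j) + eta = y j + t * (w j - v j) by rewrite /y; ring.
  have hd : - (y j / 2) <= t * (w j - v j).
    have := wge0 j; have := vge0 j; move: t2 t0 eta0; rewrite /y; nra.
  apply: le_trans (powR_tangent_scaled s01 (y0 j) hd).
  rewrite lerD2l lerN2 ler_wpM2l ?powR_ge0//.
  rewrite -mulrA !exprMn ler_wpM2l ?sqr_ge0// -!exprMn.
  rewrite -real_normK ?num_real// -[leRHS]real_normK ?num_real// ler_sqr ?nnegrE ?normr_ge0//.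
  rewrite !normrM !normfV (gtr0_norm (y0 j)) (gtr0_norm eta0) (ger0_norm M0).
  apply: ler_pM; rewrite ?invr_ge0 ?(ltW (y0 j))//.
    by rewrite ler_norml; have := WM _ Ww j; have := WM _ Wv j; have := wge0 j; have := vge0 j; lra.
  by rewrite lef_pV2 ?posrE// lerDr.
have hGv : G v = \sum_j y j `^ sigma by [].
rewrite !big_split/= -mulr_sumr sumrN -mulr_suml -hGv in lower.
have GvB := GB _ Wv.
have sumE : \sum_j y j `^ (sigma - 1) * (t * (w j - v j)) =
    t * (\sum_j y j `^ (sigma - 1) * w j - \sum_j y j `^ (sigma - 1) * v j).
  rewrite -sumrB mulr_sumr; apply: eq_bigr => j _; ring.
rewrite sumE in lower.
set S := \sum_j y j `^ (sigma - 1) * w j in lower *.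
set S' := \sum_j y j `^ (sigma - 1) * v j in lower *.
have S'le : S' <= 2 * (B + 1).
  apply: le_trans GvB; rewrite hGv; apply: ler_sum => j _.
  rewrite -[leRHS]mulr_powRB1 ?(ltW (y0 j))// mulrC ler_wpM2r ?powR_ge0//.
  by rewrite lerDl ltW.
have key : sigma * (t * (S - S')) <= t ^+ 2 + G v * (t * (M / eta)) ^+ 2.
  by have := le_trans lower Gsup'; move: supv; lra.
have key2 : G v * (t * (M / eta)) ^+ 2 <= t ^+ 2 * Q.
  rewrite exprMn mulrCA ler_wpM2l ?sqr_ge0// /Q ler_wpM2r ?sqr_ge0//.
have key3 : sigma * (S - S') <= t * (1 + Q).
  rewrite -(ler_pM2l t0); nra.
have : S - S' <= 1 by rewrite -(ler_pM2l s0) mulr1 (le_trans key3).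
lra.
Qed.

End density.

(** * From Hilbert summability to power sums *)

Lemma one_powR (R : realType) (x : R) : 1 `^ x = 1.
Proof. by rewrite powR1. Qed.

Section weights.
Context (R : realType).
Local Notation C := R[i].

Definition weighted (J X : Type) (beta : J -> R) (a : J -> X -> C) j i : C :=
  (beta j)%:C * a j i.

Lemma sqr_normc_weighted_sum (J X : finType) (beta : J -> R) (a : J -> X -> C)
    (f : X -> C) j :
  normc (\sum_i f i * weighted beta a j i) ^+ 2 =
  beta j ^+ 2 * normc (\sum_i f i * a j i) ^+ 2.
Proof.
rewrite -sqr_normc_scale mulr_sumr; congr (normc _ ^+ 2).
by apply: eq_bigr => i _; rewrite /weighted mulrCA.
Qed.

(** The values sum_k |psi_k(a_k)|_2^2, for all unit operators psi_k, form a convex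
    set of functions of j: convex combinations are realized by direct sums of
    Hilbert spaces.  The density mu of [exists_density] for this set gives the
    weights be_j = mu_j^((sigma-1)/2), up to a constant. *)
Lemma exists_summable_weights m (s K : R) : 1 <= s < 2 -> 0 <= K ->
  exists C1 C2 : R, [/\ 0 <= C1, 0 <= C2 &
  forall (J X : finType) (a : 'I_m -> J -> X -> C),
    (forall k, hilbert_summable (s / 2) K (a k)) ->
    exists La be : J -> R,
    [/\ (forall j, 0 <= La j) /\ \sum_j La j <= C1, forall j, 0 < be j,
        forall k, hilbert_summable 1 1 (weighted be (a k)) &
        forall j, (be j)^-1 <= C2 * La j `^ (s^-1 - 2^-1)]].
Proof.
move=> /andP[s1 s2] K0; have s0 : 0 < s by exact: lt_le_trans s1.
pose sigma := s / 2; have sg01 : 0 < sigma < 1.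
  by rewrite divr_gt0//= ltr_pdivrMr// mul1r.
have /andP[sg0 sg1] := sg01.
pose B : R := m%:R * (m%:R `^ sigma * K).
have B0 : 0 <= B by rewrite !mulr_ge0// powR_ge0.
pose B2 : R := 2 * (B + 1) + 1; have B20 : 0 < B2 by rewrite ltr_wpDl// mulr_ge0// addr_ge0.
exists (2 * (B + 1)), (Num.sqrt B2); split; rewrite ?sqrtr_ge0 ?mulr_ge0 ?addr_ge0//.
move=> J X a aK.
pose unit_family (L : finType) (psi : 'I_m -> L -> X -> C) :=
  forall k i, \sum_l normc (psi k l i) ^+ 2 <= 1.
pose val (L : finType) (psi : 'I_m -> L -> X -> C) j :=
  \sum_k \sum_l normc (\sum_i psi k l i * a k j i) ^+ 2.
pose W : set (J -> R) := fun v => exists (L : finType) (psi : 'I_m -> L -> X -> C),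
  unit_family L psi /\ v = val L psi.
have Wval L psi : unit_family L psi -> W (val L psi) by move=> h; exists L, psi.
have W0 : exists v, W v.
  exists (val _ (fun _ (_ : unit) _ => 0)); apply: Wval => k i.
  by rewrite big1// => l _; rewrite normc0 expr0n.
have Wge0 v : W v -> forall j, 0 <= v j.
  move=> [L [psi [_ ->]]] j; apply: sumr_ge0 => k _; apply: sumr_ge0 => l _.
  exact: sqr_ge0.
have Wconv v w t : W v -> W w -> 0 <= t <= 1 -> W (fun j => v j + t * (w j - v j)).
  move=> [L [psi [psi1 ->]]] [L' [psi' [psi'1 ->]]] /andP[t0 t1].
  have t1' : 0 <= 1 - t by rewrite subr_ge0.
  pose phi k (l : L + L') i : C := match l with
    | inl l => (Num.sqrt (1 - t))%:C * psi k l i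
    | inr l => (Num.sqrt t)%:C * psi' k l i end.
  have phi1 : unit_family _ phi.
    move=> k i; rewrite big_sumType/=.
    under eq_bigr do rewrite sqr_normc_scale sqr_sqrtr//.
    under [X in _ + X]eq_bigr do rewrite sqr_normc_scale sqr_sqrtr//.
    rewrite -!mulr_sumr; have := psi1 k i; have := psi'1 k i; nra.
  suff -> : (fun j => val L psi j + t * (val L' psi' j - val L psi j)) =
      val _ phi by exact: Wval.
  have scale_sum k j (c : R) (f : X -> C) : 0 <= c ->
      normc (\sum_i (Num.sqrt c)%:C * f i * a k j i) ^+ 2 =
      c * normc (\sum_i f i * a k j i) ^+ 2.
    move=> c0; rewrite -[in RHS](sqr_sqrtr c0) -sqr_normc_scale mulr_sumr.
    by congr (normc _ ^+ 2); apply: eq_bigr => i _; rewrite mulrA.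
  apply/funext => j; rewrite /val -sumrB mulr_sumr -big_split/=.
  apply: eq_bigr => k _; rewrite big_sumType/=.
  under [in RHS]eq_bigr => l _ do rewrite scale_sum//.
  under [X in _ = _ + X]eq_bigr => l _ do rewrite scale_sum//.
  by rewrite -!mulr_sumr; ring.
have WB v : W v -> \sum_j v j `^ sigma <= B.
  move=> [L [psi [psi1 ->]]].
  pose x j k := \sum_l normc (\sum_i psi k l i * a k j i) ^+ 2.
  have x0 j k : 0 <= x j k by apply: sumr_ge0 => l _; exact: sqr_ge0.
  apply: (@le_trans _ _ (\sum_j \sum_k (m%:R * x j k) `^ sigma)).
    apply: ler_sum => j _.
    by have := powR_sum_le sg0 (x0 j); rewrite card_ord.
  rewrite exchange_big/=.
  apply: (@le_trans _ _ (\sum_(k < m) m%:R `^ sigma * K)).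
    apply: ler_sum => k _; under eq_bigr => j _ do rewrite powRM//.
    by rewrite -mulr_sumr ler_wpM2l ?powR_ge0//; apply: aK => i; exact: psi1.
  by rewrite sumr_const card_ord /B mulr_natl.
have [mu [mu0 mu1 muW]] := exists_density sg01 W0 Wge0 Wconv WB.
pose be j := Num.sqrt (mu j `^ (sigma - 1) / B2).
have be0 j : 0 < be j by rewrite sqrtr_gt0 divr_gt0// powR_gt0.
exists (fun j => mu j `^ sigma), be; split=> // [|k L psi psi1|j].
- by split=> // j; exact: powR_ge0.
- pose phi (k' : 'I_m) l i : C := if k' == k then psi l i else 0.
  have phi1 : unit_family L phi.
    move=> k' i; rewrite /phi; case: eqP => _; first exact: psi1.
    by rewrite big1// => l _; rewrite normc0 expr0n.
  have := muW _ (Wval _ _ phi1); rewrite -/B2 => h.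
  under eq_bigr => j _.
    rewrite powRr1; last by apply: sumr_ge0 => l _; exact: sqr_ge0.
    under eq_bigr => l _ do rewrite sqr_normc_weighted_sum.
    rewrite -mulr_sumr /be sqr_sqrtr; last by rewrite divr_ge0 ?powR_ge0// ltW.
    rewrite mulrAC; over.
  rewrite -mulr_suml ler_pdivrMr// mul1r; apply: le_trans h.
  apply: ler_sum => j _; rewrite ler_wpM2l ?powR_ge0// /val (bigD1 k)//=.
  rewrite /phi eqxx lerDl; apply: sumr_ge0 => k' _; apply: sumr_ge0 => l _.
  exact: sqr_ge0.
- rewrite /be -sqrtrV ?divr_ge0 ?powR_ge0 ?(ltW B20)//.
  rewrite invfM invrK mulrC sqrtrM ?(ltW B20)// ler_wpM2l ?sqrtr_ge0//.
  rewrite -powRN opprB -powR12_sqrt ?powR_ge0// -!powRrM.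
  rewrite (_ : (1 - sigma) * 2^-1 = sigma * (s^-1 - 2^-1))//.
  by rewrite /sigma; field; rewrite gt_eqF.
Qed.

(** Hoelder's inequality with exponents 1 / (1 - 2/s) and s / 2. *)
Lemma multiplied_hilbert_summable (J X : finType) (s K : R) (a : J -> X -> C)
    (D : J -> R) :
  2 <= s -> 0 < K -> hilbert_summable (s / 2) K a ->
  (forall j, 0 <= D j) -> \sum_j D j <= 1 ->
  hilbert_summable 1 1 (weighted (fun j => D j `^ (2^-1 - s^-1) / K `^ s^-1) a).
Proof.
move=> s2 K0 aK D0 D1 L psi psi1; have s0 : 0 < s by exact: lt_le_trans s2.
have hN := aK _ _ psi1.
pose N j := \sum_l normc (\sum_i psi l i * a j i) ^+ 2.
have N0 j : 0 <= N j by apply: sumr_ge0 => l _; exact: sqr_ge0.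
pose k2 := K `^ (2 / s).
have k20 : 0 < k2 by exact: powR_gt0.
have -> : \sum_j (\sum_l normc (\sum_i psi l i * weighted
    (fun j => D j `^ (2^-1 - s^-1) / K `^ s^-1) a j i) ^+ 2) `^ 1 =
  \sum_j D j `^ (1 - 2 / s) * (N j `^ (s / 2)) `^ (2 / s) / k2.
  apply: eq_bigr => j _; rewrite powRr1; last by apply: sumr_ge0 => l _; exact: sqr_ge0.
  under eq_bigr => l _ do rewrite sqr_normc_weighted_sum.
  have sE : s / 2 * (2 / s) = 1 by field; rewrite gt_eqF.
  rewrite -mulr_sumr -/(N j) -(powRrM (N j)) sE powRr1// [RHS]mulrAC; congr (_ * _).
  rewrite expr_div_n -!powR_mulrn ?powR_ge0// -!powRrM; congr (_ `^ _ / _ `^ _).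
    by field; rewrite gt_eqF.
  by field; rewrite gt_eqF.
rewrite -mulr_suml ler_pdivrMr// mul1r.
have e0 : 0 <= 1 - 2 / s by rewrite subr_ge0 ler_pdivrMr// mul1r.
have e1 : 0 <= 2 / s by rewrite divr_ge0 ?ltW.
apply: le_trans (holder_sum e0 e1 _ D0 (fun j => powR_ge0 (N j) (s / 2))) _; first by ring.
have h1 : (\sum_j D j) `^ (1 - 2 / s) <= 1.
  by rewrite -[leRHS](one_powR (1 - 2 / s)); apply: le_powR_base; rewrite ?sumr_ge0.
rewrite -[leRHS]mul1r; apply: ler_pM; rewrite ?powR_ge0//.
by apply: le_powR_base; rewrite ?sumr_ge0// => j _; exact: powR_ge0.
Qed.

(** The hypothesis on V says that V_j <= A be_j^-m om_j^g whenever the weights be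
    make all a_k summable with exponent 1.  For s < 2 the weights of
    [exists_summable_weights] exist beforehand and Hoelder's inequality
    concludes.  For s >= 2, where 1/s - 1/2 <= 0, any D with sum at most 1
    provides weights D_j^(1/2 - 1/s); choosing D_j proportional to V_j^r yields
    M^(1/r) <= A' for the sum M. *)
Lemma sum_power_bound m (s g K A r : R) : 1 <= s -> 0 <= g -> 0 < K -> 0 <= A ->
  0 < r -> r^-1 = m%:R / s - m%:R / 2 + g ->
  exists2 B : R, 0 <= B &
  forall (J X : finType) (a : 'I_m -> J -> X -> C) (V : J -> R),
    (forall k, hilbert_summable (s / 2) K (a k)) -> (forall j, 0 <= V j) ->
    (forall be : J -> R, (forall j, 0 <= be j) ->
      (forall k, hilbert_summable 1 1 (weighted be (a k))) ->
      exists om : J -> R, [/\ forall j, 0 <= om j, \sum_j om j <= 1 &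
        forall j, be j ^+ m * V j <= A * om j `^ g]) ->
    \sum_j V j `^ r <= B.
Proof.
move=> s1 g0 K0 A0 r0 rE; have s0 : 0 < s by exact: lt_le_trans s1.
have [s2|s2] := ltP s 2.
  have [|C1 [C2 [C10 C20 h]]] := @exists_summable_weights m s K _ (ltW K0).
    by rewrite s1 s2.
  pose al := (s^-1 - 2^-1) * m%:R * r; pose ga := g * r.
  have al0 : 0 <= al.
    by rewrite !mulr_ge0 ?(ltW r0)// subr_ge0 lef_pV2 ?posrE// ltW.
  have ga0 : 0 <= ga by rewrite mulr_ge0// ltW.
  have alga : al + ga = 1.
    have -> : al + ga = r^-1 * r by rewrite rE /al /ga; ring.
    by rewrite mulVf// gt_eqF.
  exists ((A * C2 ^+ m) `^ r * C1 `^ al); first by rewrite mulr_ge0 ?powR_ge0.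
  move=> J X a V aK V0 hV; have [La [be [[La0 La1] be0 bea beLa]]] := h J X a aK.
  have [om [om0 om1 omV]] := hV be (fun j => ltW (be0 j)) bea.
  apply: (@le_trans _ _ (\sum_j (A * C2 ^+ m) `^ r * (La j `^ al * om j `^ ga))).
    apply: ler_sum => j _.
    have -> : (A * C2 ^+ m) `^ r * (La j `^ al * om j `^ ga) =
       ((C2 * La j `^ (s^-1 - 2^-1)) ^+ m * (A * om j `^ g)) `^ r.
      rewrite exprMn -(powR_mulrn _ (powR_ge0 _ _)) -powRrM.
      have -> : C2 ^+ m * La j `^ ((s^-1 - 2^-1) * m%:R) * (A * om j `^ g) =
          A * C2 ^+ m * (La j `^ ((s^-1 - 2^-1) * m%:R) * om j `^ g) by ring.
      by rewrite !powRM ?mulr_ge0 ?powR_ge0 ?exprn_ge0// -!powRrM.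
    apply: le_powR_base; rewrite ?(ltW r0)//.
    have -> : V j = (be j)^-1 ^+ m * (be j ^+ m * V j).
      by rewrite mulrA -exprMn mulVf ?gt_eqF// expr1n mul1r.
    apply: ler_pM => //; rewrite ?exprn_ge0 ?mulr_ge0 ?exprn_ge0 ?invr_ge0 ?(ltW (be0 j))//.
    rewrite lerXn2r ?nnegrE ?invr_ge0 ?(ltW (be0 j))//.
    by rewrite mulr_ge0// powR_ge0.
  rewrite -mulr_sumr ler_wpM2l ?powR_ge0//.
  apply: le_trans (holder_sum al0 ga0 alga La0 om0) _.
  rewrite -[leRHS]mulr1; apply: ler_pM; rewrite ?powR_ge0//.
    by apply: le_powR_base; rewrite ?sumr_ge0.
  by rewrite -[leRHS](one_powR ga); apply: le_powR_base; rewrite ?sumr_ge0.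
pose e := 2^-1 - s^-1; have e0 : 0 <= e by rewrite subr_ge0 lef_pV2 ?posrE.
have gE : g = r^-1 + e * m%:R by rewrite rE /e; ring.
have ggt0 : 0 < g by rewrite gE ltr_pwDl ?invr_gt0// mulr_ge0.
pose A' := A * (K `^ s^-1) ^+ m.
have A'0 : 0 <= A' by rewrite mulr_ge0// exprn_ge0// powR_ge0.
exists (A' `^ r) => [|J X a V aK V0 hV]; first exact: powR_ge0.
set M := \sum_j _.
have [M0|Mneq0] := eqVneq M 0; first by rewrite M0 powR_ge0.
have Mge0 : 0 <= M by apply: sumr_ge0 => j _; exact: powR_ge0.
have Mgt0 : 0 < M by rewrite lt0r Mneq0.
pose D j := V j `^ r / M.
have D0 j : 0 <= D j by rewrite divr_ge0 ?powR_ge0.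
have D1 : \sum_j D j <= 1 by rewrite -mulr_suml divff.
pose be j := D j `^ e / K `^ s^-1.
have be0 j : 0 <= be j by rewrite divr_ge0 ?powR_ge0.
have [|om [om0 om1 omV]] := hV be be0.
  by move=> k; apply: multiplied_hilbert_summable.
have key j : V j `^ r <= (A' * M `^ (e * m%:R)) `^ g^-1 * om j.
  have [Vj0|Vj0] := eqVneq (V j) 0.
    by rewrite Vj0 powR0 ?gt_eqF// mulr_ge0 ?powR_ge0.
  have Vgt0 : 0 < V j by rewrite lt0r Vj0 V0.
  have -> : V j `^ r = ((V j `^ r) `^ g) `^ g^-1 by rewrite -powRrM divff ?gt_eqF// powRr1 ?powR_ge0.
  have -> : om j = (om j `^ g) `^ g^-1 by rewrite -powRrM divff ?gt_eqF// powRr1.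
  rewrite -powRM ?mulr_ge0 ?exprn_ge0 ?powR_ge0//.
  apply: le_powR_base; rewrite ?invr_ge0 ?(ltW ggt0) ?powR_ge0//.
  have -> : (V j `^ r) `^ g = (K `^ s^-1) ^+ m * M `^ (e * m%:R) * (be j ^+ m * V j).
    have kn0 : (K `^ s^-1) ^+ m != 0 by rewrite expf_neq0// gt_eqF// powR_gt0.
    have mn0 : M `^ (e * m%:R) != 0 by rewrite gt_eqF// powR_gt0.
    have -> : be j ^+ m = (V j `^ r) `^ (e * m%:R) / M `^ (e * m%:R) / (K `^ s^-1) ^+ m.
      rewrite expr_div_n -(powR_mulrn m (powR_ge0 (D j) e)) -powRrM /D.
      rewrite powRM ?powR_ge0 ?invr_ge0//; congr (_ * _ * _).
      by rewrite -powR_inv1// -powRrM mulN1r powRN.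
    have -> : (V j `^ r) `^ g = (V j `^ r) `^ (e * m%:R) * V j.
      rewrite gE addrC powRD; last by apply/implyP => _; rewrite gt_eqF// powR_gt0.
      by rewrite -[(_ `^ r) `^ r^-1]powRrM divff ?gt_eqF// powRr1// ltW.
    move: kn0 mn0; move: ((V j `^ r) `^ (e * m%:R)) (M `^ (e * m%:R)).
    by move: ((K `^ s^-1) ^+ m) => p q q' ? ?; field; apply/andP.
  apply: le_trans (ler_wpM2l _ (omV j)) _; first by rewrite mulr_ge0 ?exprn_ge0 ?powR_ge0.
  apply: le_of_eq; rewrite /A'; ring.
have hM : M <= (A' * M `^ (e * m%:R)) `^ g^-1.
  apply: le_trans (ler_sum _ (fun j _ => key j)) _.
  by rewrite -mulr_sumr ler_piMr ?powR_ge0.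
have {}hM : M `^ g <= A' * M `^ (e * m%:R).
  have := le_powR_base (ltW ggt0) Mge0 hM; rewrite -[leRHS]powRrM mulVf ?gt_eqF//.
  by rewrite powRr1// mulr_ge0 ?powR_ge0.
have {}hM : M `^ r^-1 <= A'.
  rewrite -(ler_pM2r (_ : 0 < M `^ (e * m%:R))) ?powR_gt0// -powRD -?gE//.
  by apply/implyP => _; rewrite gt_eqF.
have := le_powR_base (ltW r0) (powR_ge0 _ _) hM.
by rewrite -powRrM mulVf ?gt_eqF// powRr1.
Qed.

End weights.

(** * Forms on Hilbert summable families *)

Section estimates_on_arrays.
Context (R : realType) (X : finType).
Local Notation C := R[i].

Lemma mformD (A : comNzRingType) (b b' : seq X -> A) phis :
  mform (fun s => b s + b' s) phis = mform b phis + mform b' phis.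
Proof.
elim: phis b b' => // phi phis IH b b'; rewrite !mform_cons -big_split/=.
by apply: eq_bigr => x _; rewrite IH mulrDr.
Qed.

Lemma eq_mform (A : comNzRingType) (b b' : seq X -> A) phis :
  (forall s, size s = size phis -> b s = b' s) -> mform b phis = mform b' phis.
Proof.
elim: phis b b' => [|phi phis IH] b b' bb'; first exact: bb'.
rewrite !mform_cons; apply: eq_bigr => x _; congr (_ * _).
by apply: IH => s sz; apply: bb'; rewrite /= sz.
Qed.

Definition nonneg_fun (phi : X -> R) := forall x, 0 <= phi x.

Lemma mform_ge0 (B : seq X -> R) phis : (forall s, 0 <= B s) -> allp nonneg_fun phis ->
  0 <= mform B phis.
Proof.
elim: phis B => [|phi phis IH] B B0; first by move=> _; exact: B0.
move=> [phi0 phis0]; rewrite mform_cons; apply: sumr_ge0 => x _.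
by rewrite mulr_ge0// IH.
Qed.

Lemma mform_le (B : seq X -> R) phis A : 0 <= A ->
  (forall s, size s = size phis -> B s <= A) ->
  allp nonneg_fun phis -> allp (fun phi => \sum_x phi x <= 1) phis ->
  mform B phis <= A.
Proof.
move=> A0; elim: phis B => [|phi phis IH] B BA; first by move=> _ _; exact: BA.
move=> [phi0 phis0] [phi1 phis1]; rewrite mform_cons.
apply: (@le_trans _ _ (\sum_x phi x * A)); last by rewrite -mulr_suml ler_piMl.
apply: ler_sum => x _; rewrite ler_wpM2l// IH// => s sz.
by rewrite BA//= sz.
Qed.

Lemma normc_mform_le (b : seq X -> C) (B : seq X -> R) phis (kap : R) :
  (forall s, normc (b s) <= kap * B s) ->
  normc (mform b phis) <= kap * mform B (map (fun phi x => normc (phi x)) phis).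
Proof.
elim: phis b B => [|phi phis IH] b B bB; first exact: bB.
rewrite [map _ _]/= !mform_cons; apply: le_trans (ler_normc_sum _ _ _) _.
rewrite mulr_sumr; apply: ler_sum => x _; rewrite normcM mulrCA.
by rewrite ler_wpM2l ?normc_ge0// IH.
Qed.

Definition l1_unit (phi : X -> C) := \sum_x normc (phi x) <= 1.

Lemma allp_l1_unit phis : allp l1_unit phis ->
  allp nonneg_fun (map (fun phi x => normc (phi x)) phis) /\
  allp (fun phi => \sum_x phi x <= 1) (map (fun phi x => normc (phi x)) phis).
Proof.
move=> h; split; apply/allp_map; last exact: h.
by apply: sub_allp h => phi _ x; exact: normc_ge0.
Qed.

Lemma normc_mform_le_l1 (b : seq X -> C) phis A : 0 <= A ->
  (forall s, size s = size phis -> normc (b s) <= A) -> allp l1_unit phis ->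
  normc (mform b phis) <= A.
Proof.
move=> A0 bA /allp_l1_unit[h0 h1].
have h s : normc (b s) <= 1 * normc (b s) by rewrite mul1r.
have := normc_mform_le phis h; rewrite mul1r => /le_trans; apply.
by apply: mform_le => //; rewrite size_map.
Qed.

Definition low_part (tau : R) (b : seq X -> C) s := if normc (b s) <= tau then b s else 0.
Definition high_part (tau : R) (b : seq X -> C) s := if normc (b s) <= tau then 0 else b s.

Lemma mform_low_high tau b phis :
  mform b phis = mform (low_part tau b) phis + mform (high_part tau b) phis.
Proof.
rewrite -mformD; apply: eq_mform => s _; rewrite /low_part /high_part.
by case: ifP; rewrite ?addr0 ?add0r.
Qed.

End estimates_on_arrays.

Section hilbert_valued.
Context (R : realType) (X J : finType).
Local Notation C := R[i].

(** For one slot this is the definition of summability.  For more slots, freezing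
    the first one leaves a family indexed by pairs (j', l) whose Hilbert norm is
    at most 1 by induction; applying summability of the first family to it bounds
    even the sum over all pairs (j, j'), of which the diagonal is kept. *)
Lemma hilbert_multilinear (L : finType) (th : L -> seq X -> C) (ys : seq (J -> X -> C)) :
  (0 < size ys)%N -> allp (hilbert_summable 1 1) ys ->
  (forall s, size s = size ys -> \sum_l normc (th l s) ^+ 2 <= 1) ->
  \sum_j \sum_l normc (mform (th l) (map (fun y => y j) ys)) ^+ 2 <= 1.
Proof.
have sum1 (L' : finType) (y : J -> X -> C) (psi : L' -> X -> C) :
    hilbert_summable 1 1 y -> (forall x, \sum_l normc (psi l x) ^+ 2 <= 1) ->
    \sum_j \sum_l normc (\sum_x y j x * psi l x) ^+ 2 <= 1.
  move=> yh psi1; apply: le_trans (yh _ _ psi1); apply: ler_sum => j _.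
  rewrite powRr1; last by apply: sumr_ge0 => l _; exact: sqr_ge0.
  by apply: ler_sum => l _; under eq_bigr do rewrite mulrC.
elim: ys L th => // y [|y' ys] IH L th _.
  move=> [yh _] th1; apply: le_trans (sum1 _ y (fun l x => th l [:: x]) yh _).
    by apply: ler_sum => j _; apply: ler_sum => l _; rewrite mform_cons.
  by move=> x; apply: th1.
move=> [yh ysh] th1.
pose psi (p : J * L) x := mform (fun s => th p.2 (x :: s)) (map (fun y => y p.1) (y' :: ys)).
have psi1 x : \sum_p normc (psi p x) ^+ 2 <= 1.
  rewrite -(pair_bigA _ (fun j l => normc (psi (j, l) x) ^+ 2))/=.
  apply: (IH L (fun l s => th l (x :: s))) => // s sz.
  by apply: th1; rewrite /= sz.
apply: le_trans (sum1 _ y psi yh psi1); apply: ler_sum => j _.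
rewrite -(pair_bigA _ (fun j' l => normc (\sum_x y j x * psi (j', l) x) ^+ 2))/=.
rewrite [leRHS](bigD1 j)//= -[leLHS]addr0 lerD//.
  by apply: ler_sum => l _; rewrite [mform _ _]mform_cons.
by apply: sumr_ge0 => j' _; apply: sumr_ge0 => l _; exact: sqr_ge0.
Qed.

(** Tested on the scalar functional with values the signs of y_j. *)
Lemma hilbert_l1_unit (y : J -> X -> C) j : hilbert_summable 1 1 y -> l1_unit (y j).
Proof.
move=> yh; pose psi (_ : unit) x : C := ((normc (y j x))^-1)%:C * (y j x)^*.
have psiy x : psi tt x * y j x = (normc (y j x))%:C.
  rewrite /psi -mulrA normc_conj_mul -rmorphM; congr (_%:C).
  by have [->|n0] := eqVneq (normc (y j x)) 0; rewrite ?invr0 ?mul0r// expr2 mulKf.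
have psi1 x : \sum_l normc (psi l x) ^+ 2 <= 1.
  rewrite (big_pred1 tt); last by case.
  rewrite sqr_normc_scale normc_conj -exprMn.
  by have [->|n0] := eqVneq (normc (y j x)) 0; rewrite ?mulr0 ?expr0n// mulVf// expr1n.
have := yh _ psi psi1; rewrite (bigD1 j)//= (big_pred1 tt); last by case.
under eq_bigr => x _ do rewrite psiy.
rewrite -rmorph_sum normc_real ger0_norm; last by apply: sumr_ge0 => x _; exact: normc_ge0.
rewrite powRr1 ?sqr_ge0// => h; rewrite /l1_unit.
set t := \sum_x _ in h *; have t0 : 0 <= t by apply: sumr_ge0 => x _; exact: normc_ge0.
have : t ^+ 2 <= 1 by apply: le_trans h; rewrite lerDl sumr_ge0// => i _; exact: powR_ge0.
by rewrite -[X in _ <= X -> _](expr1n _ 2) ler_sqr ?nnegrE.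
Qed.

End hilbert_valued.

Section restricted_geometric_sums.
Context (R : realType).

(** A sum over any set of exponents is comparable with its largest term. *)
Lemma decreasing_geometric_le (q T : R) (P : pred nat) N : 0 < q < 1 -> 0 <= T ->
  (forall k, P k -> q ^+ k <= T) -> \sum_(k < N | P k) q ^+ k <= T / (1 - q).
Proof.
move=> /andP[q0 q1]; have h : 0 < 1 - q by rewrite subr_gt0.
elim: N P T => [|N IH] P T T0 PT; first by rewrite big_ord0 divr_ge0// ltW.
have [P0|nP0] := boolP (P 0%N).
  apply: (@le_trans _ _ (\sum_(k < N.+1) q ^+ k)).
    rewrite big_mkcond/=; apply: ler_sum => k _; case: ifP => // _.
    by rewrite exprn_ge0// ltW.
  apply: le_trans (geometric_le _ _) _; first by rewrite ltW.
  by rewrite -[leLHS]mul1r ler_pM2r ?invr_gt0//; have := PT _ P0; rewrite expr0.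
rewrite big_mkcond big_ord_recl/= (negPf nP0) add0r -big_mkcond/=.
under eq_bigr => k _ do rewrite /bump/= exprS.
rewrite -mulr_sumr mulrC -ler_pdivlMr// mulrAC.
apply: (IH (fun k => P k.+1)); first by rewrite divr_ge0// ltW.
by move=> k /PT; rewrite exprS ler_pdivlMr// mulrC.
Qed.

Lemma increasing_geometric_le (q T : R) (P : pred nat) N : 1 < q -> 0 <= T ->
  (forall k, P k -> q ^+ k <= T) -> \sum_(k < N | P k) q ^+ k <= T * (q / (q - 1)).
Proof.
move=> q1 T0 PT; have h : 0 < q - 1 by rewrite subr_gt0.
have q0 : 0 < q by exact: lt_trans q1.
elim: N => [|N IH]; first by rewrite big_ord0 mulr_ge0// divr_ge0// ltW.
have [PN|nPN] := boolP (P N); last first.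
  rewrite big_mkcond big_ord_recr/= (negPf nPN) addr0 -big_mkcond/=; exact: IH.
apply: (@le_trans _ _ (\sum_(k < N.+1) q ^+ k)).
  rewrite big_mkcond/=; apply: ler_sum => k _; case: ifP => // _.
  by rewrite exprn_ge0// ltW.
apply: (@le_trans _ _ (q ^+ N * (q / (q - 1)))); last first.
  by rewrite ler_wpM2r ?PT// divr_ge0// ltW.
rewrite mulrA ler_pdivlMr// mulrC -subrX1 -exprSr lerBlDr lerDl//.
Qed.

End restricted_geometric_sums.

(** * Forms with values in l_p *)

Section lp_valued.
Context (R : realType).
Local Notation C := R[i].

Lemma two_powR_ltP (x y : R) : (2 `^ x < 2 `^ y) = (x < y).
Proof. by rewrite /powR pnatr_eq0/= ltr_expR ltr_pM2r// ln_gt0// ltr1n. Qed.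

Lemma powR_invl (x r : R) : 0 <= x -> x^-1 `^ r = (x `^ r)^-1.
Proof. by move=> x0; rewrite -powR_inv1// -powRrM mulN1r powRN. Qed.

Lemma sqr_powRB (t p : R) : 0 < t -> t ^+ 2 * t `^ (p - 2) = t `^ p.
Proof.
move=> t0; rewrite -powR_mulrn ?(ltW t0)// -powRD ?subrKC//.
by apply/implyP => _; rewrite gt_eqF.
Qed.

Section fixed_data.
Context (X J L : finType) (th : L -> seq X -> C) (ys : seq (J -> X -> C)) (p : R).
Hypothesis ys0 : (0 < size ys)%N.
Hypothesis ysh : allp (hilbert_summable 1 1) ys.
Hypothesis th1 : forall s, size s = size ys -> \sum_l normc (th l s) `^ p <= 1.

Let c j l := mform (th l) (map (fun y => y j) ys).
Let yl1 j : allp (@l1_unit R X) (map (fun y => y j) ys).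
Proof. by apply/allp_map; apply: sub_allp ysh => y yh; exact: hilbert_l1_unit. Qed.

Lemma normc_coef_le1 l s : 0 < p -> size s = size ys -> normc (th l s) <= 1.
Proof.
move=> p0 sz; rewrite leNgt; apply/negP => h.
have := th1 sz; rewrite leNgt => /negP; apply.
apply: (@lt_le_trans _ _ (normc (th l s) `^ p)).
  rewrite -[ltLHS](one_powR p); apply: gt0_ltr_powR; rewrite ?nnegrE ?normc_ge0//.
rewrite (bigD1 l)//= lerDl; apply: sumr_ge0 => i _; exact: powR_ge0.
Qed.

Lemma normc_value_le1 j l : 0 < p -> normc (c j l) <= 1.
Proof.
move=> p0; apply: normc_mform_le_l1 => // s; rewrite size_map => sz.
exact: normc_coef_le1.
Qed.

(** All dyadic levels k of the coefficients at once, as one Hilbert-valued form. *)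
Definition weighted_part (wt : nat -> R) (part : nat -> (seq X -> C) -> seq X -> C) K
  (kl : 'I_K * L) s : C := (Num.sqrt (wt kl.1))%:C * part kl.1 (th kl.2) s.

Lemma weighted_part_sum (wt : nat -> R) (part : nat -> (seq X -> C) -> seq X -> C) K :
  (forall k, 0 <= wt k) ->
  (forall s, size s = size ys ->
    \sum_l \sum_(k < K) wt k * normc (part k (th l) s) ^+ 2 <= 1) ->
  \sum_j \sum_l \sum_(k < K) wt k *
    normc (mform (part k (th l)) (map (fun y => y j) ys)) ^+ 2 <= 1.
Proof.
move=> wt0 part1.
have sumE (F : 'I_K -> L -> R) : \sum_(kl : 'I_K * L) F kl.1 kl.2 = \sum_l \sum_k F k l.
  by rewrite exchange_big (pair_bigA _ (fun k l => F k l)).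
have h := @hilbert_multilinear R X J _ (@weighted_part wt part K) ys ys0 ysh.
apply: le_trans (h _) => [|s sz].
  apply: ler_sum => j _; rewrite -sumE; apply: le_of_eq.
  apply: eq_bigr => -[k l] _ /=.
  by rewrite /weighted_part/= mformZ sqr_normc_scale sqr_sqrtr.
apply: le_trans (part1 s sz); rewrite -sumE; apply: le_of_eq.
by apply: eq_bigr => -[k l] _ /=; rewrite /weighted_part sqr_normc_scale sqr_sqrtr.
Qed.

Lemma exists_level_bound (t : J -> L -> R) : exists K, forall j l,
  1 <= t j l -> (level (t j l) < K)%N.
Proof.
have [h hP] := exists_scale (fun jl : J * L => (t jl.1 jl.2)^-1).
exists h.+1 => j l t1; have t0 : 0 < t j l by exact: lt_le_trans t1.
have /andP[h1 _] := levelP t1.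
have := hP (j, l); rewrite /= invr_gt0 => /(_ t0).
rewrite ler_pdivlMl// mulr1 => h2; have := le_trans h1 h2.
by rewrite ler_eXn2l ?ltr1n.
Qed.

(** The parts of th with coefficients above 2^(-k-2), weighted by 2^(-k(p-2)/2),
    form together a Hilbert-valued array of norm comparable with the l_p norm of
    the coefficients.  At the level k of a value c, the small coefficients
    contribute at most 2^(-k-2) <= |c| / 2 because the y_j are in the unit ball of
    l_1, so the large ones carry half of c. *)
Lemma sum_value_powR_gt2 : 2 < p ->
  \sum_j \sum_l normc (c j l) `^ p <= 4 * (4 `^ (p - 2) / (1 - 2 `^ (2 - p))).
Proof.
move=> p2; have p0 : 0 < p by exact: lt_trans p2.
pose q : R := 2 `^ (2 - p).
have q01 : 0 < q < 1.
  rewrite powR_gt0//= -(powRr0 2) two_powR_ltP; lra.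
have /andP[q0 q1] := q01.
have qE k : q ^+ k = ((2 ^+ k)^-1) `^ (p - 2).
  rewrite -[in LHS]powR_mulrn ?powR_ge0// -powRrM -powR_inv1 ?exprn_ge0//.
  by rewrite -powR_mulrn// -!powRrM; congr (2 `^ _); ring.
pose A := 4 `^ (p - 2) / (1 - q).
have A0 : 0 < A by rewrite divr_gt0 ?powR_gt0 ?subr_gt0.
have cA : 0 <= 4 * A by apply: mulr_ge0 => //; exact: ltW.
have [K hK] := exists_level_bound (fun j l => (normc (c j l))^-1).
pose tau k : R := (2 ^+ k.+2)^-1.
have tau0 k : 0 <= tau k by rewrite invr_ge0 exprn_ge0.
have := @weighted_part_sum (fun k => q ^+ k / A) (fun k => @high_part R X (tau k)) K _ _.
have wt0 k : 0 <= q ^+ k / A by rewrite divr_ge0 ?exprn_ge0 ?ltW.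
move=> /(_ wt0) main.
have {}main : \sum_j \sum_l \sum_(k < K) q ^+ k / A * normc (mform (high_part (tau k) (th l))
    (map (fun y => y j) ys)) ^+ 2 <= 1.
  apply: main => s sz; apply: le_trans (th1 sz); apply: ler_sum => l _.
  set t := normc (th l s).
  have t0 : 0 <= t by exact: normc_ge0.
  rewrite (_ : \sum_k _ = t ^+ 2 / A * \sum_(k < K | tau k < t) q ^+ k); last first.
    rewrite [in RHS]big_mkcond mulr_sumr; apply: eq_bigr => k _.
    by rewrite /high_part -/t; case: (ltP (tau k) t) => _; rewrite ?normc0 -?/t; ring.
  have [t_eq0|t_neq0] := eqVneq t 0; first by rewrite t_eq0 expr0n/= !mul0r powR_ge0.
  have tgt0 : 0 < t by rewrite lt0r t_neq0.
  have hg : \sum_(k < K | tau k < t) q ^+ k <= (4 * t) `^ (p - 2) / (1 - q).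
    apply: (@decreasing_geometric_le R q _ (fun k => tau k < t)) => //.
      exact: powR_ge0.
    move=> k hk.
    rewrite qE; apply: le_powR_base; rewrite ?invr_ge0 ?exprn_ge0 ?subr_ge0 ?(ltW p2)//.
    have := ltW hk; rewrite /tau !exprS !invfM; lra.
  apply: le_trans (ler_wpM2l _ hg) _; first by rewrite divr_ge0 ?sqr_ge0 ?ltW.
  rewrite -(sqr_powRB p tgt0) powRM// /A; apply: le_of_eq; field.
  by rewrite !gt_eqF ?powR_gt0 ?subr_gt0.
rewrite -[leRHS]mulr1 -/A.
apply: le_trans (ler_wpM2l cA main).
rewrite mulr_sumr; apply: ler_sum => j _; rewrite mulr_sumr; apply: ler_sum => l _.
have [c0|c_neq0] := eqVneq (normc (c j l)) 0.
  rewrite c0 powR0 ?gt_eqF//; apply: mulr_ge0 => //; apply: sumr_ge0 => k _.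
  by apply: mulr_ge0; rewrite ?sqr_ge0.
have cgt0 : 0 < normc (c j l) by rewrite lt0r c_neq0 normc_ge0.
have c1 : 1 <= (normc (c j l))^-1 by rewrite invf_ge1// normc_value_le1.
have /andP[k1 k2] := levelP c1; pose k := Ordinal (hK j l c1).
rewrite (bigD1 k)//= mulrDr -[leLHS]addr0 lerD//; last first.
  apply: mulr_ge0 => //; apply: sumr_ge0 => k' _.
  by apply: mulr_ge0; rewrite ?sqr_ge0.
have c_le : normc (c j l) <= (2 ^+ k)^-1.
  by rewrite -[leLHS]invrK lef_pV2// posrE ?exprn_gt0 ?invr_gt0.
have c_gt : 2 * tau k <= normc (c j l).
  rewrite /tau exprS invfM mulrA divff ?pnatr_eq0// mul1r -[leRHS]invrK.
  by rewrite lef_pV2 ?posrE ?exprn_gt0 ?invr_gt0// ltW.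
have low_le : normc (mform (low_part (tau k) (th l)) (map (fun y => y j) ys)) <= tau k.
  apply: normc_mform_le_l1 => // s _; rewrite /low_part.
  by case: ifP => // _; rewrite normc0.
have split_le : normc (c j l) <=
    normc (mform (low_part (tau k) (th l)) (map (fun y => y j) ys)) +
    normc (mform (high_part (tau k) (th l)) (map (fun y => y j) ys)).
  by rewrite /c (mform_low_high (tau k)); exact: le_normcD.
set hi := normc (mform (high_part _ _) _) in split_le *.
have hi_ge : normc (c j l) <= 2 * hi by lra.
have hi0 : 0 <= hi by exact: normc_ge0.
rewrite -(sqr_powRB p cgt0).
apply: (@le_trans _ _ ((2 * hi) ^+ 2 * q ^+ k)).
  apply: ler_pM; rewrite ?sqr_ge0 ?powR_ge0//.
    by rewrite ler_sqr ?nnegrE ?normc_ge0 ?mulr_ge0.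
  by rewrite qE; apply: le_powR_base; rewrite ?normc_ge0 ?subr_ge0 ?(ltW p2).
apply: le_of_eq.
have A_neq0 : A != 0 by rewrite gt_eqF.
by move: (q ^+ k) => u; field.
Qed.

Lemma mform_normc_powR_sum j :
  \sum_l mform (fun s => normc (th l s) `^ p)
    (map (fun phi x => normc (phi x)) (map (fun y => y j) ys)) <= 1.
Proof.
have [h0 h1] := allp_l1_unit (yl1 j).
set phis := map _ _ in h0 h1 *.
have -> : \sum_l mform (fun s => normc (th l s) `^ p) phis =
    mform (fun s => \sum_l 1 * normc (th l s) `^ p) phis.
  by rewrite mform_sum; apply: eq_bigr => l _; rewrite mul1r.
apply: mform_le => // s; rewrite !size_map => sz.
by under eq_bigr do rewrite mul1r; exact: th1.
Qed.

(** Dually to the case p > 2, the parts of th with small coefficients are weighted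
    by 2^(k(2-p)/2), and V_j is the square of the Hilbert norm of the value at j.
    The large coefficients at level k contribute at most 2^(k(p-1)) U_jl, where
    U is the form of |th|^p, of sum at most 1 in l.  At the last level where this
    is below |c| / 2 the small ones carry half of c, whence
    |c|^p <= 16 U^(2-p) v^(p-1), and Hoelder's inequality in l ends the proof. *)
Lemma sum_value_powR_lt2 : 1 < p < 2 -> exists V : J -> R,
  [/\ forall j, 0 <= V j, \sum_j V j <= 2 `^ (2 - p) / (2 `^ (2 - p) - 1) &
      forall j, \sum_l normc (c j l) `^ p <= 16 * V j `^ (p - 1)].
Proof.
move=> /andP[p1 p2]; have p0 : 0 < p by exact: lt_trans p1.
pose q : R := 2 `^ (2 - p).
have q1 : 1 < q by rewrite -(powRr0 2) two_powR_ltP subr_gt0.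
have q0 : 0 < q by exact: lt_trans q1.
have qE k : q ^+ k = (2 ^+ k) `^ (2 - p).
  by rewrite -[in LHS]powR_mulrn ?powR_ge0// -powRrM mulrC powRrM powR_mulrn.
pose A := q / (q - 1).
have A0 : 0 < A by rewrite divr_gt0 ?subr_gt0.
pose ys' j := map (fun y : J -> X -> C => y j) ys.
pose U j l := mform (fun s => normc (th l s) `^ p)
  (map (fun phi x => normc (phi x)) (ys' j)).
have U0 j l : 0 <= U j l.
  apply: mform_ge0 => [s|]; first exact: powR_ge0.
  by have [] := allp_l1_unit (yl1 j).
have U1 j : \sum_l U j l <= 1 by exact: mform_normc_powR_sum.
pose y j l := (normc (c j l) / (2 * U j l)) `^ (p - 1)^-1.
have [K hK] := exists_level_bound y.
pose tau k : R := (2 ^+ k)^-1.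
have tau_gt0 k : 0 < tau k by rewrite invr_gt0 exprn_gt0.
pose low j l k : R := normc (mform (low_part (tau k) (th l)) (ys' j)).
pose v j l : R := \sum_(k < K.+1) q ^+ k * low j l k ^+ 2.
have v0 j l : 0 <= v j l.
  by apply: sumr_ge0 => k _; apply: mulr_ge0; rewrite ?sqr_ge0// exprn_ge0// ltW.
pose V j := \sum_l v j l.
exists V; split; first by move=> j; exact: sumr_ge0.
  rewrite -/q -/A.
  have wt0 k : 0 <= q ^+ k / A by rewrite divr_ge0 ?exprn_ge0 ?ltW.
  have := @weighted_part_sum (fun k => q ^+ k / A) (fun k => @low_part R X (tau k)) K.+1 wt0.
  move=> main; rewrite -[leRHS]mulr1.
  apply: le_trans (ler_wpM2l (ltW A0) (main _)).
    apply: le_of_eq.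
    rewrite mulr_sumr; apply: eq_bigr => j _; rewrite mulr_sumr; apply: eq_bigr => l _.
    rewrite mulr_sumr; apply: eq_bigr => k _; rewrite -/(ys' j) -/(low j l k).
    by rewrite [RHS]mulrA [A * _]mulrC divfK// gt_eqF.
  move=> s sz; apply: le_trans (th1 sz); apply: ler_sum => l _.
  set t := normc (th l s).
  have t0 : 0 <= t by exact: normc_ge0.
  rewrite (_ : \sum_k _ = t ^+ 2 / A * \sum_(k < K.+1 | t <= tau k) q ^+ k); last first.
    rewrite [in RHS]big_mkcond mulr_sumr; apply: eq_bigr => k _.
    by rewrite /low_part -/t; case: (leP t (tau k)) => _; rewrite ?normc0 -?/t; ring.
  have [t_eq0|t_neq0] := eqVneq t 0; first by rewrite t_eq0 expr0n/= !mul0r powR_ge0.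
  have tgt0 : 0 < t by rewrite lt0r t_neq0.
  have hg : \sum_(k < K.+1 | t <= tau k) q ^+ k <= t `^ (p - 2) * A.
    apply: (@increasing_geometric_le R q _ (fun k => t <= tau k)) => //.
      exact: powR_ge0.
    move=> k hk; rewrite qE -(opprB 2 p) powRN.
    rewrite -[leLHS]invrK lef_pV2 ?posrE ?invr_gt0 ?powR_gt0 ?exprn_gt0//.
    rewrite -powR_invl ?exprn_ge0//.
    by apply: le_powR_base; rewrite ?subr_ge0 ?(ltW p2).
  apply: le_trans (ler_wpM2l _ hg) _; first by rewrite divr_ge0 ?sqr_ge0 ?(ltW A0).
  rewrite -(sqr_powRB p tgt0); apply: le_of_eq.
  by rewrite -mulrA [A^-1 * _]mulrCA mulVf ?mulr1// gt_eqF.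
move=> j.
have key l : normc (c j l) `^ p <= 16 * (U j l `^ (2 - p) * v j l `^ (p - 1)).
  have rhs0 : 0 <= 16 * (U j l `^ (2 - p) * v j l `^ (p - 1)).
    by rewrite mulr_ge0 ?mulr_ge0 ?powR_ge0.
  have [c0|c_neq0] := eqVneq (normc (c j l)) 0.
    by rewrite c0 powR0 ?gt_eqF.
  have cgt0 : 0 < normc (c j l) by rewrite lt0r c_neq0 normc_ge0.
  have hsplit k : normc (c j l) <= low j l k + (2 ^+ k) `^ (p - 1) * U j l.
    rewrite /c -/(ys' j) (mform_low_high (tau k)); apply: le_trans (le_normcD _ _) _.
    rewrite lerD2l; apply: normc_mform_le => s; rewrite /high_part.
    case: (leP (normc (th l s)) (tau k)) => h; first by rewrite normc0 mulr_ge0 ?powR_ge0.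
    have t0 : 0 < normc (th l s) by exact: lt_trans h.
    rewrite -[leLHS]powRr1 ?normc_ge0// -[X in _ `^ X](subrK (p - 1)) [1 - _ + _]addrC.
    rewrite (_ : p - 1 + (1 - (p - 1)) = p + (1 - p)); last by ring.
    rewrite powRD; last by apply/implyP => _; rewrite gt_eqF.
    rewrite mulrC ler_wpM2r ?powR_ge0// -(opprB p 1) powRN.
    rewrite -[leRHS]invrK lef_pV2 ?posrE ?invr_gt0 ?powR_gt0 ?exprn_gt0//.
    rewrite -powR_invl ?exprn_ge0//.
    by apply: le_powR_base; rewrite ?subr_ge0 ?(ltW p1) ?(ltW (tau_gt0 k)) ?(ltW h).
  have low_le k : low j l k <= tau k.
    apply: (normc_mform_le_l1 (ltW (tau_gt0 k)) _ (yl1 j)) => s _.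
    by rewrite /low_part; case: ifP => // _; rewrite normc0 ltW.
  have low0 k : 0 <= low j l k by exact: normc_ge0.
  have vk k : (k < K.+1)%N -> q ^+ k * low j l k ^+ 2 <= v j l.
    move=> kK; rewrite /v (bigD1 (Ordinal kK))//= lerDl; apply: sumr_ge0 => k' _.
    by apply: mulr_ge0; rewrite ?sqr_ge0// exprn_ge0// ltW.
  (* If U vanished, c would be at most tau k = 2^-k for every k. *)
  have Ugt0 : 0 < U j l.
    rewrite lt0r U0 andbT; apply/eqP => Ueq0.
    have [h hP] := exists_scale (fun _ : unit => normc (c j l) / 2).
    have /(_ tt) := hP; rewrite divr_gt0// => /(_ isT).
    have := hsplit h; rewrite Ueq0 mulr0 addr0 => h1.
    have := le_trans h1 (low_le h); rewrite /tau -[X in _ <= X -> _]mul1r.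
    rewrite ler_pdivlMr ?exprn_gt0// [normc _ / 2 * _]mulrAC ler_pdivlMr// mul1r => h2 h3.
    by have := le_trans h3 h2; rewrite lern1.
  (* The real parameter w is comparable with 2^k at the level k that is used. *)
  have final (w : R) : 0 <= w -> w `^ (2 - p) * normc (c j l) ^+ 2 <= 8 * v j l ->
      (normc (c j l) <= 2 * U j l * w `^ (p - 1)) ->
      normc (c j l) `^ p <= 16 * (U j l `^ (2 - p) * v j l `^ (p - 1)).
    move=> w0 wv wU.
    have h1 : (w `^ (2 - p) * normc (c j l) ^+ 2) `^ (p - 1) <= (8 * v j l) `^ (p - 1).
      by apply: le_powR_base; [rewrite subr_ge0 ltW | apply: mulr_ge0; [exact: powR_ge0 | exact: sqr_ge0] | exact: wv].
    have h2 : normc (c j l) `^ (2 - p) <= (2 * U j l * w `^ (p - 1)) `^ (2 - p).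
      by apply: le_powR_base; rewrite ?subr_ge0 ?(ltW p2) ?normc_ge0.
    have e1 : 8 `^ (p - 1) * 2 `^ (2 - p) <= 16 :> R.
      rewrite (_ : 16 = 8 `^ 1 * 2 `^ 1 :> R); last by rewrite !powRr1//; ring.
      by apply: ler_pM; rewrite ?powR_ge0//; apply: ler_powR; lra.
    have wgt0 : 0 < w `^ (p - 1).
      rewrite lt0r powR_ge0 andbT; apply/eqP => weq0; move: wU; rewrite weq0 mulr0.
      by rewrite leNgt cgt0.
    have wwgt0 : 0 < w `^ ((p - 1) * (2 - p)) by rewrite powRrM powR_gt0.
    rewrite -(ler_pM2r wwgt0).
    apply: (@le_trans _ _ ((8 * v j l) `^ (p - 1) * (2 * U j l * w `^ (p - 1)) `^ (2 - p))).
      apply: le_trans (ler_pM _ _ h1 h2); rewrite ?powR_ge0//.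
      have cE : normc (c j l) `^ p = (normc (c j l) ^+ 2) `^ (p - 1) * normc (c j l) `^ (2 - p).
        rewrite -powR_mulrn ?normc_ge0// -powRrM -powRD; last by apply/implyP => _; rewrite gt_eqF.
        by congr (_ `^ _); ring.
      have wE : w `^ ((p - 1) * (2 - p)) = (w `^ (2 - p)) `^ (p - 1) by rewrite -powRrM mulrC.
      rewrite cE wE [in leRHS]powRM ?powR_ge0 ?sqr_ge0//.
      by apply: le_of_eq; ring.
    rewrite !powRM ?mulr_ge0 ?powR_ge0 ?(ltW Ugt0)// -(powRrM w).
    rewrite [leLHS](_ : _ = 8 `^ (p - 1) * 2 `^ (2 - p) * (U j l `^ (2 - p) * v j l `^ (p - 1)
       * w `^ ((p - 1) * (2 - p)))); last by ring.
    by rewrite -[leRHS]mulrA ler_wpM2r// mulr_ge0 ?mulr_ge0 ?powR_ge0.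
  have [cU|cU] := leP (normc (c j l)) (2 * U j l).
    apply: (final 1) => //; rewrite one_powR ?mulr1 ?mul1r//.
    have low_c : low j l 0 = normc (c j l).
      rewrite /low /c /ys'; congr normc; apply: eq_mform => s; rewrite size_map => sz.
      by rewrite /low_part /tau expr0 invr1 normc_coef_le1.
    have := vk 0%N isT; rewrite expr0 mul1r low_c; have := v0 j l; lra.
  pose X0 := normc (c j l) / (2 * U j l).
  have U20 : 0 < 2 * U j l by rewrite mulr_gt0.
  have X01 : 1 < X0 by rewrite ltr_pdivlMr// mul1r.
  have X00 : 0 < X0 by exact: lt_trans X01.
  have y1 : 1 <= y j l.
    rewrite -(one_powR (p - 1)^-1); apply: le_powR_base => //; last exact: ltW.
    by rewrite invr_ge0 subr_ge0 ltW.
  have yE : y j l `^ (p - 1) = X0.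
    by rewrite -powRrM mulVf ?powRr1 ?(ltW X00)// gt_eqF// subr_gt0.
  have [k [k1 k2 kK]] : exists k, [/\ 2 ^+ k <= y j l, y j l < 2 ^+ k.+1 & (k < K.+1)%N].
    by have /andP[] := levelP y1; exists (level (y j l)); split; rewrite // ltnW// ltnS hK.
  have y0 : 0 <= y j l by exact: powR_ge0.
  apply: (final (y j l)) => //; last first.
    by rewrite yE /X0 mulrC divfK// gt_eqF.
  have hi_le : (2 ^+ k) `^ (p - 1) * U j l <= normc (c j l) / 2.
    apply: (@le_trans _ _ (X0 * U j l)).
      rewrite ler_wpM2r// -yE; apply: le_powR_base; rewrite ?exprn_ge0 ?subr_ge0 ?(ltW p1)//.
    by rewrite /X0; apply: le_of_eq; field; rewrite gt_eqF.
  have half (x z : R) : x <= z + x / 2 -> x <= 2 * z by lra.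
  have low_ge : normc (c j l) <= 2 * low j l k.
    by apply: half; apply: le_trans (hsplit k) _; rewrite lerD2l.
  have q_ge : y j l `^ (2 - p) <= 2 * q ^+ k.
    rewrite qE; apply: (@le_trans _ _ ((2 * 2 ^+ k) `^ (2 - p))).
      by apply: le_powR_base; rewrite ?subr_ge0 ?(ltW p2)// -exprS ltW.
    rewrite powRM ?exprn_ge0// ler_wpM2r ?powR_ge0// -[leRHS]powRr1//.
    by apply: ler_powR; lra.
  have := vk k kK.
  have : y j l `^ (2 - p) * normc (c j l) ^+ 2 <= 2 * q ^+ k * (2 * low j l k) ^+ 2.
    apply: ler_pM; rewrite ?powR_ge0 ?sqr_ge0//.
    by rewrite ler_sqr ?nnegrE ?normc_ge0 ?mulr_ge0.
  move=> h1 h2; apply: le_trans h1 _.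
  rewrite exprMn (_ : 2 * q ^+ k * (2 ^+ 2 * low j l k ^+ 2) = 8 * (q ^+ k * low j l k ^+ 2)).
    by rewrite ler_wpM2l.
  by move: (q ^+ k) (low j l k) => ? ?; ring.
apply: le_trans (ler_sum _ (fun l _ => key l)) _; rewrite -mulr_sumr ler_wpM2l//.
have e0 : 0 <= 2 - p by lra.
have e1 : 0 <= p - 1 by lra.
have e2 : 2 - p + (p - 1) = 1 by ring.
apply: le_trans (holder_sum e0 e1 e2 (U0 j) (v0 j)) _.
rewrite -[leRHS]mul1r ler_wpM2r ?powR_ge0//.
by rewrite -[leRHS](one_powR (2 - p)); apply: le_powR_base; rewrite ?sumr_ge0.
Qed.

End fixed_data.

(** For 1 < p the inverse of the larger one of p and its conjugate exponent. *)
Definition lp_gain (p : R) := if p <= 2 then 1 - p^-1 else p^-1.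

Lemma lp_multilinear (p : R) : 1 < p -> exists2 B : R, 0 <= B &
  forall (X J L : finType) (th : L -> seq X -> C) (ys : seq (J -> X -> C)),
    (0 < size ys)%N -> allp (hilbert_summable 1 1) ys ->
    (forall s, size s = size ys -> \sum_l normc (th l s) `^ p <= 1) ->
    exists om : J -> R, [/\ forall j, 0 <= om j, \sum_j om j <= 1 &
      forall j, (\sum_l normc (mform (th l) (map (fun y => y j) ys)) `^ p) `^ p^-1
        <= B * om j `^ lp_gain p].
Proof.
move=> p1; have p0 : 0 < p by exact: lt_trans p1.
have scaled (J : finType) (W N : J -> R) (B g : R) : 0 < B -> (forall j, 0 <= N j) ->
    \sum_j N j <= B -> (forall j, W j <= 16 `^ p^-1 * N j `^ g) ->
    exists om : J -> R, [/\ forall j, 0 <= om j, \sum_j om j <= 1 &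
      forall j, W j <= 16 `^ p^-1 * B `^ g * om j `^ g].
  move=> B0 N0 NB WN; exists (fun j => N j / B); split=> [j||j].
  - by rewrite divr_ge0// ltW.
  - by rewrite -mulr_suml ler_pdivrMr// mul1r.
  - rewrite -mulrA -powRM ?divr_ge0 ?(ltW B0)//.
    by rewrite [B * _]mulrC divfK ?gt_eqF//; exact: WN.
rewrite /lp_gain; have [p_lt2|p_gt2|p_eq2] := ltgtP p 2.
- exists (16 `^ p^-1 * (2 `^ (2 - p) / (2 `^ (2 - p) - 1)) `^ (1 - p^-1)).
    by rewrite mulr_ge0 ?powR_ge0.
  move=> X J L th ys ys0 ysh th1.
  have [V [V0 V1 hV]] := sum_value_powR_lt2 ys0 ysh th1 (introT andP (conj p1 p_lt2)).
  apply: (scaled _ _ V) => // [|j].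
    rewrite divr_gt0 ?powR_gt0// subr_gt0 -[ltLHS](powRr0 2) two_powR_ltP; lra.
  apply: le_trans (le_powR_base _ _ (hV j)) _; rewrite ?invr_ge0 ?(ltW p0)//.
    by apply: sumr_ge0 => l _; exact: powR_ge0.
  rewrite powRM ?powR_ge0// -powRrM (_ : (p - 1) * p^-1 = 1 - p^-1)//.
  by field; rewrite gt_eqF.
- exists (16 `^ p^-1 * (4 * (4 `^ (p - 2) / (1 - 2 `^ (2 - p)))) `^ p^-1).
    by rewrite mulr_ge0 ?powR_ge0.
  move=> X J L th ys ys0 ysh th1.
  have hV := sum_value_powR_gt2 ys0 ysh th1 p_gt2.
  apply: scaled hV _ => [|j|j].
  + rewrite mulr_gt0// divr_gt0 ?powR_gt0// subr_gt0 -[ltRHS](powRr0 2) two_powR_ltP.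
    lra.
  + by apply: sumr_ge0 => l _; exact: powR_ge0.
  + rewrite ler_peMl ?powR_ge0// -[leLHS](powRr0 16); apply: ler_powR.
      by rewrite ler1n.
    by rewrite invr_ge0 ltW.
- exists (16 `^ p^-1 * 1 `^ (1 - p^-1)); first by rewrite mulr_ge0 ?powR_ge0.
  move=> X J L th ys ys0 ysh th1; rewrite p_eq2 in th1 *.
  have sqE (t : C) : normc t `^ 2 = normc t ^+ 2 by rewrite powR_mulrn ?normc_ge0.
  have hV := hilbert_multilinear ys0 ysh (th := th).
  rewrite -p_eq2; apply: scaled (hV _) _ => // [j|s /th1|j].
  + by apply: sumr_ge0 => l _; exact: sqr_ge0.
  + by under eq_bigr do rewrite sqE.
  + rewrite p_eq2; under eq_bigr do rewrite sqE.
    rewrite (_ : 1 - 2^-1 = 2^-1); last by field.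
    rewrite ler_peMl ?powR_ge0// -[leLHS](powRr0 16); apply: ler_powR.
      by rewrite ler1n.
    by rewrite invr_ge0.
Qed.

End lp_valued.

(** * The sequence spaces *)

Section sequence_norms.
Context (R : realType).
Implicit Types (a : nat -> R).

Lemma lnorm_partial_le (r : R) a (c : R) : 0 < r -> (lnorm r%:E a <= c%:E)%E ->
  forall N, \sum_(i < N) `|a i| `^ r <= c `^ r.
Proof.
move=> r0 ac N; have c0 : 0 <= c by rewrite -lee_fin; exact: le_trans (lnorm_ge0 _ _) ac.
rewrite -lee_fin -sumEFin; move: ac; rewrite lnormE//.
set S := (\sum_(0 <= j <oo) _)%E => ac.
have S0 : (0 <= S)%E by apply: nneseries_ge0 => j _ _; rewrite lee_fin powR_ge0.
have SN : (\sum_(i < N) (`|a i| `^ r)%:E <= S)%E.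
  rewrite -(big_mkord xpredT (fun i => (`|a i| `^ r)%:E)).
  by apply: nneseries_lim_ge => i _ _; rewrite lee_fin powR_ge0.
apply: le_trans SN _; rewrite -(poweRe1 S0) -(@mulVf _ r) ?gt_eqF// poweRrM.
rewrite -poweR_EFin; apply: gt0_ler_poweR; rewrite ?(ltW r0)// in_itv/= ?leey ?andbT.
  exact: poweR_ge0.
by rewrite lee_fin.
Qed.

Lemma lnorm_le_partial (r : R) a (B : R) : 0 < r -> 0 <= B ->
  (forall N, \sum_(i < N) `|a i| `^ r <= B) -> (lnorm r%:E a <= (B `^ r^-1)%:E)%E.
Proof.
move=> r0 B0 aB; rewrite lnormE// -poweR_EFin.
apply: gt0_ler_poweR; rewrite ?invr_ge0 ?(ltW r0)// ?in_itv/= ?leey ?andbT//.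
  by apply: nneseries_ge0 => j _ _; rewrite lee_fin powR_ge0.
apply: lime_le.
  by apply: is_cvg_nneseries => n _ _; rewrite lee_fin powR_ge0.
by apply: nearW => n; rewrite big_mkord sumEFin lee_fin.
Qed.

End sequence_norms.

Section ell_basics.
Context (R : realType) (k : scalars) (p : \bar R) (p1 : (1 <= p)%E).
Notation K := (scalar_field R k).
Notation E := (ell R k p1).
Lemma ellZ c (x : E) t : (c *: x) t = c * x t. Proof. by []. Qed.
Lemma ell_ext (x y : E) : (forall t, x t = y t) -> x = y.
Proof. by move=> xy; apply/val_inj/funext. Qed.
(** Bundled as a linear form, so that it can be evaluated on sums and tested
    against weak norms. *)
Definition coord (t : nat) : E -> K := fun x => x t.
Lemma coord_is_scalar t : scalar (coord t).
Proof. by []. Qed.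
HB.instance Definition _ t := GRing.isLinear.Build K E K *%R (coord t) (coord_is_scalar t).
Lemma ell_sum (I : finType) (f : I -> E) t : (\sum_i f i) t = \sum_i f i t.
Proof. exact: (raddf_sum (coord t)). Qed.
End ell_basics.

Section iota.
Context (R : realType) (k : scalars).
Notation K := (scalar_field R k).

(** The inclusion of the scalars in the complex numbers, by which real and
    complex spaces share the inequalities on arrays. *)
Definition iota : K -> R[i] :=
  match k as k0 return scalar_field R k0 -> R[i] with
  | RealScalars => fun x : R => x%:C
  | ComplexScalars => fun z : R[i] => z
  end.

Lemma iotaD x y : iota (x + y) = iota x + iota y.
Proof. by rewrite /iota; case: k x y => //= x y; rewrite rmorphD. Qed.

Lemma iotaM x y : iota (x * y) = iota x * iota y.
Proof. by rewrite /iota; case: k x y => //= x y; rewrite rmorphM. Qed.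

Lemma iota0 : iota 0 = 0.
Proof. by rewrite /iota; case: k. Qed.

Lemma iota_sum (I : finType) (f : I -> K) : iota (\sum_i f i) = \sum_i iota (f i).
Proof. exact: (big_morph iota iotaD iota0). Qed.

Lemma normc_iota x : normc (iota x) = modulus x.
Proof.
rewrite /iota /modulus; case: k x => /= [x|z]; first by rewrite expr0n addr0 sqrtr_sqr.
by case: z.
Qed.

End iota.

Section ell_norms.
Context (R : realType) (k : scalars).
Notation K := (scalar_field R k).

Lemma normr_modulus (x : K) : `|modulus x| = modulus x.
Proof. by rewrite ger0_norm// modulus_ge0. Qed.

Section finite_exponent.
Context (t : R) (t1 : (1 <= t%:E)%E).
Let t0 : 0 < t. Proof. by rewrite (lt_le_trans ltr01)// -lee_fin. Qed.

Lemma ell_partial_le (x : ell R k t1) N :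
  \sum_(i < N) modulus (x i) `^ t <= rnorm x `^ t.
Proof.
have := @lnorm_partial_le R t (fun j => modulus (x j)) (rnorm x) t0.
rewrite rnorm_ell lexx => /(_ isT N).
by under eq_bigr do rewrite normr_modulus.
Qed.

Lemma ell_norm_le (x : ell R k t1) B : 0 <= B ->
  (forall N, \sum_(i < N) modulus (x i) `^ t <= B) -> rnorm x <= B `^ t^-1.
Proof.
move=> B0 xB; rewrite -lee_fin rnorm_ell; apply: lnorm_le_partial => // N.
by under eq_bigr do rewrite normr_modulus.
Qed.

End finite_exponent.

Lemma ell1_partial_le (x : ell_1 R k) N : \sum_(i < N) modulus (x i) <= rnorm x.
Proof.
have := ell_partial_le x N; rewrite powRr1 ?rnorm_ge0//.
by under eq_bigr do rewrite powRr1 ?modulus_ge0//.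
Qed.

Lemma ell1_norm_le (x : ell_1 R k) B : 0 <= B ->
  (forall N, \sum_(i < N) modulus (x i) <= B) -> rnorm x <= B.
Proof.
move=> B0 xB; rewrite -[leRHS]powRr1// -[X in _ `^ X]invr1; apply: ell_norm_le => // N.
by under eq_bigr do rewrite powRr1 ?modulus_ge0//.
Qed.

Lemma ell_oo_coord_le (x : ell_oo R k) t : modulus (x t) <= rnorm x.
Proof.
rewrite -lee_fin rnorm_ell lnormyE; apply: ereal_sup_ubound; exists t => //.
by rewrite normr_modulus.
Qed.

Lemma ell_oo_norm_le (x : ell_oo R k) c : (forall t, modulus (x t) <= c) -> rnorm x <= c.
Proof.
move=> xc; rewrite -lee_fin rnorm_ell lnormyE; apply: ge_ereal_sup => _ [t _ <-].
by rewrite lee_fin normr_modulus.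
Qed.

Lemma bounded_in_ell_oo (f : nat -> K) c : (forall t, modulus (f t) <= c) ->
  f \in ell_pred R k +oo%E.
Proof.
move=> fc; apply/ell_predP; rewrite lnormyE; apply: (@le_lt_trans _ _ c%:E); last exact: ltry.
by apply: ge_ereal_sup => _ [t _ <-]; rewrite lee_fin normr_modulus.
Qed.

Definition unit_seq (i : nat) : nat -> K := fun t => (t == i)%:R.

Lemma modulus_nat (b : bool) : modulus (b%:R : K) = b%:R.
Proof.
by case: b; rewrite ?modulus0//; apply: (can_inj (@of_realK R k)); rewrite modulusE normr1; case: (k).
Qed.

Lemma sum_unit_seq i N : \sum_(t < N) modulus (unit_seq i t) <= 1.
Proof.
have [iN|Ni] := ltnP i N.
  rewrite (bigD1 (Ordinal iN))//= /unit_seq eqxx modulus_nat big1 ?addr0// => t ti.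
  by rewrite (_ : (t == i :> nat) = false) ?modulus0//; apply/negP => /eqP ti'; move/eqP: ti; apply; apply/val_inj.
rewrite big1// => t _; rewrite /unit_seq (_ : (t == i :> nat) = false) ?modulus0//.
by rewrite ltn_eqF// (leq_trans (ltn_ord t)).
Qed.

Lemma unit_seq_in_ell1 i : unit_seq i \in ell_pred R k 1%E.
Proof.
apply/ell_predP; apply: (@le_lt_trans _ _ (1 `^ 1^-1)%:E); last exact: ltry.
apply: lnorm_le_partial => // N; under eq_bigr do rewrite normr_modulus powRr1 ?modulus_ge0//.
exact: sum_unit_seq.
Qed.

Definition unit_vector i : ell_1 R k := Ell (lexx 1%E) (unit_seq_in_ell1 i).

Lemma rnorm_unit_vector i : rnorm (unit_vector i) <= 1.
Proof. by apply: ell1_norm_le => // N; exact: sum_unit_seq. Qed.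

Definition vec P (phi : 'I_P -> K) : ell_1 R k := \sum_i phi i *: unit_vector i.

Lemma vecE P (phi : 'I_P -> K) t :
  vec phi t = if insub t is Some i then phi i else 0.
Proof.
rewrite /vec ell_sum; case: insubP => [i _ it|]; last first.
  rewrite -leqNgt => Pt; rewrite big1// => i _; rewrite ellZ/= /unit_seq.
  by rewrite gtn_eqF ?mulr0// (leq_trans (ltn_ord i)).
rewrite (bigD1 i)// ellZ/= /unit_seq -it eqxx mulr1 big1 ?addr0// => j ji.
rewrite -[LHS]/(phi j * (\val i == j :> nat)%:R) (_ : (\val i == j :> nat) = false) ?mulr0//.
by apply/negP => /eqP ij; move/eqP: ji; apply; apply/val_inj.
Qed.

Definition truncation P (x : ell_1 R k) : ell_1 R k := vec (fun i : 'I_P => x i).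

Lemma truncation_error (x : ell_1 R k) (eps : R) : 0 < eps ->
  exists M, forall P, (M <= P)%N -> rnorm (x - truncation P x) <= eps.
Proof.
move=> e0; have [M hM] : exists M, rnorm x - eps <= \sum_(i < M) modulus (x i).
  apply: contrapT => /forallNP h.
  have h' N : \sum_(i < N) modulus (x i) <= Num.max 0 (rnorm x - eps).
    by rewrite le_max; apply/orP; right; have /negP := h N; rewrite -ltNge => /ltW.
  have := ell1_norm_le _ h'; rewrite le_max lexx => /(_ isT).
  rewrite le_max => /orP[x0|]; last by rewrite lerBrDr gerDl leNgt e0.
  by apply: (h 0%N); rewrite big_ord0; lra.
exists M => P MP; apply: ell1_norm_le; first exact: ltW.
move=> N; have Mle (n n' : nat) : (n <= n')%N ->
    \sum_(i < n) modulus (x i) <= \sum_(i < n') modulus (x i).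
  move=> nn'; rewrite -(big_mkord xpredT (fun i => modulus (x i))) -[leRHS](big_mkord xpredT (fun i => modulus (x i))).
  rewrite [leRHS](big_cat_nat _ nn')//= lerDl sumr_ge0// => i _; exact: modulus_ge0.
have xE i : modulus ((x - truncation P x) i) = if (i < P)%N then 0 else modulus (x i).
  rewrite -[(x - truncation P x) i]/(x i - truncation P x i) /truncation vecE.
  case: insubP => [u ui ->|/negPf ->]; first by rewrite ui subrr modulus0.
  by rewrite subr0.
have : \sum_(i < N) modulus ((x - truncation P x) i) + \sum_(i < P) modulus (x i) <=
    \sum_(i < N + P) modulus (x i).
  rewrite -!(big_mkord xpredT (fun i => modulus (x i))).
  rewrite -(big_mkord xpredT (fun i => modulus ((x - truncation P x) i))).
  under eq_bigr do rewrite xE.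
  have -> : \sum_(0 <= i < P) modulus (x i) = \sum_(0 <= i < N + P) if (i < P)%N then modulus (x i) else 0.
    rewrite [RHS](big_cat_nat _ (leq_addl N P))//= [X in _ = _ + X]big_nat_cond.
    rewrite [X in _ = _ + X]big1 ?addr0 => [|i /andP[/andP[Pi _] _]]; last by rewrite ltnNge Pi.
    by apply: eq_big_nat => i /andP[_ ->].
  apply: (@le_trans _ _ (\sum_(0 <= i < N + P) (if (i < P)%N then 0 else modulus (x i)) +
      \sum_(0 <= i < N + P) if (i < P)%N then modulus (x i) else 0)).
    rewrite lerD2r [leRHS](big_cat_nat _ (leq_addr P N))//= lerDl sumr_ge0// => i _.
    by case: ifP => // _; exact: modulus_ge0.
  rewrite -big_split/=; apply: ler_sum => i _.
  by case: ifP; rewrite ?add0r ?addr0.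
have := ell1_partial_le x (N + P); have := Mle _ _ MP; lra.
Qed.

End ell_norms.

(** * Bounded multilinear operators *)

Lemma dfwithE (I : eqType) (T : Type) (f : I -> T) i u j :
  dfwith f i u j = if j == i then u else f j.
Proof. by case: dfwithP => [|j' ij]; rewrite ?eqxx// eq_sym (negPf ij). Qed.

(** The non-dependent case of [dfwith], free of the transport in its definition. *)
Definition upd (I : eqType) (T : Type) (f : I -> T) i u j := if j == i then u else f j.

Lemma dfwith_upd (I : eqType) (T : Type) (f : I -> T) i u :
  dfwith f i u = upd f i u.
Proof. by apply/funext => j; rewrite dfwithE. Qed.

Section linear_functions.
Context (R : realType) (k : scalars).
Notation K := (scalar_field R k).
Context (E F : normedModType K) (f : E -> F).
Hypothesis f_lin : linear f.

Lemma linear_fun0 : f 0 = 0.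
Proof. by have := f_lin (-1) 0 0; rewrite scaler0 addr0 scaleN1r addNr. Qed.

Lemma linear_funB u v : f (u - v) = f u - f v.
Proof. by have := f_lin (-1) v u; rewrite !scaleN1r [- v + u]addrC => ->; rewrite addrC. Qed.

Lemma linear_funZ c u : f (c *: u) = c *: f u.
Proof. by have := f_lin c u 0; rewrite linear_fun0 !addr0. Qed.

Lemma linear_fun_sum (I : finType) (c : I -> K) (e : I -> E) :
  f (\sum_i c i *: e i) = \sum_i c i *: f (e i).
Proof.
rewrite -!big_enum/=; elim: (enum I) => [|i s IH]; first by rewrite !big_nil linear_fun0.
by rewrite !big_cons f_lin IH.
Qed.

End linear_functions.

Section multilinear_maps.
Context (R : realType) (k : scalars).
Notation K := (scalar_field R k).
Context (N : nat) (E F : normedModType K) (S : ('I_N -> E) -> F).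
Hypothesis S_mult : @multilinear R k N (fun=> E) F S.

Lemma upd_linear (x : 'I_N -> E) i : linear (fun u : E => S (upd x i u)).
Proof.
move=> c u v; have := S_mult (i := i) x c u v.
by rewrite !(dfwith_upd (x : 'I_N -> E)).
Qed.

Let slotZ (x : 'I_N -> E) i c u : S (upd x i (c *: u)) = c *: S (upd x i u).
Proof. exact: (linear_funZ (upd_linear x i)). Qed.

Let slotB (x : 'I_N -> E) i u v : S (upd x i (u - v)) = S (upd x i u) - S (upd x i v).
Proof. exact: (linear_funB (upd_linear x i)). Qed.

(** Passing from x to y one slot at a time. *)
Definition hybrid (t : nat) (x y : 'I_N -> E) (i : 'I_N) := if (i < t)%N then y i else x i.

Lemma hybrid0 x y : hybrid 0 x y = x.
Proof. by apply/funext => i. Qed.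

Lemma hybridN x y : hybrid N x y = y.
Proof. by apply/funext => i; rewrite /hybrid ltn_ord. Qed.

Lemma hybrid_slot x y t (tN : (t < N)%N) :
  hybrid t x y = upd (hybrid t x y) (Ordinal tN) (x (Ordinal tN)).
Proof.
apply/funext => j; rewrite /upd; case: eqP => [->|//].
by rewrite /hybrid/= ltnn.
Qed.

Lemma hybridS x y t (tN : (t < N)%N) :
  hybrid t.+1 x y = upd (hybrid t x y) (Ordinal tN) (y (Ordinal tN)).
Proof.
apply/funext => j; rewrite /upd; case: eqP => [->|jt].
  by rewrite /hybrid/= ltnSn.
rewrite /hybrid ltnS leq_eqVlt (_ : (j == t :> nat) = false)//.
by apply/negP => /eqP jt'; apply: jt; apply/val_inj.
Qed.

Lemma multilinear_scale (c : 'I_N -> K) (x : 'I_N -> E) :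
  S (fun i => c i *: x i) = (\prod_i c i) *: S x.
Proof.
pose y i := c i *: x i.
have step t : (t <= N)%N -> S (hybrid t x y) = (\prod_(i < N | (i < t)%N) c i) *: S x.
  elim: t => [|t IH] tN; first by rewrite hybrid0 big1// scale1r.
  have -> : S (hybrid t.+1 x y) = c (Ordinal tN) *: S (hybrid t x y).
    rewrite (hybridS x y tN) [in RHS](hybrid_slot x y tN).
    exact: (slotZ (hybrid t x y) (Ordinal tN) (c (Ordinal tN)) (x (Ordinal tN))).
  rewrite (IH (ltnW tN)).
  rewrite scalerA [in RHS](bigD1 (Ordinal tN))//=; congr (_ * _ *: _).
  apply: eq_bigl => i; rewrite ltnS [RHS]andbC -[i != _]/(i != t :> nat).
  by rewrite ltn_neqAle.
have := step N (leqnn N); rewrite hybridN => ->; congr (_ *: _).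
by apply: eq_bigl => i; rewrite ltn_ord.
Qed.

Lemma multilinear_eq0 (x : 'I_N -> E) i : x i = 0 -> S x = 0.
Proof.
move=> xi; have -> : x = upd x i 0.
  by apply/funext => j; rewrite /upd; case: eqP => // ->.
exact: (linear_fun0 (upd_linear x i)).
Qed.

Lemma multilinear_continuous (C : R) (x : 'I_N -> E) (eps : R) :
  (forall x, rnorm (S x) <= C * \prod_(i < N) rnorm (x i)) -> 0 < eps ->
  exists2 delta : R, 0 < delta & forall x', (forall i, rnorm (x i - x' i) <= delta) ->
    rnorm (S x - S x') <= eps.
Proof.
move=> SC e0; pose C' := Num.max 0 C; have C'0 : 0 <= C' by rewrite le_max lexx.
have {}SC z : rnorm (S z) <= C' * \prod_(i < N) rnorm (z i).
  apply: le_trans (SC z) _; rewrite ler_wpM2r//; last by rewrite le_max lexx orbT.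
  by apply: prodr_ge0 => i _; exact: rnorm_ge0.
pose B := 1 + \sum_i rnorm (x i).
have B1 : 1 <= B by rewrite lerDl sumr_ge0// => i _; exact: rnorm_ge0.
have B0 : 0 <= B by exact: le_trans B1.
have xB i : rnorm (x i) + 1 <= B.
  by rewrite addrC lerD2l (bigD1 i)//= lerDl sumr_ge0// => j _; exact: rnorm_ge0.
pose Q := 1 + N%:R * (C' * B ^+ N).
have Q0 : 0 < Q by rewrite ltr_pwDl// mulr_ge0// mulr_ge0// exprn_ge0.
pose de := Num.min 1 (eps / Q).
have de0 : 0 < de by rewrite lt_min ltr01 divr_gt0.
have de1 : de <= 1 by rewrite ge_min lexx.
have deQ : de * Q <= eps by rewrite -ler_pdivlMr// ge_min lexx orbT.
exists de => // x' xx'.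
have x'B i : rnorm (x' i) <= B.
  apply: le_trans (xB i); rewrite -[x' i](subKr (x i)).
  apply: le_trans (rnormD _ _) _; rewrite lerD2l -scaleN1r rnormZ.
  rewrite (_ : modulus _ = 1) ?mul1r; first exact: le_trans de1.
  by apply: (can_inj (@of_realK R k)); rewrite modulusE normrN normr1; case: (k).
have hB t i : rnorm (hybrid t x x' i) <= B.
  by rewrite /hybrid; case: ifP => // _; apply: le_trans (xB i); rewrite lerDl.
have step t : (t <= N)%N ->
    rnorm (S x - S (hybrid t x x')) <= t%:R * (C' * B ^+ N) * de.
  elim: t => [|t IH] tN.
    rewrite hybrid0 subrr !mul0r -(scale0r (0 : F)) rnormZ.
    by rewrite modulus0 mul0r.
  rewrite -(subrKA (S (hybrid t x x'))); apply: le_trans (rnormD _ _) _.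
  have tE : t.+1%:R * (C' * B ^+ N) * de = t%:R * (C' * B ^+ N) * de + C' * B ^+ N * de.
    by rewrite -natr1 -!mulrA mulrDl mul1r.
  rewrite tE; apply: lerD; first exact: (IH (ltnW tN)).
  pose it := Ordinal tN.
  have -> : S (hybrid t x x') - S (hybrid t.+1 x x') = S (upd (hybrid t x x') it (x it - x' it)).
    by rewrite (slotB (hybrid t x x') it (x it) (x' it)) -(hybrid_slot x x' tN) -(hybridS x x' tN).
  apply: le_trans (SC _) _; rewrite -mulrA; apply: ler_wpM2l => //.
  rewrite (bigD1 it)//= /upd eqxx mulrC; apply: ler_pM => //.
  - by apply: prodr_ge0 => i _; exact: rnorm_ge0.
  - exact: rnorm_ge0.
  - apply: (@le_trans _ _ (\prod_(i < N | i != it) B)).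
      apply: ler_prod => i hi; rewrite rnorm_ge0/= (negPf hi); exact: hB.
    rewrite prodr_const; apply: ler_weXn2l => //.
    by rewrite -[X in (_ <= X)%N](card_ord N); exact: max_card.
have := step N (leqnn N); rewrite hybridN => /le_trans; apply.
apply: le_trans deQ; rewrite mulrC ler_pM2l// /Q lerDr//.
Qed.

(** Arguments given as a sequence, for induction on the slots. *)
Definition seq_eval (vs : seq E) : F := S (fun i => nth 0 vs i).

Lemma seq_eval_slot pre post : (size pre < N)%N -> linear (fun u => seq_eval (pre ++ u :: post)).
Proof.
move=> preN; suff h u : seq_eval (pre ++ u :: post) =
    S (upd (fun i : 'I_N => nth 0 (pre ++ 0 :: post) i) (Ordinal preN) u).
  move=> a u v; rewrite !h; exact: (upd_linear _ _ a u v).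
congr S; apply/funext => j; rewrite /upd !nth_cat -[j == _]/(j == size pre :> nat).
have [jp|pj|->] := ltngtP j (size pre); rewrite ?ltnn ?subnn//.
by rewrite -[(j - size pre)%N]prednK// subn_gt0.
Qed.

End multilinear_maps.

Section expansion.
Context (R : realType) (k : scalars).
Notation K := (scalar_field R k).
Context (N : nat) (E F : normedModType K) (S : ('I_N -> E) -> F).
Hypothesis S_mult : @multilinear R k N (fun=> E) F S.
Context (la : {scalar F}) (X : finType) (e : X -> E).

(** Coefficients of an operator on the span of the e_x form an array, and the
    operator is the form of that array; pre holds the slots that have already
    been expanded. *)
Lemma multilinear_expand (phis : seq (X -> K)) pre : (size pre + size phis = N)%N ->
  iota (la (seq_eval S (pre ++ map (fun phi => \sum_x phi x *: e x) phis))) =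
  mform (fun s => iota (la (seq_eval S (pre ++ map e s)))) (map (fun phi x => iota (phi x)) phis).
Proof.
have laS (c : X -> K) v : la (\sum_x c x *: v x) = \sum_x c x * la (v x).
  by rewrite raddf_sum; apply: eq_bigr => x _; exact: linearZ.
elim: phis pre => [|phi phis IH] pre sz; first by rewrite /mform.
rewrite /= mform_cons (linear_fun_sum (seq_eval_slot S_mult _ _)); last first.
  by rewrite -sz addnS ltnS leq_addr.
rewrite laS iota_sum; apply: eq_bigr => x _.
rewrite iotaM -cat_rcons IH; last by rewrite size_rcons -sz /= addnS.
by congr (_ * mform _ _); apply/funext => s; rewrite cat_rcons.
Qed.

End expansion.

Section block_composition.
Context (R : realType) (k : scalars).
Notation K := (scalar_field R k).
Context (m n : nat) (E F G : normedModType K).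
Context (T : ('I_m -> F) -> G) (A : 'I_m -> ('I_n -> E) -> F).
Hypothesis T_mult : multilinear_operators T.
Hypothesis A_mult : forall i : 'I_m, multilinear_operators (A i).

Lemma block_index_surj (i : 'I_(m * n)) : exists a b, i = block_index a b.
Proof.
have /andP[_ n0] : (0 < m)%N && (0 < n)%N.
  by rewrite -muln_gt0; exact: leq_ltn_trans (leq0n i) (ltn_ord i).
have am : (i %/ n < m)%N by rewrite ltn_divLR.
exists (Ordinal am), (Ordinal (ltn_pmod i n0)); apply/val_inj => /=.
exact: divn_eq.
Qed.

Lemma block_index_inj a b a' b' : @block_index m n a b = block_index a' b' ->
  a = a' /\ b = b'.
Proof.
move=> /(congr1 val)/= h; have n0 : (0 < n)%N by exact: leq_ltn_trans (ltn_ord b).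
have := congr1 (divn^~ n) h; have := congr1 (modn^~ n) h.
rewrite /= !modnMDl !modn_small// !divnMDl// !divn_small// !addn0 => bb' aa'.
by split; apply/val_inj.
Qed.

Lemma prod_block (f : 'I_(m * n) -> R) :
  \prod_i f i = \prod_a \prod_b f (block_index a b).
Proof.
rewrite pair_bigA/= (reindex (fun p : 'I_m * 'I_n => block_index p.1 p.2))//=.
pose inv i := [pick p : 'I_m * 'I_n | block_index p.1 p.2 == i].
apply: onW_bij; apply: inj_card_bij => [[a b] [a' b'] /block_index_inj[/= -> ->]//|].
by rewrite card_prod !card_ord.
Qed.

Lemma block_comp_bounded :
  @bounded_multilinear R k (m * n) (fun=> E) G (block_comp T A).
Proof.
have [T_lin [CT hT]] := T_mult.
split=> [i x|].
  have [a [b ->]] := block_index_surj i.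
  pose xa a' := fun j => x (block_index a' j).
  have blockE u : block_comp T A (dfwith x (block_index a b) u) =
      T (upd (fun a' => A a' (xa a')) a (A a (upd (xa a) b u))).
    congr T; apply/funext => a'; rewrite /upd; case: eqP => [->|aa'].
      congr (A a); apply/funext => j; rewrite dfwithE.
      by rewrite (inj_eq (fun j j' h => (block_index_inj h).2 : j = j')).
    congr (A a'); apply/funext => j; rewrite dfwithE; case: eqP => // /block_index_inj[].
    by move=> /aa'.
  move=> c u v; rewrite !blockE.
  have [A_lin _] := A_mult a; rewrite (upd_linear A_lin (xa a) b c u v).
  exact: (upd_linear T_lin).
have /choice[CA hA] a : exists C, 0 <= C /\ forall x, rnorm (A a x) <= C * \prod_(i < n) rnorm (x i).
  have [_ [C hC]] := A_mult a; exists (Num.max 0 C); split; first by rewrite le_max lexx.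
  move=> x; apply: le_trans (hC x) _; rewrite ler_wpM2r ?le_max ?lexx ?orbT//.
  by apply: prodr_ge0 => i _; exact: rnorm_ge0.
exists (Num.max 0 CT * \prod_a CA a) => x.
apply: (@le_trans _ _ (Num.max 0 CT * \prod_a rnorm (A a (fun j => x (block_index a j))))).
  apply: le_trans (hT _) _; rewrite ler_wpM2r ?le_max ?lexx ?orbT//.
  by apply: prodr_ge0 => i _; exact: rnorm_ge0.
rewrite prod_block -mulrA ler_wpM2l ?le_max ?lexx// -big_split/=.
apply: ler_prod => a _; rewrite rnorm_ge0/=; exact: (hA a).2.
Qed.

End block_composition.

(** * Operators on truncated families, and quantization *)

Section operators_on_ell1.
Context (R : realType) (k : scalars).
Notation K := (scalar_field R k).
Local Notation C := R[i].

Lemma rnorm_vec_le P (phi : 'I_P -> K) : rnorm (vec phi) <= \sum_i modulus (phi i).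
Proof.
rewrite /vec; elim/big_ind2: _ => [|x1 y1 x2 y2 h1 h2|i _].
- by rewrite -(scale0r (0 : ell_1 R k)) rnormZ modulus0 mul0r.
- by apply: le_trans (rnormD _ _) _; exact: lerD.
- by rewrite rnormZ ler_piMr ?modulus_ge0// rnorm_unit_vector.
Qed.

(** With g = 0 only boundedness of T is used, since weighted families lie in the
    unit ball of l_1. *)
Lemma vec_bound_l1 m (s K0 r : R) (F : normedModType K) (T : ('I_m -> ell_1 R k) -> F) :
  multilinear_operators T -> 1 <= s -> 0 < K0 -> 0 < r ->
  r^-1 = m%:R / s - m%:R / 2 ->
  exists2 B : R, 0 <= B & forall (J : finType) P (al : 'I_m -> J -> 'I_P -> K),
    (forall a, hilbert_summable (s / 2) K0 (fun j i => iota (al a j i))) ->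
    \sum_j rnorm (T (fun a => vec (al a j))) `^ r <= B.
Proof.
move=> [_ [CT hT]] s1 K00 r0 rE.
have [B B0 hB] := @sum_power_bound R m s 0 K0 1 r s1 (lexx 0) K00 ler01 r0 (etrans rE (esym (addr0 _))).
pose CT' := Num.max 0 CT; have CT0 : 0 <= CT' by rewrite le_max lexx.
exists (CT' `^ r * B) => [|J P al hal]; first by rewrite mulr_ge0// powR_ge0.
pose V (j : J) := \prod_(a < m) \sum_i normc (iota (al a j i)).
have V0 j : 0 <= V j.
  by apply: prodr_ge0 => a _; apply: sumr_ge0 => i _; exact: normc_ge0.
have TV j : rnorm (T (fun a => vec (al a j))) <= CT' * V j.
  apply: (@le_trans _ _ (CT' * \prod_(a < m) rnorm (vec (al a j)))).
    apply: le_trans (hT _) _; rewrite ler_wpM2r ?le_max ?lexx ?orbT//.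
    by apply: prodr_ge0 => a _; exact: rnorm_ge0.
  rewrite ler_wpM2l//; apply: ler_prod => a _; rewrite rnorm_ge0/=.
  by under [leRHS]eq_bigr do rewrite normc_iota; exact: rnorm_vec_le.
apply: (@le_trans _ _ (\sum_j CT' `^ r * V j `^ r)).
  apply: ler_sum => j _; rewrite -powRM//.
  by apply: le_powR_base; rewrite ?(ltW r0) ?rnorm_ge0.
rewrite -mulr_sumr ler_wpM2l ?powR_ge0//.
apply: (hB _ _ (fun a j i => iota (al a j i)) V hal V0) => be be0 hbe.
exists (fun=> 0); split=> // [|j]; first by rewrite big1.
rewrite powRr0 mulr1.
have -> : be j ^+ m * V j =
    \prod_(a < m) \sum_i normc (weighted be (fun j i => iota (al a j i)) j i).
  rewrite -[X in _ ^+ X](card_ord m) -prodr_const -big_split/=.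
  apply: eq_bigr => a _; rewrite mulr_sumr; apply: eq_bigr => i _.
  by rewrite /weighted normcM normc_real ger0_norm.
apply: prodr_ile1 => a _; rewrite sumr_ge0/=; last by move=> i _; exact: normc_ge0.
exact: hilbert_l1_unit.
Qed.

(** The norm of T(a_j) in l_t is replaced by that of its first L coordinates, at
    the price of a factor 2; L can be chosen for all j together because J is
    finite. *)
Lemma vec_bound_lp m (s K0 r t : R) (t1 : (1 <= t%:E)%E)
    (T : ('I_m -> ell_1 R k) -> ell R k t1) :
  (0 < m)%N -> multilinear_operators T -> 1 <= s -> 0 < K0 -> 0 < r -> 1 < t ->
  r^-1 = m%:R / s - m%:R / 2 + lp_gain t ->
  exists2 B : R, 0 <= B & forall (J : finType) P (al : 'I_m -> J -> 'I_P -> K),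
    (forall a, hilbert_summable (s / 2) K0 (fun j i => iota (al a j i))) ->
    \sum_j rnorm (T (fun a => vec (al a j))) `^ r <= B.
Proof.
move=> m0 [T_lin [CT hT]] s1 K00 r0 t_gt1 rE.
have t0 : 0 < t by exact: lt_trans t_gt1.
have [A A0 hA] := lp_multilinear t_gt1.
have g0 : 0 <= lp_gain t.
  rewrite /lp_gain; case: ifP => _; last by rewrite invr_ge0 ltW.
  by rewrite subr_ge0 invf_le1// ltW.
have [B B0 hB] := @sum_power_bound R m s (lp_gain t) K0 A r s1 g0 K00 A0 r0 rE.
pose CT' := Num.max 1 CT; have CT1 : 1 <= CT' by rewrite le_max lexx.
have CT0 : 0 < CT' by exact: lt_le_trans CT1.
exists ((2 * CT') `^ r * B) => [|J P al hal]; first by rewrite mulr_ge0// powR_ge0.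
pose evT : seq (ell_1 R k) -> ell R k t1 := @seq_eval R k m (ell_1 R k) (ell R k t1) T.
pose th (l : nat) (s : seq 'I_P) : C :=
  ((CT')^-1)%:C * iota (coord l (evT (map (fun i : 'I_P => unit_vector R k i) s))).
have th1 L s' : size s' = m -> \sum_(l < L) normc (th l s') `^ t <= 1.
  move=> sz; set w := evT (map (fun i : 'I_P => unit_vector R k i) s').
  have w1 : rnorm w <= CT'.
    apply: le_trans (hT _) _; rewrite -[leRHS]mulr1.
    apply: (@le_trans _ _ (CT' * \prod_(i < m) rnorm (nth 0 (map (fun i : 'I_P => unit_vector R k i) s') i))).
      rewrite ler_wpM2r ?le_max ?lexx ?orbT//.
      by apply: prodr_ge0 => a _; exact: rnorm_ge0.
    rewrite ler_wpM2l ?(ltW CT0)//; apply: prodr_ile1 => i _; rewrite rnorm_ge0/=.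
    case: s' sz @w => [|i0 s'] sz w; first by exfalso; move: m0; rewrite -sz.
    by rewrite (nth_map i0) ?sz// rnorm_unit_vector.
  have E l : normc (th l s') `^ t = modulus (w l) `^ t / CT' `^ t.
    rewrite /th normcM normc_iota normc_real ger0_norm ?invr_ge0 ?(ltW CT0)//.
    by rewrite powRM ?invr_ge0 ?modulus_ge0 ?(ltW CT0)// mulrC powR_invl// ltW.
  under eq_bigr do rewrite E.
  rewrite -mulr_suml ler_pdivrMr ?powR_gt0// mul1r.
  apply: le_trans (ell_partial_le _ _) _.
  by apply: le_powR_base; rewrite ?(ltW t0) ?rnorm_ge0.
pose ys : seq (J -> 'I_P -> C) := map (fun a j i => iota (al a j i)) (enum 'I_m).
have szys : size ys = m by rewrite size_map size_enum_ord.
pose V L j := (\sum_(l < L) normc (mform (th l) (map (fun y => y j) ys)) `^ t) `^ t^-1.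
have V0 L j : 0 <= V L j by exact: powR_ge0.
have VB L : \sum_j V L j `^ r <= B.
  apply: (hB _ _ (fun a j i => iota (al a j i)) (V L) hal (V0 L)) => be be0 hbe.
  pose zs := map (fun a => weighted be (fun j i => iota (al a j i))) (enum 'I_m).
  have szs : size zs = m by rewrite size_map size_enum_ord.
  have [|||om [om0 om1 omV]] := hA _ _ _ (fun l : 'I_L => th l) zs.
  - by rewrite szs.
  - by apply/allp_map; elim: (enum _) => //= a e' IH; split.
  - by move=> s' sz; apply: th1; rewrite sz szs.
  exists om; split=> // j; apply: le_trans (omV j).
  have zE l : normc (mform (th l) (map (fun y => y j) zs)) `^ t =
      (be j ^+ m) `^ t * normc (mform (th l) (map (fun y => y j) ys)) `^ t.
    have -> : map (fun y => y j) zs =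
        map (fun phi x => (be j)%:C * phi x) (map (fun y => y j) ys).
      by rewrite /zs /ys -!map_comp.
    rewrite mformZ_all size_map szys normcM normcX normc_real ger0_norm//.
    by rewrite powRM ?exprn_ge0 ?normc_ge0.
  under eq_bigr do rewrite zE.
  rewrite -mulr_sumr powRM ?powR_ge0 ?sumr_ge0//; last by move=> l _; exact: powR_ge0.
  by rewrite -powRrM divff ?gt_eqF// powRr1 ?exprn_ge0.
have valueE j l : normc (mform (th l) (map (fun y => y j) ys)) =
    modulus (T (fun a => vec (al a j)) l) / CT'.
  rewrite /th mformZ normcM normc_real ger0_norm ?invr_ge0 ?(ltW CT0)// mulrC.
  congr (_ / _); rewrite -normc_iota; congr normc.
  pose phis := map (fun a => al a j) (enum 'I_m).
  have := @multilinear_expand R k m (ell_1 R k) (ell R k t1) T T_lin (coord l : {scalar ell R k t1}) _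
    (fun i : 'I_P => unit_vector R k i) phis [::].
  rewrite /= size_map size_enum_ord => /(_ erefl).
  rewrite (_ : map _ phis = map (fun y => y j) ys); last by rewrite /phis /ys -!map_comp.
  move=> <-; congr (iota (coord l _)); rewrite /seq_eval; congr T; apply/funext => a.
  rewrite (nth_map (al a j)); last by rewrite /phis size_map size_enum_ord.
  by rewrite (nth_map a) ?size_enum_ord// nth_ord_enum.
have /choice[Lf hL] : forall j : J, exists L, 0 < rnorm (T (fun a => vec (al a j))) ->
    rnorm (T (fun a => vec (al a j))) <= 2 * CT' * V L j.
  move=> j; apply: contrapT => /forallNP h.
  set w := T _ in h *.
  have w0 : 0 < rnorm w by apply: contrapT => nw; apply: (h 0%N) => /nw.
  have h' L : \sum_(l < L) modulus (w l) `^ t <= (rnorm w / 2) `^ t.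
    rewrite leNgt; apply/negP => hlt; apply: (h L) => _.
    have -> : V L j = (\sum_(l < L) modulus (w l) `^ t) `^ t^-1 / CT'.
      rewrite /V; under eq_bigr do rewrite valueE powRM ?modulus_ge0 ?invr_ge0 ?(ltW CT0)//.
      rewrite -mulr_suml powRM ?powR_ge0 ?sumr_ge0//; last by move=> l _; exact: powR_ge0.
      by rewrite -powRrM divff ?gt_eqF// powRr1// invr_ge0 ltW.
    have := le_powR_base (_ : 0 <= t^-1) (powR_ge0 _ _) (ltW hlt).
    rewrite invr_ge0 ltW// -powRrM divff ?gt_eqF// powRr1 ?divr_ge0 ?rnorm_ge0// => /(_ isT).
    rewrite ler_pdivrMr// => h1; apply: le_trans h1 _.
    set u := _ `^ t^-1; apply: le_of_eq; field.
    by rewrite gt_eqF.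
  have := ell_norm_le (powR_ge0 _ _) h'.
  rewrite -powRrM divff ?gt_eqF// powRr1 ?divr_ge0 ?rnorm_ge0//.
  by apply/negP; rewrite -ltNge; lra.
pose L := (\sum_j Lf j)%N.
have LfL j : (Lf j <= L)%N by rewrite /L (bigD1 j)//= leq_addr.
have Vmono j : V (Lf j) j <= V L j.
  apply: le_powR_base; rewrite ?invr_ge0 ?(ltW t0)//.
    by apply: sumr_ge0 => l _; exact: powR_ge0.
  rewrite -(big_mkord xpredT (fun l => normc (mform (th l) (map (fun y => y j) ys)) `^ t)).
  rewrite -[leRHS](big_mkord xpredT (fun l => normc (mform (th l) (map (fun y => y j) ys)) `^ t)).
  rewrite [leRHS](big_cat_nat _ (LfL j))//= lerDl sumr_ge0// => l _; exact: powR_ge0.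
apply: (@le_trans _ _ (\sum_j (2 * CT') `^ r * V L j `^ r)).
  apply: ler_sum => j _; rewrite -powRM ?mulr_ge0 ?(ltW CT0)//.
  apply: le_powR_base; rewrite ?(ltW r0) ?rnorm_ge0//.
  have [w0|] := ltP 0 (rnorm (T (fun a => vec (al a j)))).
    apply: le_trans (hL j w0) _; rewrite ler_wpM2l// mulr_ge0// ltW//.
  by move=> /le_trans; apply; rewrite mulr_ge0 ?mulr_ge0 ?(ltW CT0).
by rewrite -mulr_sumr ler_wpM2l ?powR_ge0.
Qed.

End operators_on_ell1.

Section quantization.
Context (R : realType).

(** The function q codes, for all g together, the cell of width delta of the
    value at t, and rep picks an argument in each cell. *)
Lemma quantize_real (G : finType) (h : G -> nat -> R) (B delta : R) :
  (forall g t, `|h g t| <= B) -> 0 < delta ->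
  exists P (q rep : nat -> nat), (forall t, (q t < P)%N) /\
    forall g t, `|h g t - h g (rep (q t))| <= delta.
Proof.
move=> hB d0; pose lv g t := Num.truncn ((h g t + B) / delta).
pose D := Num.truncn ((B + B) / delta).
have h0 g t : 0 <= (h g t + B) / delta.
  by rewrite divr_ge0 ?(ltW d0)//; have := hB g t; rewrite ler_norml => /andP[]; lra.
have lvD g t : (lv g t < D.+1)%N.
  rewrite ltnS; apply: le_truncn; rewrite ler_pM2r ?invr_gt0//.
  by rewrite lerD2r; have := hB g t; rewrite ler_norml => /andP[].
pose code t : {ffun G -> 'I_D.+1} := [ffun g => Ordinal (lvD g t)].
pose q t : nat := enum_rank (code t).
exists #|{ffun G -> 'I_D.+1}|, q, (fun c => xget 0%N [set t | q t = c]).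
split=> [t|g t]; first exact: ltn_ord.
have : q (xget 0%N [set t' | q t' = q t]) = q t.
  by apply: (xgetPex 0%N (ex_intro (fun x => [set t' | q t' = q t] x) t erefl)).
set t' := xget _ _ => qq.
have /(congr1 (fun f : {ffun G -> 'I_D.+1} => val (f g))) : code t' = code t.
  by apply: enum_rank_inj; apply/val_inj.
rewrite !ffunE/= => lvE.
have /andP[a1 a2] := truncn_itv (h0 g t); have /andP[b1 b2] := truncn_itv (h0 g t').
rewrite -/(lv g t) in a1 a2; rewrite -/(lv g t') lvE in b1 b2.
move: a1 a2 b1 b2; rewrite !ler_pdivlMr// !ltr_pdivrMr// -natr1.
by rewrite ler_norml; lra.
Qed.

End quantization.

(** * Coefficient arrays of operators into l_1 *)

Lemma mform_rcons (A : comNzRingType) (X : finType) (b : seq X -> A) phis psi :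
  mform b (rcons phis psi) = \sum_i psi i * mform (fun s => b (rcons s i)) phis.
Proof.
elim: phis b => [|phi phis IH] b; first by rewrite mform_cons.
rewrite rcons_cons mform_cons; under eq_bigr => x _ do rewrite IH mulr_sumr.
rewrite exchange_big/=; apply: eq_bigr => i _; rewrite mform_cons mulr_sumr.
by apply: eq_bigr => x _; rewrite mulrCA.
Qed.

Section complexification.
Context (R : realType) (X : finType).
Local Notation C := R[i].

Lemma normc_Re_le (z : C) : `|Re z| <= normc z.
Proof.
rewrite -ler_sqr ?nnegrE ?normc_ge0// sqr_normc real_normK ?num_real//.
by rewrite lerDl sqr_ge0.
Qed.

Lemma normc_Im_le (z : C) : `|Im z| <= normc z.
Proof.
rewrite -ler_sqr ?nnegrE ?normc_ge0// sqr_normc real_normK ?num_real//.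
by rewrite lerDr sqr_ge0.
Qed.

(** A real array is tested on complex functions by splitting each slot into real
    and imaginary parts, which doubles the bound for each of the N slots. *)
Lemma sup_bounded_iota (k : scalars) N B (b : seq X -> C) :
  (forall phis : seq (X -> scalar_field R k), size phis = N ->
    allp (fun phi => forall x, modulus (phi x) <= 1) phis ->
    normc (mform b (map (fun phi x => iota (phi x)) phis)) <= B) ->
  sup_bounded N (2 ^+ N * B) b.
Proof.
case: k => [|] bB; last first.
  move=> phis sz phis1; have B0 : 0 <= B.
    have := bB (nseq N (fun=> 0)) (size_nseq _ _).
    move=> h; apply: le_trans (normc_ge0 _) (h _); elim: (N) => //= n' IH; split=> // x.
    by rewrite expr0n addr0 sqrtr0 ler01.
  have := bB phis sz; rewrite (_ : map _ phis = phis); last first.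
    by rewrite -[RHS]map_id; apply: eq_map => phi; apply/funext.
  move=> h; apply: (@le_trans _ _ B).
    by apply: h; apply: sub_allp phis1 => phi hphi x; rewrite -normc_iota; exact: hphi.
  by rewrite ler_peMl// exprn_ege1// ler1n.
elim: N b bB => [|N IH] b bB.
  by case=> // _ _; rewrite expr0 mul1r; apply: (bB [::]).
case=> [|phi phis]// [sz] /= [phi1 phis1].
pose re x : R := Re (phi x); pose im x : R := Im (phi x).
have phiE : plug b phi = (fun s => plug b (fun x => (re x)%:C) s + 'i%C * plug b (fun x => (im x)%:C) s).
  apply/funext => s; rewrite /plug mulr_sumr -big_split/=; apply: eq_bigr => x _.
  by rewrite {1}(complexE (phi x)) mulrDl mulrA.
have part (u : X -> R) : (forall x, `|u x| <= 1) ->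
    normc (mform (plug b (fun x => (u x)%:C)) phis) <= 2 ^+ N * B.
  move=> u1; apply: IH => // psis psz psis1.
  apply: (bB (u :: psis)); first by rewrite /= psz.
  by split; [move=> x; exact: (u1 x)|exact: psis1].
rewrite -[mform b _]/(mform (plug b phi) phis) phiE mformD mformZ.
apply: le_trans (le_normcD _ _) _; rewrite exprS mulrAC mulr_natl mulr2n.
rewrite [leRHS](_ : _ = 2 ^+ N * B + 2 ^+ N * B); last by ring.
apply: lerD; first by apply: part => x; apply: le_trans (normc_Re_le _) (phi1 x).
rewrite normcM (_ : normc 'i = 1) ?mul1r; last by rewrite /= expr0n expr1n add0r sqrtr1.
by apply: part => x; apply: le_trans (normc_Im_le _) (phi1 x).
Qed.

End complexification.

Section arrays_of_operators.
Context (R : realType) (k : scalars) (n P : nat).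
Notation K := (scalar_field R k).
Local Notation C := R[i].
Context (A : ('I_n -> ell_oo R k) -> ell_1 R k) (CA : R) (e : 'I_P -> ell_oo R k).
Hypothesis A_lin : @multilinear R k n (fun=> ell_oo R k) (ell_1 R k) A.
Hypothesis CA1 : 1 <= CA.
Hypothesis A_le : forall x, rnorm (A x) <= CA * \prod_(i < n) rnorm (x i).
Hypothesis e_le : forall phi : 'I_P -> K, (forall c, modulus (phi c) <= 1) ->
  rnorm (\sum_c phi c *: e c) <= 1.

Let evA : seq (ell_oo R k) -> ell_1 R k := @seq_eval R k n (ell_oo R k) (ell_1 R k) A.

(** The first n indices are slots of A, the last one a coordinate of its value. *)
Definition coef (s : seq 'I_P) : C :=
  iota (coord (nth 0%N (map val s) n) (evA (map e (take n s)))).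

Lemma mform_coef (phis : seq ('I_P -> K)) (psi : 'I_P -> C) : size phis = n ->
  mform coef (rcons (map (fun phi x => iota (phi x)) phis) psi) =
  \sum_i psi i * iota (coord i (evA (map (fun phi => \sum_c phi c *: e c) phis))).
Proof.
move=> sz; rewrite mform_rcons; apply: eq_bigr => i _; congr (_ * _).
rewrite -[map _ phis in RHS]cat0s.
have := @multilinear_expand R k n _ _ A A_lin (coord i : {scalar ell_1 R k}) _ e phis [::] sz.
rewrite /= => ->; apply: eq_mform => s; rewrite size_map sz => ssz; rewrite /coef.
have -> : take n (rcons s i) = s by rewrite -ssz -cats1 take_size_cat.
by rewrite map_rcons nth_rcons size_map ssz ltnn eqxx.
Qed.

(** The last slot pairs l_1 with l_oo, so boundedness of the form is boundedness
    of A with values in l_1. *)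
Lemma coef_bounded : sup_bounded n.+1 (2 ^+ n.+1 * CA) coef.
Proof.
apply: (sup_bounded_iota (k := k)) => phis; case/lastP: phis => // phis psi.
rewrite size_rcons map_rcons => -[sz] /allp_rcons[phis1 psi1]; rewrite mform_coef//.
set w := evA _.
apply: (@le_trans _ _ (\sum_(i < P) modulus (w i))).
  apply: le_trans (ler_normc_sum _ _ _) _; apply: ler_sum => i _.
  by rewrite normcM !normc_iota ler_piMl ?modulus_ge0.
apply: le_trans (ell1_partial_le _ _) _; apply: le_trans (A_le _) _.
rewrite -[leRHS]mulr1 ler_wpM2l ?(le_trans _ CA1)//.
apply: prodr_ile1 => i _; rewrite rnorm_ge0/=.
rewrite (nth_map (fun=> 0)) ?sz//; apply: e_le => c.
by have := nth_allp (fun=> 0) phis1 (_ : (i < _)%N); rewrite sz => /(_ (ltn_ord i)).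
Qed.

Definition operator_const (s : R) : R := (2 ^+ n.+1 * CA) `^ s * (2 * form_const n s) `^ s.

Lemma operator_hilbert_summable (J : finType) (s : R) (y : 'I_n -> J -> 'I_P -> K) :
  (2 <= n)%N -> 1 <= s ->
  (forall i0 c, \sum_j modulus (y i0 j c) `^ (2 * s) <= 1) ->
  hilbert_summable (s / 2) (operator_const s)
    (fun j (i : 'I_P) => iota (coord i (A (fun i0 => \sum_c y i0 j c *: e c)))).
Proof.
move=> n2 s1 y1; pose D : R := 2 ^+ n.+1 * CA.
have s0 : 0 < s by exact: lt_le_trans s1.
have D0 : 0 < D by rewrite mulr_gt0 ?exprn_gt0// (lt_le_trans _ CA1).
pose ys : seq (J -> 'I_P -> C) := map (fun i0 j c => iota (y i0 j c)) (enum 'I_n).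
pose b s : C := (D^-1)%:C * coef s.
have b1 : sup_bounded n.+1 1 b.
  move=> phis sz phis1; rewrite mformZ normcM normc_real ger0_norm ?invr_ge0 ?(ltW D0)//.
  by rewrite mulrC ler_pdivrMr// mul1r; exact: coef_bounded.
have ys1 : allp (fun z => forall x, \sum_j normc (z j x) `^ (2 * s) <= 1) ys.
  apply/allp_map; elim: (enum _) => //= i0 l IH; split=> // x.
  by under eq_bigr do rewrite normc_iota; exact: y1.
have szys : size ys = n by rewrite size_map size_enum_ord.
have main := @multilinear_hilbert_summable R _ b n J ys s n2 szys b1 s1 ys1.
have aE j (i : 'I_P) : iota (coord i (A (fun i0 => \sum_c y i0 j c *: e c))) =
    D%:C * mform b (rcons (map (fun z => z j) ys) (fun x => (x == i)%:R)).
  rewrite mformZ mulrA -rmorphM divff ?gt_eqF// mul1r.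
  pose phis := map (fun i0 => y i0 j) (enum 'I_n).
  have -> : map (fun z => z j) ys = map (fun phi x => iota (phi x)) phis.
    by rewrite /ys /phis -!map_comp.
  rewrite mform_coef; last by rewrite size_map size_enum_ord.
  rewrite (bigD1 i)//= eqxx mul1r big1 ?addr0 => [|c ci]; last first.
    by rewrite (negPf ci) mul0r.
  congr (iota (coord i _)); rewrite /evA /seq_eval; congr A; apply/funext => i0.
  rewrite (nth_map (y i0 j)); last by rewrite /phis size_map size_enum_ord.
  by rewrite (nth_map i0) ?size_enum_ord// nth_ord_enum.
move=> L psi psi1; have := main _ _ psi1.
move=> h; apply: le_trans (ler_wpM2l (powR_ge0 D s) h).
rewrite mulr_sumr; apply: ler_sum => j _.
have D2 : D `^ s = (D ^+ 2) `^ (s / 2).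
  rewrite -[D ^+ 2]powR_mulrn ?(ltW D0)// -powRrM; congr (_ `^ _).
  by rewrite mulrCA divff ?mulr1// pnatr_eq0.
rewrite D2 -powRM ?sqr_ge0 ?sumr_ge0//; last by move=> l _; exact: sqr_ge0.
apply: le_of_eq; congr (_ `^ _).
rewrite mulr_sumr; apply: eq_bigr => l _; rewrite -sqr_normc_scale mulr_sumr.
by congr (normc _ ^+ 2); apply: eq_bigr => i _; rewrite aE mulrCA.
Qed.

End arrays_of_operators.

(** * Finite approximation of the composition *)

Lemma exists_common_delta (R : realType) (I : finType) (Q : I -> R -> Prop) :
  (forall i, exists2 delta, 0 < delta & Q i delta) ->
  (forall i delta delta', delta' <= delta -> Q i delta -> Q i delta') ->
  exists2 delta, 0 < delta & forall i, Q i delta.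
Proof.
move=> hQ monoQ.
have /choice[de hde] i : exists delta, 0 < delta /\ Q i delta.
  by have [delta] := hQ i; exists delta.
have [h hh] := exists_scale de.
exists (2 ^+ h)^-1 => [|i]; first by rewrite invr_gt0 exprn_gt0.
apply: monoQ (hde i).2; have := hh i (hde i).1.
by rewrite -ler_pdivrMr ?exprn_gt0// mul1r.
Qed.

Section finite_approximation.
Context (R : realType) (k : scalars).
Notation K := (scalar_field R k).

Lemma normc_le_ReIm (z : R[i]) : normc z <= `|Re z| + `|Im z|.
Proof.
rewrite -ler_sqr ?nnegrE ?normc_ge0 ?addr_ge0// sqr_normc sqrrD !real_normK ?num_real//.
by rewrite lerD2r lerDl mulrn_wge0// mulr_ge0.
Qed.

Lemma iotaB (x y : K) : iota (x - y) = iota x - iota y.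
Proof. by rewrite /iota; case: k x y => //= x y; rewrite rmorphB. Qed.

Lemma quantize (I : finType) (x : I -> ell_oo R k) (delta : R) : 0 < delta ->
  exists P (q rep : nat -> nat), (forall t, (q t < P)%N) /\
    forall i t, modulus (x i t - x i (rep (q t))) <= delta.
Proof.
move=> d0.
pose part (g : I * bool) t : R :=
  if g.2 then Re (iota (x g.1 t)) else Im (iota (x g.1 t)).
have partB g t : `|part g t| <= \sum_i rnorm (x i).
  have le1 : normc (iota (x g.1 t)) <= \sum_i rnorm (x i).
    rewrite normc_iota; apply: le_trans (ell_oo_coord_le _ _) _.
    by rewrite (bigD1 g.1)//= lerDl sumr_ge0// => i _; exact: rnorm_ge0.
  apply: le_trans le1; rewrite /part; case: ifP => _; first exact: normc_Re_le.
  exact: normc_Im_le.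
have [|P [q [rep [qP hq]]]] := @quantize_real R _ part _ (delta / 2) partB.
  by rewrite divr_gt0.
exists P, q, rep; split=> // i t; rewrite -normc_iota iotaB.
apply: le_trans (normc_le_ReIm _) _.
have := hq (i, true) t; have := hq (i, false) t; rewrite /part/=.
rewrite -raddfB -[X in _ -> `|X| <= _ -> _]raddfB; lra.
Qed.

Section cells.
Context (q : nat -> nat) (P : nat).
Hypothesis qP : forall t, (q t < P)%N.

Lemma cell_in_ell_oo c : (fun t => (q t == c)%:R : K) \in ell_pred R k +oo%E.
Proof.
apply: (@bounded_in_ell_oo _ _ _ 1) => t.
by rewrite modulus_nat lern1 leq_b1.
Qed.

(** The indicator of a level set of q.  Cells are disjoint, so the norm of a
    combination of them is at most the largest coefficient. *)
Definition cell (c : 'I_P) : ell_oo R k := Ell (leey 1%E) (cell_in_ell_oo c).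

Lemma sum_cell (phi : 'I_P -> K) t : (\sum_c phi c *: cell c) t = phi (Ordinal (qP t)).
Proof.
rewrite ell_sum (bigD1 (Ordinal (qP t)))// ellZ/= eqxx mulr1 big1 ?addr0// => c ct.
rewrite -[LHS]/(phi c * (q t == c)%:R) (_ : (q t == c) = false) ?mulr0//.
by apply/negP => /eqP tc; move/eqP: ct; apply; apply/val_inj.
Qed.

Lemma sum_cell_le (phi : 'I_P -> K) : (forall c, modulus (phi c) <= 1) ->
  rnorm (\sum_c phi c *: cell c) <= 1.
Proof. by move=> phi1; apply: ell_oo_norm_le => t; rewrite sum_cell. Qed.

End cells.

(** Quantization replaces the x_j by combinations of cells; then the values of
    the A_a are truncated.  The number of cells is enlarged, with empty cells, to
    the length of the truncation, so that one index set serves all slots of the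
    arrays. *)
Lemma block_comp_approximation (m n : nat) (G : normedModType K)
    (T : ('I_m -> ell_1 R k) -> G) (A : 'I_m -> ('I_n -> ell_oo R k) -> ell_1 R k)
    (J : finType) (x : 'I_(m * n) -> J -> ell_oo R k) (eps : R) :
  multilinear_operators T -> (forall a : 'I_m, multilinear_operators (A a)) -> 0 < eps ->
  exists P (rep : 'I_P -> nat) (e : 'I_P -> ell_oo R k),
    (forall phi : 'I_P -> K, (forall c, modulus (phi c) <= 1) ->
      rnorm (\sum_c phi c *: e c) <= 1) /\
    forall j, rnorm (block_comp T A (fun i => x i j) -
      T (fun a => vec (fun i : 'I_P =>
        coord i (A a (fun b => \sum_c x (block_index a b) j (rep c) *: e c))))) <= eps.
Proof.
move=> T_mult A_mult e0; have e20 : 0 < eps / 2 by rewrite divr_gt0.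
have [S_lin [CS hS]] := block_comp_bounded T_mult A_mult.
have [T_lin [CT hT]] := T_mult.
pose S := block_comp T A.
have [|j d d' dd' hd x' xx'|de de0 hde] := @exists_common_delta R J (fun j delta =>
  forall x', (forall i, rnorm (x i j - x' i) <= delta) ->
    rnorm (S (fun i => x i j) - S x') <= eps / 2).
- by move=> j; exact: (multilinear_continuous S_lin (C := CS)).
- by apply: hd => i; exact: le_trans (xx' i) dd'.
have [P0 [q [rep [qP0 hq]]]] := @quantize _ (fun g : 'I_(m * n) * J => x g.1 g.2) de de0.
pose x' P i j := \sum_(c < P) x i j (rep c) *: cell q c.
have x'E P : (P0 <= P)%N -> x' P = x' P0.
  move=> P0P; apply/funext => i; apply/funext => j; apply: ell_ext => t.
  have qP t' : (q t' < P)%N by exact: leq_trans (qP0 t') P0P.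
  by rewrite /x' (sum_cell qP) (sum_cell qP0).
have S_close j : rnorm (S (fun i => x i j) - S (fun i => x' P0 i j)) <= eps / 2.
  apply: hde => i; apply: ell_oo_norm_le => t.
  rewrite -[(x i j - x' P0 i j) t]/(x i j t - x' P0 i j t) /x' (sum_cell qP0).
  exact: (hq (i, j)).
pose z j a := A a (fun b => x' P0 (block_index a b) j).
have [|j d d' dd' hd z' zz'|de' de'0 hde'] := @exists_common_delta R J (fun j delta =>
  forall z', (forall a, rnorm (z j a - z' a) <= delta) ->
    rnorm (T (z j) - T z') <= eps / 2).
- by move=> j; exact: (multilinear_continuous T_lin (C := CT)).
- by apply: hd => a; exact: le_trans (zz' a) dd'.
have /choice[M hM] (g : J * 'I_m) : exists M, forall P, (M <= P)%N ->
    rnorm (z g.1 g.2 - truncation P (z g.1 g.2)) <= de'.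
  exact: truncation_error.
pose P := (P0 + \sum_g M g)%N.
have MP g : (M g <= P)%N.
  by rewrite /P (bigD1 g)//= addnCA leq_addr.
have P0P : (P0 <= P)%N by exact: leq_addr.
have qP t : (q t < P)%N by exact: leq_trans (qP0 t) P0P.
exists P, (fun c => rep c), (@cell q P); split; first by exact: (sum_cell_le qP).
move=> j; rewrite -(subrKA (S (fun i => x' P0 i j))).
apply: le_trans (rnormD _ _) _; rewrite [leRHS]splitr; apply: lerD; first exact: S_close.
apply: hde' => a; rewrite -[X in _ - X]/(truncation P (A a (fun b => x' P (block_index a b) j))).
by rewrite x'E//; exact: (hM (j, a)).
Qed.

End finite_approximation.

(** * The power sum of the composition *)

Section main_bound.
Context (R : realType) (k : scalars).
Notation K := (scalar_field R k).

Lemma hilbert_summable_le (J X : finType) (sigma K0 K1 : R) (a : J -> X -> R[i]) :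
  K0 <= K1 -> hilbert_summable sigma K0 a -> hilbert_summable sigma K1 a.
Proof. by move=> K01 ha L psi psi1; exact: le_trans (ha L psi psi1) K01. Qed.

(** In all cases 1/r = m/s - m/2 + g with g <= 1/2 the gain of l_p.  As m >= 1
    this also gives 1/r <= m/s. *)
Lemma summing_exponent_bound m (s : R) (p : \bar R) (p1 : (1 <= p)%E)
    (T : ('I_m -> ell_1 R k) -> ell R k p1) (K0 : R) :
  (0 < m)%N -> multilinear_operators T -> 1 <= s -> 0 < summing_denom m s p -> 0 < K0 ->
  let r := summing_exponent m s p in
  [/\ 0 < r, r^-1 <= m%:R / s &
    exists2 B : R, 0 <= B & forall (J : finType) P (al : 'I_m -> J -> 'I_P -> K),
      (forall a, hilbert_summable (s / 2) K0 (fun j i => iota (al a j i))) ->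
      \sum_j rnorm (T (fun a => vec (al a j))) `^ r <= B].
Proof.
move=> m0 T_mult s1 denom0 K00 r.
have s0 : 0 < s by exact: lt_le_trans s1.
have ms0 : s != 0 by rewrite gt_eqF.
have m1 : 1 <= m%:R :> R by rewrite ler1n.
case: p p1 T T_mult denom0 @r => [t||] p1 T T_mult denom0 r.
- have t1 : 1 <= t by rewrite -lee_fin.
  have t0 : 0 < t by exact: lt_le_trans t1.
  have mt0 : t != 0 by rewrite gt_eqF.
  have r0 : 0 < r by rewrite divr_gt0// !mulr_gt0.
  have rE : r^-1 = m%:R / s - m%:R / 2 + lp_gain t.
    rewrite /r /summing_exponent /summing_num /summing_denom invf_div /lp_gain.
    by case: ifP => _; field; rewrite ms0 mt0.
  have gain_le : lp_gain t <= 2^-1.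
    rewrite /lp_gain; case: (leP t 2) => t2.
      have : 2^-1 <= t^-1 by rewrite lef_pV2 ?posrE.
      by move: t^-1 => u; lra.
    by rewrite lef_pV2 ?posrE ?(ltW t2).
  split=> //; first by rewrite rE; lra.
  have [t_gt1|t_le1] := ltP 1 t; first exact: vec_bound_lp rE.
  have tE : t = 1 by apply/eqP; rewrite eq_le t_le1.
  apply: (vec_bound_l1 T_mult s1 K00 r0).
  by rewrite rE /lp_gain tE ler1n invr1 subrr addr0.
- have r0 : 0 < r by rewrite divr_gt0// mulr_gt0.
  have rE : r^-1 = m%:R / s - m%:R / 2.
    rewrite /r /summing_exponent /summing_num /summing_denom invf_div.
    by field; rewrite ms0.
  split=> //; first by rewrite rE; lra.
  exact: (vec_bound_l1 T_mult s1 K00 r0 rE).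
- by have := p1.
Qed.

(** The error of the approximation is at most half of every nonzero term, so
    that each term is at most twice its approximation. *)
Lemma block_comp_summable (m n : nat) (p : \bar R) (p1 : (1 <= p)%E)
    (T : ('I_m -> ell_1 R k) -> ell R k p1)
    (A : 'I_m -> ('I_n -> ell_oo R k) -> ell_1 R k) (s : R) :
  (0 < m)%N -> (2 <= n)%N -> multilinear_operators T ->
  (forall a : 'I_m, multilinear_operators (A a)) ->
  1 <= s -> 0 < summing_denom m s p ->
  let r := summing_exponent m s p in
  [/\ 0 < r, r^-1 <= m%:R / s & exists2 B : R, 0 <= B &
    forall (J : finType) (x : 'I_(m * n) -> J -> ell_oo R k),
      (forall i t, \sum_j modulus (x i j t) `^ (2 * s) <= 1) ->
      \sum_j rnorm (block_comp T A (fun i => x i j)) `^ r <= B].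
Proof.
move=> m0 n2 T_mult A_mult s1 denom0 r.
have /choice[CA hCA] (a : 'I_m) : exists C : R, forall x, rnorm (A a x) <= C * \prod_(i < n) rnorm (x i).
  by have [_] := A_mult a.
pose D := 1 + \sum_a `|CA a|.
have D1 : 1 <= D by rewrite lerDl sumr_ge0.
have hD a x : rnorm (A a x) <= D * \prod_(i < n) rnorm (x i).
  apply: le_trans (hCA a x) _; rewrite ler_wpM2r//.
    by apply: prodr_ge0 => i _; exact: rnorm_ge0.
  apply: le_trans (ler_norm _) _; rewrite /D (bigD1 a)//= addrCA lerDl addr_ge0//.
  exact: sumr_ge0.
have c0 : 0 <= operator_const n D s by rewrite mulr_ge0 ?powR_ge0.
have K00 : 0 < operator_const n D s + 1 by rewrite ltr_wpDl.
have [r0 r_le [B B0 hB]] := summing_exponent_bound m0 T_mult s1 denom0 K00.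
split=> //; exists (2 `^ r * B) => [|J x x1]; first by rewrite mulr_ge0 ?powR_ge0.
pose w j := rnorm (block_comp T A (fun i => x i j)).
have [h hh] := exists_scale w.
have e0 : 0 < (2 ^+ h)^-1 / 2 :> R by rewrite divr_gt0// invr_gt0 exprn_gt0.
have [P [rep [e [e_le approx]]]] := block_comp_approximation x T_mult A_mult e0.
pose al a j (i : 'I_P) : K :=
  coord i (A a (fun b => \sum_c x (block_index a b) j (rep c) *: e c)).
have al_summable a : hilbert_summable (s / 2) (operator_const n D s + 1)
    (fun j i => iota (al a j i)).
  apply: (@hilbert_summable_le _ _ _ (operator_const n D s)); first by rewrite lerDl.
  have [A_lin _] := A_mult a.
  apply: (operator_hilbert_summable A_lin D1 (hD a) e_le
    (y := fun b j c => x (block_index a b) j (rep c))) => // b c; exact: x1.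
have wT j : w j <= 2 * rnorm (T (fun a => vec (al a j))).
  have [w0|] := ltP 0 (w j); last by move=> /le_trans; apply; rewrite mulr_ge0 ?rnorm_ge0.
  have ew : (2 ^+ h)^-1 <= w j.
    by have := hh j w0; rewrite -ler_pdivrMr ?exprn_gt0// mul1r.
  have := approx j; rewrite -/(al _ _ _) => ap.
  have := rnormD (block_comp T A (fun i => x i j) - T (fun a => vec (al a j)))
    (T (fun a => vec (al a j))).
  rewrite subrK -/(w j); move: ap ew.
  rewrite -[X in X <= _ -> _]/(rnorm (block_comp T A (fun i => x i j) - T (fun a => vec (al a j)))).
  by move: (2 ^+ h)^-1 => d; lra.
apply: (@le_trans _ _ (\sum_j 2 `^ r * rnorm (T (fun a => vec (al a j))) `^ r)).
  apply: ler_sum => j _; rewrite -powRM ?rnorm_ge0//.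
  by apply: le_powR_base; rewrite ?(ltW r0) ?rnorm_ge0//; exact: wT.
by rewrite -mulr_sumr ler_wpM2l ?powR_ge0//; exact: hB.
Qed.

End main_bound.

(** * From coordinates to weak norms *)

Section weak_norms.
Context (R : realType) (k : scalars).
Notation K := (scalar_field R k).

Lemma coord_dual_ball t : dual_ball (coord t : {scalar ell_oo R k}).
Proof.
move=> v; rewrite -[`|_ v|]modulusE -rnormE ler_of_real; exact: ell_oo_coord_le.
Qed.

Lemma weak_norm_ge0 (E : normedModType K) (q : R) (x : nat -> E) : (0 <= weak_norm q x)%E.
Proof.
apply: (@le_trans _ _ (lnorm q%:E (fun j => modulus ((\0 : {scalar E}) (x j))))).
  exact: lnorm_ge0.
by apply: ereal_sup_ubound; exists \0 => // v /=; rewrite normr0.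
Qed.

Lemma weak_norm_coord (q : R) (x : nat -> ell_oo R k) (c : R) : 0 < q ->
  weak_norm q x = c%:E -> forall t N, \sum_(j < N) modulus (x j t) `^ q <= c `^ q.
Proof.
move=> q0 xc t N; have := @lnorm_partial_le R q (fun j => modulus (x j t)) c q0.
rewrite -xc => /(_ (ereal_sup_ubound _)) h.
have := h (ex_intro2 _ _ _ (@coord_dual_ball t) erefl) N.
by under eq_bigr do rewrite normr_modulus.
Qed.

Lemma modulus_of_real (c : R) : 0 <= c -> modulus (of_real R k c) = c.
Proof.
move=> c0; apply: (can_inj (@of_realK R k)); rewrite modulusE ger0_norm//.
by rewrite -[leLHS](of_real0 R k) ler_of_real.
Qed.

(** Sequences of weak norm W_i > 0 are divided by W_i, and S is zero if some W_i
    vanishes. *)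
Lemma absolutely_summing_of_normalized (N : nat) (F : normedModType K)
    (S : ('I_N -> ell_oo R k) -> F) (r q B : R) :
  @bounded_multilinear R k N (fun=> ell_oo R k) F S ->
  0 < r -> 1 <= q -> r^-1 <= N%:R / q -> 0 <= B ->
  (forall (J : finType) (x : 'I_N -> J -> ell_oo R k),
    (forall i t, \sum_j modulus (x i j t) `^ q <= 1) ->
    \sum_j rnorm (S (fun i => x i j)) `^ r <= B) ->
  @absolutely_summing R k N (fun=> ell_oo R k) F r q S.
Proof.
move=> S_mult r0 q1 rq B0 hB; have [S_lin _] := S_mult.
have q0 : 0 < q by exact: lt_le_trans q1.
have C0 : 0 < B `^ r^-1 + 1 by rewrite ltr_wpDl ?powR_ge0.
split=> //; exists (B `^ r^-1 + 1) => // x x_fin.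
pose W i := fine (weak_norm q (x i)).
have WE i : weak_norm q (x i) = (W i)%:E.
  by rewrite /W fineK// ge0_fin_numE ?x_fin// weak_norm_ge0.
have W0 i : 0 <= W i by rewrite -lee_fin -WE weak_norm_ge0.
have xW i := weak_norm_coord q0 (WE i).
have Wprod0 : 0 <= \prod_i W i by exact: prodr_ge0.
have main M : \sum_(j < M) `|rnorm (S (fun i => x i j))| `^ r <= B * (\prod_i W i) `^ r.
  rewrite (eq_bigr (fun j : 'I_M => rnorm (S (fun i => x i j)) `^ r)) => [|j _]; last first.
    by congr (_ `^ _); apply: ger0_norm; exact: rnorm_ge0.
  have [/existsP[i /eqP Wi]|/existsPn W_neq0] := boolP [exists i, W i == 0].
    rewrite big1 ?mulr_ge0 ?powR_ge0// => j _.
    have xi : x i j = 0.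
      apply: ell_ext => t; apply: modulus_eq0; apply/eqP.
      have := xW i t j.+1; rewrite Wi powR0 ?(gt_eqF q0)// big_ord_recr/= => h.
      have : modulus (x i j t) `^ q <= 0.
        apply: le_trans h; rewrite lerDr sumr_ge0// => l _; exact: powR_ge0.
      by rewrite le_eqVlt ltNge powR_ge0 orbF powR_eq0 => /andP[].
    rewrite (multilinear_eq0 S_lin (i := i)) ?xi//.
    by rewrite -(scale0r (0 : F)) rnormZ modulus0 mul0r powR0 ?gt_eqF.
  have Wgt0 i : 0 < W i by rewrite lt_def W_neq0 W0.
  pose y i (j : 'I_M) := of_real R k (W i)^-1 *: x i j.
  have y1 i t : \sum_j modulus (y i j t) `^ q <= 1.
    have E j : modulus (y i j t) `^ q = modulus (x i j t) `^ q / W i `^ q.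
      rewrite /y ellZ modulusM modulus_of_real ?invr_ge0// powRM ?invr_ge0 ?modulus_ge0//.
      by rewrite powR_invl// mulrC.
    under eq_bigr do rewrite E.
    by rewrite -mulr_suml ler_pdivrMr ?powR_gt0// mul1r; exact: xW.
  have E j : rnorm (S (fun i => x i (j : 'I_M))) `^ r =
      (\prod_i W i) `^ r * rnorm (S (fun i => y i j)) `^ r.
    rewrite /y (multilinear_scale S_lin (fun i => of_real R k (W i)^-1)) rnormZ.
    rewrite -powRM ?mulr_ge0 ?rnorm_ge0 ?modulus_ge0//; congr (_ `^ _).
    have -> : modulus (\prod_i of_real R k (W i)^-1) = (\prod_i W i)^-1.
      rewrite -prodfV; elim/big_ind2: _ => [|a b a' b' <- <-|i _].
      - exact: (@modulus_nat R k true).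
      - exact: modulusM.
      - by rewrite modulus_of_real ?invr_ge0.
    by rewrite mulrA divff ?mul1r// gt_eqF// prodr_gt0.
  by under eq_bigr do rewrite E; rewrite -mulr_sumr mulrC ler_wpM2r ?powR_ge0//; exact: hB.
have -> : (\prod_(i < N) weak_norm q (x i))%E = (\prod_i W i)%:E.
  rewrite (eq_bigr (fun i => (W i)%:E)) => [|i _]; last exact: WE.
  by elim/big_ind2: _ => // ? ? ? ? -> ->.
apply: (le_trans (lnorm_le_partial r0 _ main)); first by rewrite mulr_ge0 ?powR_ge0.
rewrite lee_fin powRM ?powR_ge0// -powRrM divff ?gt_eqF// powRr1//.
by rewrite ler_wpM2r// lerDl.
Qed.

End weak_norms.

Theorem theorem5p2 (R : realType) (k : scalars) (m n : nat)
  (m_gt0 : (0 < m)%N) (n_ge2 : (2 <= n)%N)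
  (p : \bar R) (p1 : (1 <= p)%E)
  (T : ('I_m -> ell_1 R k) -> ell R k p1)
  (T_mult : multilinear_operators T)
  (A : 'I_m -> ('I_n -> ell_oo R k) -> ell_1 R k)
  (A_mult : forall i : 'I_m, multilinear_operators (A i))
  (s : R) (s_ge1 : 1 <= s) (denom_gt0 : 0 < summing_denom m s p) :
  absolutely_summing (E := fun=> ell_oo R k)
    (summing_exponent m s p) (2 * s) (block_comp T A).
Proof.
have [r0 r_le [B B0 hB]] := block_comp_summable m_gt0 n_ge2 T_mult A_mult s_ge1 denom_gt0.
apply: absolutely_summing_of_normalized B0 hB => //.
- exact: block_comp_bounded.
- lra.
- apply: le_trans r_le _; have s0 : 0 < s by exact: lt_le_trans s_ge1.
  have n2 : 2 <= n%:R :> R by rewrite ler_nat.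
  rewrite natrM -mulrA ler_wpM2l// invfM mulrA -[leLHS]mul1r.
  by rewrite ler_wpM2r ?invr_ge0 ?(ltW s0)// ler_pdivlMr// mul1r.
Qed.
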